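(* Let $A$ be a set of measurable functions $\alpha:[0,1]^{d+1}\to\mathbb R$ such that: (i) there is a countable subset $A'\subset A$ with $\sup_{\alpha\in A'}P_n(\ell_\alpha)=\sup_{\alpha\in A}P_n(\ell_\alpha)$ almost surely; (ii) there is $b>0$ with $\|\alpha\|_\infty\le b$ for every $\alpha\in A$. Assume that the support of $P_X$ is $[0,1]^d$ and $\|\alpha_0\|_\infty<\infty$. Let $\alpha_*\in A$ be the target function. Then for any $x>0$, $$\sup_{\alpha\in A}\sqrt n\,(P-P_n)(\ell_\alpha-\ell_{\alpha_*})\le c\Big(\gamma_2(A,d_2)(1+\sqrt x)+\gamma_1(A,d_\infty)\frac{1+x}{\sqrt n}\Big)$$ with probability larger than $1-Le^{-x}$, where $c=4(b+\|\alpha_0\|_\infty)+2\big([\sqrt2(\sqrt2+1)\|\alpha_0\|_\infty]^{1/2}+1\big)$ and $L$ is an absolute constant ($L\approx1.545433$).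
   Context: Model. On a probability space with a filtration $(\mathcal F_t)_{t\ge0}$ satisfying the usual conditions, $N$ is a counting process (unit jumps, $N(0)=0$) with compensator $\Lambda(t)=\int_0^t\alpha_0(u,X)Y(u)\,du$, so $M=N-\Lambda$ is a martingale; here $\alpha_0\ge0$ is an unknown deterministic measurable function (the intensity), $X\in\mathbb R^d$ is an $\mathcal F_0$-measurable random vector (covariates) with law $P_X$, and $Y$ is a predictable process with values in $[0,1]$. One observes $n$ i.i.d. copies $D_n=\{(X_i,N^i(t),Y^i(t)):t\in[0,1],1\le i\le n\}$ of $(X,N,Y)$; $M^i$ are the corresponding independent martingales. Probabilities are with respect to the law of $D_n$. Norms. $\|\alpha\|_\infty=\sup_{(t,x)\in[0,1]^{d+1}}|\alpha(t,x)|$; $\langle\alpha,\beta\rangle=\int\int_0^1\alpha(t,x)\beta(t,x)\,\mathbb E[Y(t)|X=x]\,dt\,P_X(dx)$, $\|\alpha\|^2=\langle\alpha,\alpha\rangle$; $d_2(a,b)=\|a-b\|$, $d_\infty(a,b)=\|a-b\|_\infty$. Risks. $\ell_\alpha(X,Y,N)=\int_0^1\alpha(t,X)^2Y(t)dt-2\int_0^1\alpha(t,X)dN(t)$; $P_n(\ell_\alpha)=\frac1n\sum_{i=1}^n\ell_\alpha(X_i,Y^i,N^i)$; $P(\ell_\alpha)=\mathbb E[\ell_\alpha(X,Y,N)]$ (for $(X,Y,N)$ independent of $D_n$), which equals $\|\alpha\|^2-2\langle\alpha,\alpha_0\rangle$. Both are extended linearly, e.g. $P(\ell_\alpha-\ell_\beta)=P(\ell_\alpha)-P(\ell_\beta)$.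 Target. $\alpha_*\in A$ is a fixed element with $P(\ell_{\alpha_*})=\inf_{\alpha\in A}P(\ell_\alpha)$ (if no minimizer exists, a fixed element with $P(\ell_{\alpha_*})\le\inf_{\alpha\in A}P(\ell_\alpha)+\rho$ for a given $\rho>0$). Generic chaining functionals. For a set $A$ with a (semi-)distance $d$, $\Delta(B,d)=\sup_{a,b\in B}d(a,b)$. An admissible sequence of $A$ is an increasing sequence $(\mathcal A_j)_{j\ge0}$ of partitions of $A$ (each set of $\mathcal A_{j+1}$ is contained in a set of $\mathcal A_j$) with $|\mathcal A_0|=1$ and $|\mathcal A_j|\le2^{2^j}$; $A_j(a)$ is the element of $\mathcal A_j$ containing $a$. For $\nu>0$, $\gamma_\nu(A,d)=\inf\sup_{a\in A}\sum_{j\ge0}2^{j/\nu}\Delta(A_j(a),d)$, the infimum being over all admissible sequences. *)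

(* Defs.v *)
From HB Require Import structures.
From mathcomp Require Import all_boot all_order all_algebra.
From mathcomp Require Import all_classical all_reals all_analysis.

Set Implicit Arguments.
Unset Strict Implicit.
Unset Printing Implicit Defensive.

Import Order.TTheory GRing.Theory Num.Theory.
Import numFieldTopology.Exports numFieldNormedType.Exports.

Local Open Scope classical_set_scope.
Local Open Scope ring_scope.

Definition borel (R : realType) (k : nat) :=
  g_sigma_algebraType (@open 'rV[R]_k).

Definition unit_cube (R : realType) (k : nat) : set (borel R k) :=
  [set x : 'rV[R]_k | forall i, 0 <= x ord0 i <= 1].

Definition time_cube (R : realType) (k : nat) : set (R * borel R k) :=
  `[0, 1] `*` @unit_cube R k.

Definition measure_support (R : realType) (k : nat)
    (mu : {measure set (borel R k) -> \bar R}) : set (borel R k) :=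
  [set x | forall U : set 'rV[R]_k, open U -> U x -> (0 < mu U)%E].

(** A measurable function [0,1]^(k+1) -> R is encoded, bijectively, by its
    extension by 0 to R * R^k.  This makes a(t, X) meaningful on the null event
    where X is outside [0,1]^k. *)
Definition cube_function (R : realType) (k : nat) (a : R * borel R k -> R) :=
  measurable_fun [set: R * borel R k] a /\
  forall z, ~ time_cube z -> a z = 0.

Definition sup_norm (R : realType) (k : nat) (a : R * borel R k -> R) : \bar R :=
  ereal_sup [set `|a z|%:E | z in @time_cube R k].

Definition d_infty (R : realType) (k : nat) (a a' : R * borel R k -> R) :=
  sup_norm (a \- a').

Section generic_chaining.
Context (R : realType) (V : Type).
Implicit Types (A B : set V) (d : V -> V -> \bar R).

Definition diameter d B : \bar R := ereal_sup [set d p.1 p.2 | p in B `*` B].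

Record admissible A (AA : nat -> set (set V)) : Prop := {
  admissible_partition : forall j, partition (AA j) id A ;
  admissible_refine : forall j B, AA j.+1 B -> exists2 C, AA j C & B `<=` C ;
  admissible_card0 : (AA 0%N #= `I_1)%card ;
  admissible_card : forall j, (AA j #<= `I_(2 ^ (2 ^ j)))%card }.

Definition chaining_gamma (nu : R) A d : \bar R :=
  ereal_inf [set ereal_sup
    [set (\sum_(0 <= j <oo)
            (2 `^ (j%:R / nu))%:E * diameter d (pblock (AA j) id a))%E
    | a in A] | AA in admissible A].

End generic_chaining.

(** The time index is R, but only times t >= 0 are constrained. *)

Section processes.
Context (R : realType) (dT : measure_display) (T : measurableType dT)
  (P : probability T R) (F : R -> set (set T)).

Record usual_conditions : Prop := {
  filtration_sigma_algebra : forall t, 0 <= t -> sigma_algebra setT (F t) ;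
  filtration_measurable : forall t, 0 <= t -> F t `<=` measurable ;
  filtration_nondecreasing : forall s t, 0 <= s -> s <= t -> F s `<=` F t ;
  filtration_right_continuous :
    forall t, 0 <= t -> F t = \bigcap_(s in [set s | t < s]) F s ;
  filtration_complete : forall B, P.-negligible B -> F 0 B }.

Definition adapted (Z : R -> T -> R) :=
  forall t, 0 <= t -> preimage_set_system setT (Z t) measurable `<=` F t.

(** The last clause and adaptedness say that Z s is a version of the
    conditional expectation of Z t given F s. *)
Definition martingale (Z : R -> T -> R) :=
  [/\ adapted Z,
      forall t, 0 <= t -> P.-integrable setT (EFin \o Z t) &
      forall s t, 0 <= s -> s <= t -> forall B, F s B ->
        (\int[P]_(w in B) (Z t w)%:E = \int[P]_(w in B) (Z s w)%:E)%E].

Definition predictable_rectangles : set (set (R * T)) :=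
  [set [set 0] `*` B | B in F 0] `|`
  [set C | exists s t B, [/\ 0 <= s, s <= t, F s B & C = `]s, t] `*` B]].

Definition predictable (Z : R -> T -> R) :=
  preimage_set_system [set z | 0 <= z.1] (fun z => Z z.1 z.2) measurable
  `<=` <<s [set z | 0 <= z.1], predictable_rectangles >>.

(** Monotonicity and right-continuity of the paths come from [cumulative]; the
    last clause says that the jumps have size (at most) one. *)
Definition counting_process (N : T -> cumulative R R) :=
  [/\ adapted (fun t w => N w t),
      forall w, N w 0 = 0,
      forall w t, 0 <= t -> exists m : nat, N w t = m%:R &
      forall w t, 0 < t -> N w t - lim (N w s @[s --> t^'-]) <= 1].

End processes.

Section model.
Context (R : realType) (k : nat) (dT : measure_display) (T : measurableType dT)
  (P : probability T R) (F : R -> set (set T))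
  (alpha0 : R * borel R k -> R) (X : {RV P >-> borel R k})
  (N : T -> cumulative R R) (Y : R -> T -> R).

Definition compensator (t : R) (w : T) : \bar R :=
  (\int[lebesgue_measure]_(u in `[0%R, t]) (alpha0 (u, X w) * Y u w)%:E)%E.

Record counting_model : Prop := {
  model_filtration : usual_conditions P F ;
  model_covariates : preimage_set_system setT X measurable `<=` F 0 ;
  model_counting : counting_process F N ;
  model_predictable : predictable F Y ;
  model_Y01 : forall t w, 0 <= t -> 0 <= Y t w <= 1 ;
  model_alpha0_measurable : measurable_fun [set: R * borel R k] alpha0 ;
  model_alpha0_ge0 : forall z, 0 <= alpha0 z ;
  model_compensator_finite :
    {ae P, forall w, forall t, 0 <= t -> (compensator t w < +oo)%E} ;
  model_martingale : martingale P F (fun t w => N w t - fine (compensator t w)) }.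

(** m(t, x) is a jointly measurable version of E[Y(t) | X = x]. *)
Definition is_cond_mean (m : R * borel R k -> R) :=
  measurable_fun (`[0, 1] `*` setT : set (R * borel R k)) m /\
  forall t, t \in `[0, 1] -> forall B : set (borel R k), measurable B ->
    (\int[distribution P X]_(x in B) (m (t, x))%:E
     = \int[P]_(w in X @^-1` B) (Y t w)%:E)%E.

Definition inner (m a a' : R * borel R k -> R) : R :=
  fine (\int[distribution P X]_x
    \int[lebesgue_measure]_(t in `[0%R, 1%R]) (a (t, x) * a' (t, x) * m (t, x))%:E)%E.

Definition d_2 (m a a' : R * borel R k -> R) : \bar R :=
  (Num.sqrt (inner m (a \- a') (a \- a')))%:E.

End model.

(** The integral against nu is pathwise, in the sense of Lebesgue-Stieltjes. *)
Definition loss (R : realType) (k : nat) (a : R * borel R k -> R)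
    (x : borel R k) (y : R -> R) (nu : cumulative R R) : R :=
  \int[lebesgue_measure]_(t in `[0, 1]) (a (t, x) ^+ 2 * y t)
  - 2 * \int[lebesgue_stieltjes_measure nu]_(t in `]0, 1]) a (t, x).

Definition risk (R : realType) (k : nat) (dT : measure_display)
    (T : measurableType dT) (P : probability T R) (X : T -> borel R k)
    (N : T -> cumulative R R) (Y : R -> T -> R) (a : R * borel R k -> R) : R :=
  fine ('E_P[fun w => loss a (X w) (Y ^~ w) (N w)]).

Definition empirical_risk (R : realType) (k n : nat) (S : Type)
    (Xs : 'I_n -> S -> borel R k) (Ns : 'I_n -> S -> cumulative R R)
    (Ys : 'I_n -> R -> S -> R) (a : R * borel R k -> R) (s : S) : R :=
  n%:R^-1 * \sum_(i < n) loss a (Xs i s) (Ys i ^~ s) (Ns i s).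

(** The observation (x, N(t), Y(t)), t in [0,1], as a point of a path space. *)
Definition observation (R : realType) (k : nat) (x : borel R k)
    (nu : cumulative R R) (y : R -> R) : borel R k * (R -> R) * (R -> R) :=
  (x, (nu : R -> R) \_ `[0, 1], y \_ `[0, 1]).

(** Ds 0, ..., Ds (n-1) are i.i.d. copies of D, whose law is the image of P by D,
    defined on the sets B such that D^-1(B) is measurable; independence of
    subfamilies is obtained by taking some of the B i equal to setT. *)
Definition iid_copies (R : realType) (n : nat) (V : Type)
    (dT : measure_display) (T : measurableType dT) (P : probability T R)
    (dS : measure_display) (S : measurableType dS) (Q : probability S R)
    (D : T -> V) (Ds : 'I_n -> S -> V) :=
  (forall i (B : set V), measurable (D @^-1` B) -> measurable (Ds i @^-1` B)) /\
  (forall B : 'I_n -> set V, (forall i, measurable (D @^-1` B i)) ->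
     Q [set s | forall i, B i (Ds i s)] = (\prod_(i < n) P (D @^-1` B i))%E).

(** A minimizer of r over A or, if there is none, a minimizer up to rho. *)
Definition is_target (R : realType) (V : Type) (r : V -> R) (A : set V) (rho : R)
    (astar : V) :=
  A astar /\
  (r astar = inf [set r a | a in A] \/
   (forall a, A a -> r a <> inf [set r a | a in A]) /\
   r astar <= inf [set r a | a in A] + rho).

Definition chaining_constant (R : realType) (b alpha0_norm : R) : R :=
  4 * (b + alpha0_norm)
  + 2 * (Num.sqrt (Num.sqrt 2 * (Num.sqrt 2 + 1) * alpha0_norm) + 1).

(* Main.v *)
(** Fix a, a' with h = a - a'. The excess loss of one observation is an integral
    2 int h dN minus an integral in time. The process exp (int g dN - int (exp g - 1) dLambda)
    has mean at most 1: on a grid finer than the gaps between jumps it is a product of factors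
    whose increments are compensated, and Fatou's lemma removes the grid. Young's inequality
    splits the exponential of the excess loss into such a process and the exponential of a
    bounded time integral, which gives a Bernstein bound on the moments, with variance factor
    4 S^2 |h|^2 and scale 4/3 S |h|_oo, where 10/3 S is slightly less than the constant c.
    Independence turns it into a mixed tail for the increments of the empirical process.

    The two metrics are chained together along the intersections of the cells of two nearly
    optimal admissible sequences. Level j has at most 16^(2^j) links, each of which is
    allowed to fail with probability exp (- x - 157/50 2^j); as 16 exp (-157/50) <= 7/10,
    the total is at most exp (-x) times the sum of the (7/10)^(2^j), which is less than L.
    For x < 43/100 one has L exp (-x) > 1 and nothing to prove. Both risks are Lipschitz
    in the sup norm along each sample path, so the chains converge to the deviation at a. *)
Require Import Defs.
From HB Require Import structures.
From mathcomp Require Import all_boot all_order all_algebra.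
From mathcomp Require Import all_classical all_reals all_analysis.
From mathcomp Require Import measurable_realfun.
From mathcomp Require Import zify ring lra.

Set Implicit Arguments.
Unset Strict Implicit.
Unset Printing Implicit Defensive.

Import Order.TTheory GRing.Theory Num.Theory.
Import numFieldTopology.Exports numFieldNormedType.Exports.

Local Open Scope classical_set_scope.
Local Open Scope ring_scope.

(** * Scalar estimates *)

Section exponential_bounds.
Context {R : realType}.
Implicit Types u v z M th : R.

(** The constant c is prescribed, and every estimate has to fit into it. Chaining multiplies the
    factor 2 S of the square-root term by 5/3 and the scale 4/3 S by 5/2, so both become 10/3 S.
    What is left of c, at least 1/18, pays for the infima in the chaining functionals, which need
    not be attained.

    Two obstacles shape the stochastic part. The exponential of a counting integral is not known to
    be integrable beforehand, and the intensity is bounded only on the cube; hence the exponential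
    is first cut off at m jumps and restricted to the event that X lies in the cube. Stochastic
    integrals are avoided: the two sides of a compensation identity are measures on time times
    covariates, compared on rectangles, where the martingale property applies directly.

    In the sample, only sets with a measurable preimage under one observation are controlled. Each
    loss is therefore replaced by a variable that is built from such sets and equals it on an event
    of probability one. *)

Definition psi2 u : R := expR u - 1 - u.

Lemma psi2_ge0 u : 0 <= psi2 u.
Proof. by rewrite /psi2; have := expR_ge1Dx u; lra. Qed.

Lemma series_exp_coeffSS u n :
  series (exp_coeff u) n.+2
  = 1 + u + \sum_(i < n) u ^+ i.+2 / (i.+2)`!%:R.
Proof.
rewrite /series/= big_mkord 2!big_ord_recl /= /exp_coeff/=.
by rewrite expr0 expr1 !fact0 ?divr1 addrA; congr (_ + _ + _); rewrite ?divr1.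
Qed.

(** Bounds on the partial sums pass to the limit, so [psi2] can be estimated by comparing power
    series coefficient by coefficient. *)
Lemma psi2_le_series u (B : R) :
  (forall n, \sum_(i < n) u ^+ i.+2 / (i.+2)`!%:R <= B) -> psi2 u <= B.
Proof.
move=> uB; rewrite /psi2 -addrA -opprD lerBlDl.
apply: limr_le; first exact: is_cvg_series_exp_coeff.
exists 2%N => // -[|[|n]] //= _.
by rewrite series_exp_coeffSS lerD2l.
Qed.

Lemma series_le_psi2 u n : 0 <= u ->
  \sum_(i < n) u ^+ i.+2 / (i.+2)`!%:R <= psi2 u.
Proof.
move=> u0; rewrite /psi2 -addrA -opprD lerBrDl -series_exp_coeffSS.
apply: (@nondecreasing_cvgn_le _ (series (exp_coeff u))).
  apply: nondecreasing_series => k _ _; exact: exp_coeff_ge0.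
exact: is_cvg_series_exp_coeff.
Qed.

(** The series of [psi2] starts at degree 2, and [th ^+ i.+2 <= th ^+ 2] for [th] in [0, 1]. Only
    [|u|] enters, so negative [u] are covered. *)
Lemma psi2_le_scaled th M u :
  0 <= th <= 1 -> 0 <= M -> `|u| <= th * M -> psi2 u <= th ^+ 2 * psi2 M.
Proof.
move=> /andP[th0 th1] M0 uM; apply: psi2_le_series => n.
apply: (@le_trans _ _ (th ^+ 2 * \sum_(i < n) M ^+ i.+2 / (i.+2)`!%:R)).
  rewrite mulr_sumr; apply: ler_sum => i _.
  rewrite mulrA ler_pM2r ?invr_gt0 ?ltr0n ?fact_gt0//.
  apply: (le_trans (ler_norm _)); rewrite normrX.
  apply: (le_trans (lerXn2r i.+2 _ _ uM)); rewrite ?nnegrE ?mulr_ge0//.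
  rewrite exprMn ler_wpM2r ?exprn_ge0//.
  by rewrite -addn2 exprD ler_piMl ?exprn_ge0// exprn_ile1.
by rewrite ler_wpM2l ?exprn_ge0// series_le_psi2.
Qed.

(* The coefficient 1/n! is at most (n-1)/2 * 6^(2-n), the coefficient of the
   right-hand side. *)
Lemma psi2_le u : 0 <= u < 6 -> psi2 u <= u ^+ 2 / (2 * (1 - u / 6) ^+ 2).
Proof.
move=> /andP[u0 u6]; apply: psi2_le_series => n.
have coef (i : nat) : u ^+ i.+2 / (i.+2)`!%:R
    <= u ^+ 2 / 2 * (i.+1%:R * (u / 6) ^+ i).
  have -> : u ^+ 2 / 2 * (i.+1%:R * (u / 6) ^+ i)
      = u ^+ i.+2 * (i.+1%:R / (2 * 6 ^+ i)).
    have -> : u ^+ i.+2 = u ^+ i * u ^+ 2 by rewrite -exprD addn2.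
    rewrite exprMn exprVn invfM.
    by move: (i.+1%:R) (u ^+ i) (6 ^+ i)^-1 => c d e; field.
  rewrite ler_wpM2l ?exprn_ge0// ler_pdivlMr ?mulr_gt0 ?exprn_gt0//.
  rewrite mulrC ler_pdivrMr ?ltr0n ?fact_gt0//.
  rewrite -!natrX -!natrM ler_nat.
  (* Equality holds for [i] = 0, 1, 2: the bound agrees with the exponential series up to degree 4,
     which is the origin of the 6. *)
  elim: i => // -[|[|i]] // IH.
  rewrite expnS mulnCA.
  apply: (@leq_trans (6 * (i.+3 * (i.+4)`!))).
    by rewrite leq_mul2l IH.
  by rewrite [in leqRHS]factS !mulnA leq_mul2r; apply/orP; right; nia.
apply: (@le_trans _ _ (u ^+ 2 / 2 * \sum_(i < n) (i.+1%:R * (u / 6) ^+ i))).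
  by rewrite mulr_sumr; apply: ler_sum => i _.
have q1 : u / 6 < 1 by rewrite ltr_pdivrMr// mul1r.
have q0 : 0 <= u / 6 by rewrite divr_ge0.
rewrite invfM mulrA ler_wpM2l ?divr_ge0 ?exprn_ge0//.
move: q0 q1; set q := u / 6 => q0 q1.
rewrite -[leRHS]mul1r ler_pdivlMr ?exprn_gt0 ?subr_gt0//.
(* Closed form of the arithmetic-geometric sum; what matters is that it is at most 1. *)
have -> : (\sum_(i < n) i.+1%:R * q ^+ i) * (1 - q) ^+ 2
    = 1 - n.+1%:R * q ^+ n + n%:R * q ^+ n.+1.
  elim: n => [|n IH]; first by rewrite big_ord0 expr0; ring.
  by rewrite big_ord_recr/= mulrDl IH !exprS -(natr1 n.+1) -(natr1 n); ring.
have : n%:R * q ^+ n.+1 <= n.+1%:R * q ^+ n.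
  rewrite exprS mulrA ler_wpM2r ?exprn_ge0//.
  by apply: (@le_trans _ _ n%:R); rewrite ?ler_piMr ?ler_nat // ltW.
by lra.
Qed.

Lemma psi2_le_bernstein u : 0 <= u < 3 -> psi2 u <= u ^+ 2 / (2 * (1 - u / 3)).
Proof.
move=> /andP[u0 u3]; apply: (le_trans (psi2_le _)).
  by rewrite u0/=; lra.
rewrite ler_wpM2l ?exprn_ge0// lef_pV2 ?posrE; last 2 first.
- by rewrite mulr_gt0 ?exprn_gt0//; lra.
- by rewrite mulr_gt0//; lra.
by rewrite ler_wpM2l//; nra.
Qed.

Lemma psi2_ge0_homo : {in Num.nneg &, {homo psi2 : u v / u <= v}}.
Proof.
move=> u v; rewrite !nnegrE => u0 v0 uv.
have := @psi2_le_scaled 1 v u; rewrite expr1n !mul1r ler01 lexx; apply => //.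
by rewrite ger0_norm.
Qed.

(* psi2 (z' + X') + X' bounds the exponential moment of the part of the
   empirical deviation that is absolutely continuous in time. *)
Lemma mgf_scalar (k z z' X' : R) : 0 <= k <= 5 / 4 -> 0 <= z < 3 / 2 ->
  0 <= z' <= 5 / 6 * z -> 0 <= X' <= k * (z ^+ 2 / 2) ->
  psi2 (z' + X') + X' <= (1 + k) * (z ^+ 2 / 2 / (1 - 2 / 3 * z)).
Proof.
move=> /andP[k0 k54] /andP[z0 z32] /andP[z'0 z'z] /andP[X'0 X'z].
set u := 5 / 6 * z + k * (z ^+ 2 / 2).
have zz : z ^+ 2 <= 9 / 4 by nra.
have kzz : k * (z ^+ 2) <= 5 / 4 * (9 / 4).
  by apply: ler_pM => //; rewrite exprn_ge0.
have u3 : u < 3 by rewrite /u; nra.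
have u0 : 0 <= u by rewrite /u addr_ge0 ?mulr_ge0 ?divr_ge0 ?exprn_ge0.
apply: (@le_trans _ _ (psi2 u + k * (z ^+ 2 / 2))).
  apply: lerD => //; apply: psi2_ge0_homo; rewrite ?nnegrE//.
    by rewrite addr_ge0.
  by rewrite /u lerD.
apply: (@le_trans _ _ (u ^+ 2 / (2 * (1 - u / 3)) + k * (z ^+ 2 / 2))).
  by rewrite lerD2r psi2_le_bernstein// u0.
have d1 : 0 < 1 - u / 3 by lra.
have d2 : 0 < 1 - 2 / 3 * z by lra.
rewrite -subr_ge0.
have -> : (1 + k) * (z ^+ 2 / 2 / (1 - 2 / 3 * z))
    - (u ^+ 2 / (2 * (1 - u / 3)) + k * (z ^+ 2 / 2))
  = (z ^+ 2 / 2) * ((1 + k) * (1 - u / 3)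
     - (5 / 6 + k * z / 2) ^+ 2 * (1 - 2 / 3 * z)
     - k * (1 - 2 / 3 * z) * (1 - u / 3)) / ((1 - 2 / 3 * z) * (1 - u / 3)).
  rewrite /u; field.
  by apply/andP; split; apply/negP => /eqP; rewrite /u in d1 d2; lra.
rewrite divr_ge0 ?mulr_ge0 ?exprn_ge0 ?invr_ge0// ?ltW// ?mulr_gt0//.
rewrite /u {u u3 u0 d1 zz kzz X'z z'z}.
(* In terms of [w] the bracket is affine in [z] with nonnegative slope, and [k <= 5 / 4] gives
   [z >= 4 / 5 * w]. This leaves a cubic in [w] whose minimum on the half-line is near 7/5, whence
   the squares given to [nra]. *)
pose w := k * z; have w0 : 0 <= w by rewrite mulr_ge0.
rewrite (_ : _ - _ = 11 / 36 - w / 6 - w ^+ 2 / 4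
    + z * (10 / 54 + 11 / 54 * w + w ^+ 2 / 18)); last by rewrite /w; field.
have wz : 4 / 5 * w <= z by rewrite /w; nra.
have : 4 / 5 * w * (10 / 54 + 11 / 54 * w + w ^+ 2 / 18)
    <= z * (10 / 54 + 11 / 54 * w + w ^+ 2 / 18).
  by rewrite ler_wpM2r// !addr_ge0// ?mulr_ge0// ?sqr_ge0.
have := mulr_ge0 w0 (sqr_ge0 (w - 7 / 5)).
by have := sqr_ge0 (w - 7 / 5); nra.
Qed.

End exponential_bounds.

(** * Weighted image measures *)

Section weighted_images.
Local Open Scope ereal_scope.
Context d d' (T : measurableType d) (T' : measurableType d') (R : realType)
  (mu : {measure set T -> \bar R}).

Import HBNNSimple.

(** For a simple [g] this is the hypothesis on its level sets; monotone convergence does the rest on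
    both sides. *)
Lemma integral_weighted_image (W : T -> R) (f : T -> T')
    (nu : {measure set T' -> \bar R}) (g : T' -> \bar R) :
  measurable_fun setT W -> (forall x, (0 <= W x)%R) -> measurable_fun setT f ->
  (forall B, measurable B -> nu B = \int[mu]_(x in f @^-1` B) (W x)%:E) ->
  measurable_fun setT g -> (forall y, 0 <= g y) ->
  \int[nu]_y g y = \int[mu]_x (g (f x) * (W x)%:E).
Proof.
move=> mW W0 mf nuE mg g0.
have mWE : measurable_fun setT (EFin \o W) by exact/measurable_EFinP.
pose h := nnsfun_approx measurableT mg.
have hg y : (h n y)%:E @[n --> \oo] --> g y.
  by apply: cvg_nnsfun_approx => // x _; exact: g0.
transitivity (limn (fun n => \int[nu]_x (h n x)%:E)).
  rewrite -monotone_convergence//.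
  - by apply: eq_integral => y _; apply/esym/cvg_lim => //; exact: hg.
  - by move=> n; exact/measurable_EFinP/measurable_funP.
  - by move=> n y _; rewrite lee_fin.
  - by move=> y _ m n mn; rewrite lee_fin; exact/lefP/nd_nnsfun_approx.
have mhf n : measurable_fun setT (fun x => (h n (f x))%:E).
  by apply/measurable_EFinP; apply: measurableT_comp.
transitivity (limn (fun n => \int[mu]_x ((h n (f x))%:E * (W x)%:E))); last first.
  rewrite -monotone_convergence//.
  - apply: eq_integral => x _; apply/cvg_lim => //.
    by apply: cvgeZr => //; exact: hg.
  - by move=> n; apply: emeasurable_funM.
  - by move=> n y _; rewrite mule_ge0 ?lee_fin.
  - move=> y _ m n mn; rewrite lee_wpmul2r ?lee_fin//.
    exact/lefP/nd_nnsfun_approx.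
congr (limn _); apply/funext => n.
have mfp B : measurable B -> measurable (f @^-1` B).
  by move=> mB; rewrite -[X in measurable X]setTI; exact: mf.
transitivity (\sum_(k \in range (h n)) k%:E * nu (h n @^-1` [set k])).
  under eq_integral do rewrite fimfunE -fsumEFin//.
  rewrite ge0_integral_fsum//; last 2 first.
  - by move=> y; exact/measurable_EFinP/measurable_funM.
  - by move=> y x _; rewrite nnfun_muleindic_ge0.
  by apply: eq_fsbigr => r _; rewrite integralZl_indic_nnsfun// integral_indic// setIT.
transitivity (\int[mu]_x \sum_(k \in range (h n))
    ((k * \1_(h n @^-1` [set k]) (f x))%:E * (W x)%:E)); last first.
  apply: eq_integral => x _; rewrite -ge0_mule_fsuml => [|y]; last first.
    exact: nnfun_muleindic_ge0.
  by rewrite fsumEFin// -fimfunE.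
have mi k : measurable_fun setT (fun x : T => \1_(h n @^-1` [set k]) (f x) : R).
  by apply: (measurableT_comp _ mf); exact: measurable_indic.
have mk k : measurable_fun setT (fun x : T => (k * \1_(h n @^-1` [set k]) (f x))%:E).
  by apply/measurable_EFinP/measurable_funM.
rewrite ge0_integral_fsum//; last 2 first.
- by move=> k; apply: emeasurable_funM.
- by move=> k x _; rewrite mule_ge0 ?lee_fin// -lee_fin nnfun_muleindic_ge0.
apply: eq_fsbigr => k /[!inE] -[t _ kE].
have k0 : (0 <= k)%R by rewrite -kE.
under [RHS]eq_integral do rewrite EFinM -muleA.
rewrite ge0_integralZl//=; last 2 first.
- by apply: emeasurable_funM => //; exact/measurable_EFinP.
- by move=> x _; rewrite mule_ge0 ?lee_fin.
rewrite nuE//; congr (_ * _); rewrite integral_mkcond; apply: eq_integral => x _.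
rewrite /patch indicE /=; case: ifPn => [/set_mem xk|/negP xk].
  by rewrite mem_set ?mul1e.
by rewrite memNset ?mul0e// => fxk; apply: xk; exact/mem_set.
Qed.

(** The recurrent tool for extending identities: once two weighted images agree on sets, the
    corresponding integrals agree for every nonnegative [g]. *)
Lemma weighted_image (W : T -> R) (f : T -> T') :
  measurable_fun setT W -> (forall x, (0 <= W x)%R) -> measurable_fun setT f ->
  exists2 nu : {measure set T' -> \bar R},
    (forall B, measurable B -> nu B = \int[mu]_(x in f @^-1` B) (W x)%:E) &
    (forall g, measurable_fun setT g -> (forall y, 0 <= g y) ->
       \int[nu]_y g y = \int[mu]_x (g (f x) * (W x)%:E)).
Proof.
move=> mW W0 mf.
have mWE : measurable_fun setT (EFin \o W) by exact/measurable_EFinP.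
have mfp B : measurable B -> measurable (f @^-1` B).
  by move=> mB; rewrite -[X in measurable X]setTI; exact: mf.
pose n0 (B : set T') := \int[mu]_(x in f @^-1` B) (W x)%:E.
have n00 : n0 set0 = 0 by rewrite /n0 preimage_set0 integral_set0.
have n0_ge0 B : 0 <= n0 B by apply: integral_ge0 => x _; rewrite lee_fin.
have n0s : semi_sigma_additive n0.
  move=> F mF tF mUF; rewrite /n0 preimage_bigcup ge0_integral_bigcup//.
  - by apply: is_cvg_ereal_nneg_natsum => k _; exact: n0_ge0.
  - by move=> k; exact: mfp.
  - by apply: measurable_funTS.
  - by move=> x _; rewrite lee_fin.
  - apply/trivIsetP => /= i j _ _ ij; rewrite -preimage_setI.
    by move/trivIsetP : tF => /(_ _ _ _ _ ij) ->//; rewrite preimage_set0.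
pose nm := isMeasure.Build _ _ _ n0 n00 n0_ge0 n0s.
pose nu : {measure set T' -> \bar R} := HB.pack n0 nm.
by exists nu => // g mg g0; exact: integral_weighted_image.
Qed.

(** A countable superposition is needed for the jumps of a path: one map [f l] for each jump number
    [l]. *)
Lemma weighted_image_series (W : nat -> T -> R) (f : nat -> T -> T') :
  (forall l, measurable_fun setT (W l)) -> (forall l x, (0 <= W l x)%R) ->
  (forall l, measurable_fun setT (f l)) ->
  exists2 nu : {measure set T' -> \bar R},
    (forall B, measurable B ->
       nu B = \sum_(0 <= l <oo) \int[mu]_(x in f l @^-1` B) (W l x)%:E) &
    (forall g, measurable_fun setT g -> (forall y, 0 <= g y) ->
       \int[nu]_y g y = \sum_(0 <= l <oo) \int[mu]_x (g (f l x) * (W l x)%:E)).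
Proof.
move=> mW W0 mf.
have /choice[nus nusE] l : exists nu : {measure set T' -> \bar R},
    forall B, measurable B -> nu B = \int[mu]_(x in f l @^-1` B) (W l x)%:E.
  by have [nu nuE _] := weighted_image (mW l) (W0 l) (mf l); exists nu.
exists (mseries nus 0) => [B mB|g mg g0].
  by rewrite /mseries; apply: eq_eseriesr => l _; exact: nusE.
rewrite ge0_integral_measure_series//; apply: eq_eseriesr => l _.
by apply: integral_weighted_image => //; exact: nusE.
Qed.

End weighted_images.

(** * Paths of counting processes *)

Section counting_paths.
Context {R : realType}.
Implicit Types (nu : cumulative R R) (s t : R) (l : nat).

Definition counting_path nu := [/\ nu 0 = 0,
  forall t, 0 <= t -> exists m : nat, nu t = m%:R &
  forall t, 0 < t -> nu t - lim (nu s @[s --> t^'-]) <= 1].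

Definition jump_count nu t : nat := Num.truncn (nu t).

(** Jumps are numbered from 0. If the path has at most [l] jumps up to time 1, the set is empty and
    the value is 0. *)
Definition jump_time nu l : R :=
  inf [set t | 0 <= t <= 1 /\ (l < jump_count nu t)%N].

(** For 0 <= s <= t <= 1 and a counting path, this is the integral of [phi] over ]s, t] against the
    path, written as a finite sum. *)
Definition jump_sum nu (phi : R -> R) s t : R :=
  \sum_(jump_count nu s <= l < jump_count nu t) phi (jump_time nu l).

Lemma jump_count_le nu s t : s <= t -> (jump_count nu s <= jump_count nu t)%N.
Proof. by move=> st; apply/le_truncn/cumulative_is_nondecreasing. Qed.

Lemma jump_sum_cat nu phi r s t : r <= s -> s <= t ->
  jump_sum nu phi r t = jump_sum nu phi r s + jump_sum nu phi s t.
Proof. by move=> rs st; rewrite /jump_sum -big_cat_nat ?jump_count_le. Qed.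

Lemma stieltjes_itv nu (a b : R) : a <= b ->
  lebesgue_stieltjes_measure nu `]a, b] = (nu b - nu a)%:E.
Proof.
move=> ab; rewrite /lebesgue_stieltjes_measure/= /measure_extension/=.
by rewrite measurable_mu_extE/= ?wlength_itv_bnd//; exact: is_ocitv.
Qed.

(** Uniqueness of measures is applied to the restrictions to ]0, 1], so the path outside [0, 1] does
    not enter. This serves both to write the path measure as a sum of Dirac masses and to see that
    the loss is a function of the observation. *)
Lemma stieltjes_unit_unique (nu : cumulative R R)
    (mu : {measure set (measurableTypeR R) -> \bar R}) :
  (forall a b, 0 <= a -> a <= b -> b <= 1 -> mu `]a, b]%classic = (nu b - nu a)%:E) ->
  forall A : set R, measurable A -> A `<=` `]0, 1] -> lebesgue_stieltjes_measure nu A = mu A.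
Proof.
move=> muE A mA A01.
have mD : measurable (`]0, 1] : set (measurableTypeR R)).
  by apply: sub_sigma_algebra; exact: is_ocitv.
pose m1 : {measure set (measurableTypeR R) -> \bar R} := mrestr (lebesgue_stieltjes_measure nu) mD.
pose m2 : {measure set (measurableTypeR R) -> \bar R} := mrestr mu mD.
suff : m1 A = m2 A by rewrite /m1 /m2/= /mrestr setIidl.
refine (@measure_unique _ R (measurableTypeR R) (@ocitv R) (fun k => `](- k%:R), k%:R]%classic) _ _ _ _ m1 m2 _ _ A mA) => //.
- exact: ocitvI.
- by move=> i; exact: is_ocitv.
- rewrite -subTset => /= x _ /=.
  by exists (Num.bound x); rewrite //= in_itv/= ltrNl unstable.ltrNbound ltW// unstable.ltr_bound.
- move=> _ [[a b] _ <-] /=.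
  rewrite /m1 /m2/= /mrestr/=.
  pose a' := Num.max a 0; pose b' := Num.min b 1.
  have -> : `]a, b] `&` `]0, 1] = `]a', b']%classic :> set R.
    apply/seteqP; split => x /=; rewrite !in_itv/= gt_max le_min.
      by move=> [/andP[-> ->] /andP[-> ->]].
    by move=> /andP[/andP[-> ->] /andP[-> ->]].
  have [ab|ba] := leP a' b'; last first.
    by rewrite (_ : `]a', b']%classic = set0) ?measure0// set_itv_ge// bnd_simp -leNgt ltW.
  by rewrite stieltjes_itv// muE// ?le_max ?ge_min ?lexx ?orbT.
- move=> i; apply: (@le_lt_trans _ _ (lebesgue_stieltjes_measure nu `]0, 1])).
    by apply: le_measure; rewrite ?inE; [apply: measurableI => //; apply: sub_sigma_algebra; exact: is_ocitv|exact: mD|exact: subIsetr].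
  by rewrite stieltjes_itv// ltry.
Qed.

Lemma sum_indicator_nat n p q : (p <= q)%N ->
  (\sum_(l < n) (p <= l < q)%N = minn q n - minn p n)%N.
Proof.
move=> pq; elim: n => [|n IH]; first by rewrite big_ord0 !minn0.
by rewrite big_ord_recr/= IH; lia.
Qed.

Lemma maxr0B (r : R) : Num.max r 0 - Num.max (- r) 0 = r.
Proof.
have [r0|r0] := leP r 0; have [s0|s0] := leP (- r) 0; lra.
Qed.

Section properties.
Context (nu : cumulative R R) (hnu : counting_path nu).

Lemma jump_countE t : 0 <= t -> (jump_count nu t)%:R = nu t.
Proof. by case: hnu => _ + _ => /[apply] -[m]; rewrite /jump_count => ->; rewrite natrK. Qed.

Lemma jump_count0 : jump_count nu 0 = 0%N.
Proof. by case: hnu => nu0 _ _; rewrite /jump_count nu0 truncn0. Qed.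

Let jump_set_has_inf l : (l < jump_count nu 1)%N ->
  has_inf [set t | 0 <= t <= 1 /\ (l < jump_count nu t)%N].
Proof.
by move=> l1; split; [exists 1; rewrite /= ler01 lexx|exists 0 => t [/andP[]]].
Qed.

Lemma jump_time_ge0 l : (l < jump_count nu 1)%N -> 0 <= jump_time nu l.
Proof.
by move=> /jump_set_has_inf[n0 _]; apply: lb_le_inf => // t [/andP[]].
Qed.

(** The infimum is attained: by right-continuity some point of the set is so close to the jump time
    that the path grows by at most 1/2 in between, and an integer-valued path then does not grow at
    all. *)
Lemma jump_time_le l t : (l < jump_count nu 1)%N -> 0 <= t <= 1 ->
  (jump_time nu l <= t) = (l < jump_count nu t)%N.
Proof.
move=> l1 t01; apply/idP/idP => [lt|lt]; last first.
  by apply: ge_inf => //; exists 0 => s [/andP[]].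
have T0 := jump_time_ge0 l1.
suff : (l < jump_count nu (jump_time nu l))%N.
  by move=> /leq_trans; apply; exact: jump_count_le.
have [d dT] := @nondecreasing_right_continuousP _ (jump_time nu l) (2^-1) nu
  (ltac:(by rewrite invr_gt0)).
have [s [s01 ls] sT] := inf_adherent (gt0 d) (jump_set_has_inf l1).
have := @cumulative_is_nondecreasing _ _ _ nu _ _ (ltW sT) => /le_trans /(_ dT).
rewrite -(jump_countE T0) -(jump_countE (proj1 (andP s01))) => H.
rewrite (leq_trans ls)// -ltnS -(ltr_nat R) (le_lt_trans H)//.
by rewrite -[ltRHS]natr1 ltrD2l invf_lt1 ?ltr1n.
Qed.

Lemma jump_time_gt0 l : (l < jump_count nu 1)%N -> 0 < jump_time nu l.
Proof.
by move=> l1; rewrite ltNge jump_time_le ?lexx ?ler01// jump_count0.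
Qed.

Lemma jump_time_le1 l : (l < jump_count nu 1)%N -> jump_time nu l <= 1.
Proof. by move=> l1; rewrite jump_time_le// ler01 lexx. Qed.

Lemma jump_time_lt l : (l.+1 < jump_count nu 1)%N ->
  jump_time nu l < jump_time nu l.+1.
Proof.
move=> l1; have l1' := ltnW l1.
set t := jump_time nu l.
have t0 : 0 < t by exact: jump_time_gt0.
have t1 : t <= 1 by exact: jump_time_le1.
have t01 : 0 <= t <= 1 by rewrite ltW.
rewrite ltNge jump_time_le// -leqNgt.
suff : (jump_count nu t)%:R <= l.+1%:R :> R by rewrite ler_nat.
rewrite (jump_countE (ltW t0)).
(* Before [t] there are at most [l] jumps, so the left limit is at most [l]; a jump of size at most
   one leaves a count of at most [l.+1]. *)
case: hnu => _ _ /(_ _ t0); rewrite lerBlDl => H.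
apply: (le_trans H).
rewrite -natr1 lerD2r; apply: limr_le.
  apply: nondecreasing_at_left_is_cvgr.
    by near=> x; move=> a b _ _; exact: cumulative_is_nondecreasing.
  near=> x; exists (nu t) => _ [y + <-]; rewrite /= in_itv/= => /andP[_ yt].
  exact/cumulative_is_nondecreasing/ltW.
near=> s.
have s0 : 0 <= s.
  by apply: ltW; near: s; exact: nbhs_left_gt.
have st : s < t by near: s; exact: nbhs_left_lt.
rewrite -jump_countE// ler_nat leqNgt -jump_time_le//; first by rewrite -ltNge.
by rewrite s0 (le_trans (ltW st)).
Unshelve. all: by end_near. Qed.

Lemma jump_sum_const (c s t : R) : 0 <= s -> s <= t ->
  jump_sum nu (cst c) s t = c * (nu t - nu s).
Proof.
move=> s0 st; rewrite /jump_sum big_const_nat iter_addr_0.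
by rewrite -mulr_natr natrB ?jump_count_le// !jump_countE// (le_trans s0).
Qed.

(* Distinct jump times of a path keep a positive distance, so a fine enough
   grid separates them. *)
Lemma jump_count_grid : \forall K \near \oo, forall i, (i < K)%N ->
  (jump_count nu (i.+1%:R / K%:R) <= (jump_count nu (i%:R / K%:R)).+1)%N.
Proof.
have [d d0 dT] : exists2 d : R, 0 < d & forall l, (l.+1 < jump_count nu 1)%N ->
    d <= jump_time nu l.+1 - jump_time nu l.
  suff : forall n, (n <= jump_count nu 1)%N -> exists2 d : R, 0 < d &
      forall l, (l.+1 < n)%N -> d <= jump_time nu l.+1 - jump_time nu l.
    by apply.
  elim=> [|n IH] n1; first by exists 1.
  have [d d0 dT] := IH (ltnW n1).
  case: n n1 dT {IH} => [|n] n1 dT; first by exists 1.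
  exists (Num.min d (jump_time nu n.+1 - jump_time nu n)) => [|l].
    by rewrite lt_min d0 subr_gt0 jump_time_lt.
  rewrite ltnS leq_eqVlt => /orP[/eqP[->]|ln]; rewrite ge_min ?lexx ?orbT//.
  by rewrite dT.
near=> K => i iK.
have K0 : 0 < K%:R :> R by rewrite ltr0n; near: K; exact: nbhs_infty_gt.
rewrite leqNgt; apply/negP => h.
set t := i%:R / K%:R in h *.
have tS : i.+1%:R / K%:R = t + K%:R^-1 by rewrite /t -natr1 mulrDl mul1r.
have t0 : 0 <= t by rewrite divr_ge0.
have S1 : i.+1%:R / K%:R <= 1 :> R by rewrite ler_pdivrMr// mul1r ler_nat.
have SE : 0 <= (i.+1%:R / K%:R : R) <= 1 by rewrite divr_ge0.
have t1 : t <= 1 by rewrite (le_trans _ S1)// tS lerDl invr_ge0 ltW.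
have l1 : ((jump_count nu t).+1 < jump_count nu 1)%N.
  by rewrite (leq_trans h)// jump_count_le.
have := dT _ l1; apply/negP; rewrite -ltNge.
have T1 : jump_time nu (jump_count nu t).+1 <= t + K%:R^-1.
  by rewrite -tS jump_time_le.
have T2 : t < jump_time nu (jump_count nu t).
  by rewrite ltNge jump_time_le ?t0// ?ltnn// ltnW.
have : K%:R^-1 < d.
  rewrite invf_plt ?posrE//; near: K; exact: nbhs_infty_gtr.
lra.
Unshelve. all: by end_near. Qed.

Lemma stieltjes_jump_times (A : set R) : measurable A -> A `<=` `]0, 1] ->
  lebesgue_stieltjes_measure nu A =
  (\sum_(l < jump_count nu 1) \d_(jump_time nu l) A)%E.
Proof.
move=> mA A01.
pose mu : {measure set (measurableTypeR R) -> \bar R} := msum (fun l => \d_(jump_time nu l : measurableTypeR R) : {measure set _ -> \bar R}) (jump_count nu 1).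
apply: (@stieltjes_unit_unique nu mu) => // a b a0 ab b1; rewrite /mu/= /msum/=.
rewrite -!jump_countE ?(le_trans a0)//.
rewrite (eq_bigr (fun l : 'I__ => ((jump_count nu a <= l < jump_count nu b)%N%:R : R)%:E)).
  rewrite sumEFin -natr_sum sum_indicator_nat ?jump_count_le//.
  by rewrite !(minn_idPl _) ?jump_count_le ?(le_trans ab)// natrB ?jump_count_le.
have a01 : 0 <= a <= 1 by rewrite a0 (le_trans ab).
have b01 : 0 <= b <= 1 by rewrite b1 (le_trans a0).
move=> [l l1] _; rewrite diracE; congr ((nat_of_bool _)%:R%:E) => /=.
rewrite [X in X && _]leqNgt -(jump_time_le l1 a01) -(jump_time_le l1 b01) -ltNge.
by apply/idP/idP => [/set_mem|?]; [|apply/mem_set]; rewrite /= in_itv.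
Qed.

Lemma integral_stieltjes_path (phi : R -> R) : measurable_fun setT phi ->
  \int[lebesgue_stieltjes_measure nu]_(t in `]0, 1]) phi t = jump_sum nu phi 0 1.
Proof.
move=> mphi.
have mD : measurable (`]0, 1] : set R) by [].
rewrite /Rintegral.
pose m2 : {measure set (measurableTypeR R) -> \bar R} := msum (fun l => \d_(jump_time nu l : measurableTypeR R) : {measure set _ -> \bar R}) (jump_count nu 1).
rewrite (@eq_measure_integral _ _ _ _ m2); last first.
  by move=> B mB B01; exact: (stieltjes_jump_times mB B01).
have mE : measurable_fun (`]0, 1] : set R) (EFin \o phi).
  by apply/measurable_EFinP; exact: measurable_funTS.
have D1 l : (l < jump_count nu 1)%N -> (\d_(jump_time nu l : measurableTypeR R) `]0%R, 1%R]%classic = 1 :> \bar R)%E.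
  move=> l1; rewrite diracE mem_set//= in_itv/=.
  by rewrite jump_time_gt0 ?jump_time_le1.
rewrite integralE !ge0_integral_measure_sum//; last 2 first.
- exact: measurable_funeneg.
- exact: measurable_funepos.
rewrite /jump_sum jump_count0 big_mkord.
rewrite (eq_bigr (fun l : 'I__ => (Num.max (phi (jump_time nu l)) 0)%:E)); last first.
  move=> l _; rewrite integral_dirac ?D1 ?mul1e//; last exact: measurable_funepos.
  by rewrite funeposE/= EFin_max.
rewrite [X in (_ - X)%E](eq_bigr (fun l : 'I__ => (Num.max (- phi (jump_time nu l)) 0)%:E)); last first.
  move=> l _; rewrite integral_dirac ?D1 ?mul1e//; last exact: measurable_funeneg.
  by rewrite funenegE/= EFin_max.
rewrite !sumEFin -EFinB/= -sumrB; apply: eq_bigr => l _.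
exact: maxr0B.
Qed.

End properties.
End counting_paths.

(** * Discretized exponentials *)

Section discretized_exponential.
Context {R : realType}.

Lemma expRN_le_quadratic (x : R) : `|x| <= 1 -> expR (- x) <= 1 - x + `|x| ^+ 2.
Proof.
move=> x1.
have : psi2 (- x) <= `|x| ^+ 2 * psi2 1.
  by apply: psi2_le_scaled; rewrite ?normr_ge0 ?mulr1 ?normrN.
have : psi2 (1 : R) <= 1.
  apply: (le_trans (psi2_le _)); first by rewrite ler01/= ltr1n.
  by rewrite ler_pdivrMr; nra.
have := psi2_ge0 (1 : R); have := sqr_ge0 `|x|.
by rewrite /psi2; nra.
Qed.

(** [p i] says that the process is not yet stopped at step [i]. The bound is a sum of increments
    rather than a product, so that each term can be integrated separately; [0 <= f i] settles the
    step at which [p] fails. *)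
Lemma discrete_gronwall (K : nat) (p : nat -> bool) (f D e : nat -> R) :
  f 0%N = 1 -> (forall i, 0 <= f i) -> (forall i, 0 <= e i) ->
  (forall i, (i < K)%N -> p i.+1 -> p i) ->
  (forall i, (i < K)%N -> p i -> f i.+1 <= f i + f i * D i + e i) ->
  (if p K then f K else 0)
  <= 1 + \sum_(i < K) (p i)%:R * (f i * D i) + \sum_(i < K) e i.
Proof.
move=> f01 f0 e0 pS fS.
suff H : forall j, (j <= K)%N -> (if p j then f j else 0)
  <= 1 + \sum_(i < j) (p i)%:R * (f i * D i) + \sum_(i < j) e i by exact: H.
elim=> [_|j IH jK]; first by rewrite !big_ord0 f01; case: (p 0%N); lra.
have := IH (ltnW jK); rewrite !big_ord_recr/=.
have := pS j jK; have := fS j jK; have := e0 j; have := f0 j.+1.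
case: (p j) => [fj1 ej /(_ isT) fj _|fj1 ej _ /contraNF -> //]; last first.
  by rewrite mul0r; lra.
by rewrite mul1r; case: (p j.+1); lra.
Qed.

(** To first order exp (g - x) - 1 is the compensated increment (exp g - 1) - x. A cell without jump
    contributes an error of order 1/K^2, a cell with its single jump one of order 1/K, and the
    number of jumps does not depend on K. *)
Lemma exponential_discretization (nu : cumulative R R) (g C : R -> R)
    (G c : R) (m : nat) (eps : R) :
  counting_path nu -> 0 <= G -> (forall t, `|g t| <= G) -> 0 <= c -> C 0 = 0 ->
  (forall s t, 0 <= s -> s <= t -> t <= 1 -> `|C t - C s| <= c * (t - s)) ->
  0 < eps ->
  let f t := expR (jump_sum nu g 0 t - C t) in
  \forall K \near \oo,
    (if (jump_count nu 1 < m)%N then f 1 else 0)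
    <= 1 + \sum_(i < K) (jump_count nu (i%:R / K%:R) < m)%N%:R *
         (f (i%:R / K%:R) *
          (jump_sum nu (fun t => expR (g t) - 1) (i%:R / K%:R) (i.+1%:R / K%:R)
           - (C (i.+1%:R / K%:R) - C (i%:R / K%:R)))) + eps.
Proof.
move=> hnu G0 gG c0 C0 Clip eps0 f.
(* [Mf] bounds [f] as long as fewer than [m] jumps have occurred; [c'] is the cost of the product of
   a jump with the drift in its cell. *)
pose Mf := expR (G * m%:R + c).
pose c' := (2 * expR G + 1) * c.
pose B := Mf * (c ^+ 2 + (jump_count nu 1)%:R * c').
have c'0 : 0 <= c' by rewrite mulr_ge0// addr_ge0// mulr_ge0// expR_ge0.
have B0 : 0 <= B.
  by rewrite mulr_ge0 ?expR_ge0// addr_ge0 ?exprn_ge0// mulr_ge0.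
near=> K.
have K0 : 0 < K%:R :> R by rewrite ltr0n; near: K; exact: nbhs_infty_gt.
have Kc : c / K%:R <= 1.
  by rewrite ler_pdivrMr// mul1r ltW//; near: K; exact: nbhs_infty_gtr.
have KB : B / K%:R <= eps.
  by rewrite ler_pdivrMr// mulrC -ler_pdivrMr// ltW//; near: K; exact: nbhs_infty_gtr.
have grid : forall i, (i < K)%N ->
  (jump_count nu (i.+1%:R / K%:R) <= (jump_count nu (i%:R / K%:R)).+1)%N.
  by near: K; exact: jump_count_grid.
pose t i : R := i%:R / K%:R.
have t_ge0 i : 0 <= t i by rewrite divr_ge0.
have t_le1 i : (i <= K)%N -> t i <= 1.
  by move=> iK; rewrite ler_pdivrMr// mul1r ler_nat.
have t_S i : t i.+1 - t i = K%:R^-1 by rewrite /t -mulrBl -natrB// subSnn mul1r.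
have t_leS i : t i <= t i.+1 by rewrite -subr_ge0 t_S invr_ge0 ltW.
pose dN i := (jump_count nu (t i.+1) - jump_count nu (t i))%N.
pose e i : R := Mf * ((c / K%:R) ^+ 2 + (dN i)%:R * (c' / K%:R)).
have e0 i : 0 <= e i.
  by rewrite mulr_ge0 ?expR_ge0// addr_ge0 ?exprn_ge0 ?divr_ge0// mulr_ge0// divr_ge0// ltW.
have tK : t K = 1 by rewrite /t divff// lt0r_neq0.
have eE : \sum_(i < K) e i <= eps.
  apply: le_trans KB; rewrite /e -mulr_sumr /B -mulrA ler_wpM2l ?expR_ge0//.
  rewrite big_split/= sumr_const card_ord -mulr_suml -natr_sum mulrDl lerD//.
    rewrite -mulr_natr le_eqVlt; apply/orP; left.
    by apply/eqP; field; rewrite lt0r_neq0.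
  rewrite -(mulrA _ c') ler_wpM2r ?(divr_ge0 c'0 (ltW K0))// ler_nat.
  rewrite -(big_mkord xpredT dN) telescope_sumn_in//; last first.
    by move=> i _ /=; exact: jump_count_le.
  by rewrite tK leq_subr.
have H := @discrete_gronwall K (fun i => jump_count nu (t i) < m)%N (fun i => f (t i))
  (fun i => jump_sum nu (fun t => expR (g t) - 1) (t i) (t i.+1)
            - (C (t i.+1) - C (t i))) e.
rewrite tK in H; apply: le_trans (H _ _ e0 _ _) _; last by rewrite lerD2l.
- by rewrite /t mul0r /f C0 subr0 /jump_sum big_geq ?expR0.
- by move=> i; exact: expR_ge0.
- by move=> i _ /=; apply: leq_ltn_trans; exact: jump_count_le.
move=> i iK pim.
set x := C (t i.+1) - C (t i).
have xK : `|x| <= c / K%:R by rewrite -(t_S i); apply: Clip => //; exact: t_le1.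
have fE : f (t i.+1) = f (t i) * (expR (jump_sum nu g (t i) (t i.+1)) * expR (- x)).
  rewrite /f -!expRD; congr expR; rewrite (jump_sum_cat nu g (t_ge0 i) (t_leS i)).
  by rewrite /x; ring.
have fM : f (t i) <= Mf.
  rewrite /f /Mf ler_expR lerD//.
    apply: (le_trans (ler_norm _)); apply: (le_trans (ler_norm_sum _ _ _)).
    apply: (@le_trans _ _ (\sum_(jump_count nu 0 <= l < jump_count nu (t i)) G)).
      by apply: ler_sum => l _.
    rewrite big_const_nat iter_addr_0 -[leLHS]mulr_natr ler_wpM2l// ler_nat.
    by rewrite (leq_trans (leq_subr _ _))// ltnW.
  rewrite -(subr0 (C _)) -C0 -normrN in xK *.
  have := Clip 0 (t i) (lexx 0) (t_ge0 i) (t_le1 _ (ltnW iK)).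
  rewrite ler_norml subr0 => /andP[+ _]; rewrite -C0.
  have : c * t i <= c by rewrite ler_piMr// t_le1// ltnW.
  lra.
have f0 : 0 <= f (t i) by exact: expR_ge0.
have x1 : `|x| <= 1 by exact: le_trans Kc.
have xe := expRN_le_quadratic x1.
have cK0 : 0 <= c / K%:R by rewrite divr_ge0 // ltW.
have x2 : `|x| ^+ 2 <= (c / K%:R) ^+ 2 by apply: lerXn2r; rewrite ?nnegrE ?normr_ge0.
rewrite fE; suff : expR (jump_sum nu g (t i) (t i.+1)) * expR (- x)
    <= 1 + (jump_sum nu (fun t => expR (g t) - 1) (t i) (t i.+1) - x)
     + ((c / K%:R) ^+ 2 + (dN i)%:R * (c' / K%:R)).
  move=> /(ler_wpM2l f0) /le_trans; apply; rewrite mulrDr lerD//.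
    by rewrite mulrDr mulr1.
  rewrite /e ler_wpM2r//.
  by rewrite addr_ge0 ?exprn_ge0 ?divr_ge0// ?mulr_ge0// ?divr_ge0// ltW.
have := jump_count_le nu (t_leS i); rewrite leq_eqVlt => /orP[/eqP dN0|dN1].
  rewrite /jump_sum !big_geq ?dN0// expR0 mul1r /dN dN0 subnn mul0r addr0.
  by apply: (le_trans xe); lra.
have {}dN1 : jump_count nu (t i.+1) = (jump_count nu (t i)).+1.
  by apply/eqP; rewrite eqn_leq dN1 andbT; exact: grid.
rewrite /jump_sum dN1 !big_nat1 /dN dN1 subSnn mul1r.
set a := g _; have aG : expR a <= expR G.
  by rewrite ler_expR (le_trans (ler_norm _))// gG.
have x2' : `|x| ^+ 2 <= `|x| by rewrite expr2 ler_piMr.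
have : expR a * (expR (- x) - 1) <= expR G * (2 * `|x|).
  apply: (@le_trans _ _ (expR a * (2 * `|x|))).
    rewrite ler_wpM2l ?expR_ge0//; have := ler_norm (- x); rewrite normrN; lra.
  by rewrite ler_wpM2r// mulr_ge0.
have : expR G * (2 * `|x|) + `|x| <= c' / K%:R.
  rewrite /c' -mulrA.
  have -> : expR G * (2 * `|x|) + `|x| = (2 * expR G + 1) * `|x| by ring.
  by rewrite ler_wpM2l// addr_ge0// mulr_ge0// expR_ge0.
have := ler_norm x; have := exprn_ge0 2 (divr_ge0 c0 (ltW K0)).
by nra.
Unshelve. all: by end_near. Qed.

End discretized_exponential.

(** * Bounded integrands *)

Section bounded_measurable.
Context {R : realType} d {T : measurableType d}.
Implicit Types f g : T -> R.

Definition bounded_measurable f :=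
  measurable_fun setT f /\ exists M, forall x, `|f x| <= M.

Lemma bounded_measurableD f g : bounded_measurable f -> bounded_measurable g ->
  bounded_measurable (fun x => f x + g x).
Proof.
move=> [mf [M Mf]] [mg [M' Mg]]; split; first exact: measurable_funD.
by exists (M + M') => x; rewrite (le_trans (ler_normD _ _))// lerD.
Qed.

Lemma bounded_measurableM f g : bounded_measurable f -> bounded_measurable g ->
  bounded_measurable (fun x => f x * g x).
Proof.
move=> [mf [M Mf]] [mg [M' Mg]]; split; first exact: measurable_funM.
by exists (M * M') => x; rewrite normrM ler_pM.
Qed.

Lemma bounded_measurable_cst (c : R) : bounded_measurable (fun _ : T => c).
Proof. by split; [exact: measurable_cst|exists `|c|]. Qed.

Lemma bounded_measurableZ f c : bounded_measurable f ->
  bounded_measurable (fun x => c * f x).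
Proof. by move=> ?; apply: bounded_measurableM => //; exact: bounded_measurable_cst. Qed.

Lemma bounded_measurableB f g : bounded_measurable f -> bounded_measurable g ->
  bounded_measurable (fun x => f x - g x).
Proof.
move=> [mf [M Mf]] [mg [M' Mg]]; split; first exact: measurable_funB.
by exists (M + M') => x; rewrite (le_trans (ler_normB _ _))// lerD.
Qed.

Lemma bounded_measurable_norm f : bounded_measurable f ->
  bounded_measurable (fun x => `|f x|).
Proof.
move=> [mf [M Mf]]; split; first exact: measurableT_comp.
by exists M => x; rewrite normr_id.
Qed.

Lemma bounded_measurable_exp f : bounded_measurable f ->
  bounded_measurable (fun x => expR (f x)).
Proof.
move=> [mf [M Mf]]; split; first exact: measurableT_comp.
exists (expR M) => x; rewrite ger0_norm ?expR_ge0// ler_expR.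
by rewrite (le_trans (ler_norm _)).
Qed.

Lemma bounded_measurable_indic (A : set T) : measurable A ->
  bounded_measurable (\1_A : T -> R).
Proof.
move=> mA; split; first exact: measurable_indic.
by exists 1 => x; rewrite indicE; case: (_ \in _); rewrite ?normr1// normr0.
Qed.

Lemma bounded_measurable_integrable (mu : {measure set T -> \bar R}) D f :
  measurable D -> (mu D < +oo)%E -> bounded_measurable f ->
  mu.-integrable D (EFin \o f).
Proof.
move=> mD muD [mf [M Mf]].
apply: measurable_bounded_integrable => //; first exact: measurable_funTS.
exists M; split; first by rewrite num_real.
by move=> N MN x _ /=; rewrite (le_trans (Mf x))// ltW.
Qed.

End bounded_measurable.

Lemma bounded_measurable_comp {R : realType} d d' {T : measurableType d}
    {T' : measurableType d'} (f : T -> T') (g : T' -> R) :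
  measurable_fun setT f -> bounded_measurable g ->
  bounded_measurable (fun x => g (f x)).
Proof.
move=> mf [mg [M Mg]]; split; first exact: (measurableT_comp mg).
by exists M => x.
Qed.

Section interval_integrals.
Context {R : realType}.
Implicit Types (p q : R -> R) (r s t : R).
Local Notation mu := (@lebesgue_measure R).

Lemma lebesgue_itv_oc s t : s <= t -> mu `]s, t]%classic = (t - s)%:E.
Proof.
rewrite lebesgue_measure_itv/= lte_fin le_eqVlt => /predU1P[->|->] //.
by rewrite ltxx subrr.
Qed.

Lemma lebesgue_itv_oc_fin s t : (mu `]s, t]%classic < +oo)%E.
Proof. by rewrite lebesgue_measure_itv/=; case: ifP => _; rewrite ?ltry. Qed.

Lemma itv_integrable p s t : bounded_measurable p ->
  mu.-integrable `]s, t] (EFin \o p).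
Proof.
by move=> bp; apply: bounded_measurable_integrable => //; exact: lebesgue_itv_oc_fin.
Qed.

Lemma itv_integral_EFin p s t : bounded_measurable p ->
  (\int[mu]_(u in `]s, t]) p u)%:E = (\int[mu]_(u in `]s, t]) (p u)%:E)%E.
Proof.
by move=> bp; rewrite /Rintegral fineK//; apply: integral_fune_fin_num => //; exact: itv_integrable.
Qed.

Lemma itv_integralD p q s t : bounded_measurable p -> bounded_measurable q ->
  \int[mu]_(u in `]s, t]) (p u + q u)
  = \int[mu]_(u in `]s, t]) p u + \int[mu]_(u in `]s, t]) q u.
Proof. by move=> bp bq; rewrite RintegralD//; exact: itv_integrable. Qed.

Lemma itv_integralB p q s t : bounded_measurable p -> bounded_measurable q ->
  \int[mu]_(u in `]s, t]) (p u - q u)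
  = \int[mu]_(u in `]s, t]) p u - \int[mu]_(u in `]s, t]) q u.
Proof. by move=> bp bq; rewrite RintegralB//; exact: itv_integrable. Qed.

Lemma itv_integralZ p c s t : bounded_measurable p ->
  \int[mu]_(u in `]s, t]) (c * p u) = c * \int[mu]_(u in `]s, t]) p u.
Proof. by move=> bp; rewrite RintegralZl//; exact: itv_integrable. Qed.

Lemma itv_integral_cst c s t : s <= t -> \int[mu]_(u in `]s, t]) c = c * (t - s).
Proof. by move=> st; rewrite /Rintegral integral_cst//= lebesgue_itv_oc. Qed.

Lemma itv_integral_le p q s t : bounded_measurable p -> bounded_measurable q ->
  (forall u, p u <= q u) ->
  \int[mu]_(u in `]s, t]) p u <= \int[mu]_(u in `]s, t]) q u.
Proof. by move=> bp bq pq; apply: le_Rintegral => //; exact: itv_integrable. Qed.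

Lemma itv_integral_ge0 p s t : (forall u, 0 <= p u) ->
  0 <= \int[mu]_(u in `]s, t]) p u.
Proof. by move=> p0; apply: Rintegral_ge0. Qed.

Lemma itv_integral_norm p M s t : bounded_measurable p -> s <= t ->
  (forall u, `|p u| <= M) -> `|\int[mu]_(u in `]s, t]) p u| <= M * (t - s).
Proof.
move=> bp st pM; rewrite -itv_integral_cst// ler_norml.
have bM c : bounded_measurable (fun _ : R => c) by exact: bounded_measurable_cst.
apply/andP; split; last first.
  by apply: itv_integral_le => // u; rewrite (le_trans (ler_norm _)).
rewrite -mulN1r -itv_integralZ//; apply: itv_integral_le => // u.
by have := pM u; rewrite ler_norml mulN1r => /andP[].
Qed.

Lemma itv_integral_cat p r s t : bounded_measurable p -> r <= s -> s <= t ->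
  \int[mu]_(u in `]r, t]) p u
  = \int[mu]_(u in `]r, s]) p u + \int[mu]_(u in `]s, t]) p u.
Proof.
move=> bp rs st; rewrite -Rintegral_setU//.
- by rewrite -itv_bndbnd_setU// bnd_simp.
- by rewrite -itv_bndbnd_setU ?bnd_simp//; exact: itv_integrable.
- apply/disj_setPS => u [] /=; rewrite !in_itv/= => /andP[_ us] /andP[su _].
  by move: (lt_le_trans su us); rewrite ltxx.
Qed.

Lemma itv_integral_cc p s t : measurable_fun setT p ->
  \int[mu]_(u in `[s, t]) p u = \int[mu]_(u in `]s, t]) p u.
Proof.
move=> mp; rewrite /Rintegral integral_itv_obnd_cbnd//.
exact/measurable_funTS/measurable_EFinP.
Qed.

End interval_integrals.

(** * Filtrations and predictability *)

(** Tonelli gives measurability for nonnegative integrands; a bounded one is made nonnegative by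
    adding its bound. *)
Lemma measurable_itv_integral {R : realType} d (T : measurableType d)
    (q : R * T -> R) (s t : R) : bounded_measurable q ->
  measurable_fun setT (fun w => \int[lebesgue_measure]_(u in `]s, t]) q (u, w)).
Proof.
move=> bq; have [mq [M qM]] := bq.
have sec w : bounded_measurable (fun u => q (u, w)).
  exact: (bounded_measurable_comp (pair2_measurable w)).
wlog q0 : q M mq qM bq sec / forall z, 0 <= q z.
  move=> H.
  have bM : bounded_measurable (fun z : R * T => q z + M).
    by apply: bounded_measurableD => //; exact: bounded_measurable_cst.
  have [mM [M' qM']] := bM.
  have -> : (fun w => \int[lebesgue_measure]_(u in `]s, t]) q (u, w))
    = (fun w => \int[lebesgue_measure]_(u in `]s, t]) (q (u, w) + M)
                - \int[lebesgue_measure]_(u in `]s, t]) M).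
    apply/funext => w; rewrite itv_integralD ?addrK//; exact: bounded_measurable_cst.
  apply: measurable_funB => //.
  apply: (H (fun z => q z + M) M') => // [w|z].
  - exact: (bounded_measurable_comp (pair2_measurable w) bM).
  - by have := qM z; rewrite ler_norml => /andP[]; lra.
pose h (z : R * T) := (q z * \1_(`]s, t]%classic : set R) z.1)%:E.
have mh : measurable_fun setT h.
  apply/measurable_EFinP; apply: measurable_funM => //.
  by apply: (measurableT_comp (measurable_indic _)) => //; exact: measurable_fst.
have h0 z : (0 <= h z)%E by rewrite lee_fin mulr_ge0.
have := @measurable_fun_fubini_tonelli_G _ _ _ _ _ lebesgue_measure h mh h0.
move=> /(measurableT_comp (@fine_measurable R _ measurableT)).
apply: eq_measurable_fun => w _ /=; rewrite /fubini_G /Rintegral; congr fine.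
rewrite [RHS]integral_mkcond; apply: eq_integral => u _.
rewrite /h /patch indicE/=.
by case: (u \in _); rewrite ?mulr1 ?mulr0.
Qed.

Section filtration.
Context {R : realType} {dT : measure_display} {T : measurableType dT}
  {P : probability T R} {F : R -> set (set T)} (hF : usual_conditions P F).

Lemma filtrationE t : 0 <= t -> <<s F t >> = F t.
Proof. by move=> t0; apply: sigma_algebra_id; exact: (filtration_sigma_algebra hF). Qed.

Lemma measurable_filtrationT t : 0 <= t ->
  measurable_fun setT (fun w : T => w : g_sigma_algebraType (F t)).
Proof.
move=> t0 _ B; rewrite setTI /measurable/= filtrationE//.
exact: (filtration_measurable hF).
Qed.

Lemma measurable_filtration_le s t : 0 <= s -> s <= t ->
  measurable_fun setT
    (fun w : g_sigma_algebraType (F t) => w : g_sigma_algebraType (F s)).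
Proof.
move=> s0 st _ B; rewrite setTI /measurable/= !filtrationE ?(le_trans s0)//.
exact: (filtration_nondecreasing hF).
Qed.

(** The sets whose trace on [0, t] is measurable for [F t] form a sigma-algebra. It contains the
    predictable rectangles: ]a, b] x A with A in [F a] has an empty trace if a > t, and otherwise A
    lies in [F t]. *)
Lemma predictable_progressive (Y : R -> T -> R) t : predictable F Y -> 0 <= t ->
  measurable_fun (`[0, t]%classic `*` setT : set (R * g_sigma_algebraType (F t)))
    (fun z => Y z.1 z.2).
Proof.
move=> pY t0 mD B mB.
have /pY : preimage_set_system [set z | 0 <= z.1] (fun z => Y z.1 z.2) measurable
    ([set z : R * T | 0 <= z.1] `&` (fun z => Y z.1 z.2) @^-1` B) by exists B.
set D := `[0, t]%classic `*` setT in mD *.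
pose K := [set C : set (R * T) |
  measurable (C `&` D : set (R * g_sigma_algebraType (F t)))].
have -> : D `&` (fun z => Y z.1 z.2) @^-1` B
    = [set z : R * T | 0 <= z.1] `&` (fun z => Y z.1 z.2) @^-1` B `&` D.
  apply/seteqP; split => [[u w] [[/= u0 _] Yu]|[u w] [[/= _ Yu] Du]] //.
  by move: u0; rewrite in_itv/= => /andP[u0 ut]; split; split => //=; rewrite in_itv/= u0 ut.
suff H : <<s [set z : R * T | 0 <= z.1], predictable_rectangles F >> `<=` K by exact: H.
apply: smallest_sub; first split.
- by rewrite /K/= set0I; exact: measurable0.
- move=> C KC; rewrite /K/= (_ : _ `&` D = D `\` (C `&` D)); first exact: measurableD.
  apply/seteqP; split => [z [[z0 nC] Dz]|z [Dz nCD]].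
    by split => // -[].
  split => //; split => //; last by move=> Cz; exact: nCD.
  by case: Dz => /=; rewrite in_itv/= => /andP[].
- by move=> A KA; rewrite /K/= setI_bigcupl; apply: bigcupT_measurable => i; exact: KA.
move=> C [[A FA <-]|[a [b [A [a0 ab FA ->]]]]]; rewrite /K/=.
  rewrite /D -setXI setIT; apply: measurableX.
    by apply: measurableI; [exact: measurable_set1|exact: measurable_itv].
  rewrite /measurable/= filtrationE//.
  exact: (filtration_nondecreasing hF (lexx 0) t0).
have [at_|ta] := leP a t.
  rewrite /D -setXI setIT; apply: measurableX; first exact: measurableI.
  by rewrite /measurable/= filtrationE//; exact: (filtration_nondecreasing hF a0 at_).
rewrite (_ : _ `&` _ = set0) ?measurable0//.
apply/seteqP; split => [[u w] [[/= + _] [/= + _]]|//].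
rewrite !in_itv/= => /andP[au _] /andP[_ ut].
by move: (lt_trans ta au); rewrite ltNge ut.
Qed.

End filtration.

(** * Integrals against the risk process *)

Section cube.
Context {R : realType} {k : nat}.

Lemma measurable_unit_cube : measurable (@unit_cube R k).
Proof.
have -> : @unit_cube R k = ~` ~` \bigcap_(i in [set: 'I_k])
    ((fun x : 'rV[R]_k => x ord0 i) @^-1` `[0, 1]).
  rewrite setCK; apply/seteqP; split => [x x01 i _|x x01 i].
    by rewrite /= in_itv/= x01.
  by have := x01 i Logic.I; rewrite /= in_itv.
apply: measurableC; apply: sub_sigma_algebra; apply/closed_openC.
apply: closed_bigI => i _; apply: closed_comp; last exact: itv_closed.
by move=> x _; exact: coord_continuous.
Qed.

Lemma measurable_time_cube : measurable (@time_cube R k).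
Proof. by apply: measurableX => //; exact: measurable_unit_cube. Qed.

End cube.

Section model_integrals.
Context {R : realType} {k : nat} {dT : measure_display} {T : measurableType dT}
  {P : probability T R} {F : R -> set (set T)}
  {alpha0 : R * borel R k -> R} {X : {RV P >-> borel R k}}
  {N : T -> cumulative R R} {Y : R -> T -> R}
  (hmodel : counting_model F alpha0 X N Y).
Implicit Types phi : R * borel R k -> R.
Local Notation T_ t := (g_sigma_algebraType (F t)).

Let hF := model_filtration hmodel.

(** [Y] is constrained for nonnegative times only; the cut-off gives a bounded process on the whole
    line without changing any integral over [0, 1]. *)
Definition risk_process (y : R -> T -> R) u w : R := \1_(`[0, 1]%classic : set R) u * y u w.

Local Notation Yc := (risk_process Y).

Definition time_int (x : T -> borel R k) (y : R -> T -> R) phi s t w : R :=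
  \int[lebesgue_measure]_(u in `]s, t]) (phi (u, x w) * risk_process y u w).

Lemma risk_process01 u w : 0 <= Yc u w <= 1.
Proof.
rewrite /risk_process indicE; case: (boolP (u \in _)) => [/set_mem/=|_].
  rewrite in_itv/= mul1r => /andP[u0 _].
  exact: (model_Y01 hmodel).
by rewrite mul0r lexx ler01.
Qed.

Lemma bounded_measurable_risk_process_F t : 0 <= t <= 1 ->
  bounded_measurable (fun z : R * T_ t => \1_(`[0, t]%classic : set R) z.1 * Yc z.1 z.2).
Proof.
move=> /andP[t0 t1]; split; last first.
  exists 1 => z; have /andP[y0 y1] := risk_process01 z.1 z.2.
  rewrite normrM (ger0_norm y0) -[leRHS]mulr1 ler_pM//.
  by rewrite indicE; case: (_ \in _); rewrite ?normr1 ?normr0.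
have := @predictable_progressive _ _ _ _ _ hF Y t (model_predictable hmodel) t0.
have mD : measurable (`[0, t]%classic `*` setT : set (R * T_ t)) by apply: measurableX.
move=> /(measurable_restrictT _ mD).
apply: eq_measurable_fun => -[u w] _ /=; rewrite /patch/= /risk_process !indicE.
have [/set_mem[/= ut _]|ut] := boolP ((u, w) \in _).
  rewrite mem_set// mem_set//= ?mul1r//.
  by move: ut; rewrite !in_itv/= => /andP[-> /le_trans->].
rewrite memNset ?mul0r// => ut'; move/negP: ut; apply; exact/mem_set.
Qed.

Lemma bounded_measurable_risk_process :
  bounded_measurable (fun z : R * T => Yc z.1 z.2).
Proof.
have m1 : measurable_fun setT (fun z : R * T => (z.1, z.2 : T_ 1)).
  apply: measurable_fun_pair; first exact: measurable_fst.
  by apply: (measurableT_comp (measurable_filtrationT hF ler01)); exact: measurable_snd.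
have B := bounded_measurable_comp m1 (@bounded_measurable_risk_process_F 1 ltac:(by rewrite ler01 lexx)).
rewrite (_ : (fun _ => _) = (fun z : R * T => \1_(`[0, 1]%classic : set R) z.1 * Yc z.1 z.2))//.
apply/funext => z; rewrite /risk_process mulrA; congr (_ * _).
by rewrite indicE; case: (_ \in _); rewrite ?mulr1 ?mulr0.
Qed.

Lemma measurable_covariates_F t : 0 <= t ->
  measurable_fun setT (X : T_ t -> borel R k).
Proof.
move=> t0 _ B mB; rewrite setTI /measurable/= (filtrationE hF t0).
apply: (filtration_nondecreasing hF (lexx 0) t0); apply: (model_covariates hmodel).
by exists B => //; rewrite setTI.
Qed.

Lemma bounded_measurable_integrand phi : bounded_measurable phi ->
  bounded_measurable (fun z : R * T => phi (z.1, X z.2) * Yc z.1 z.2).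
Proof.
move=> bphi; apply: bounded_measurableM; last exact: bounded_measurable_risk_process.
apply: (@bounded_measurable_comp _ _ _ _ _ (fun z : R * T => (z.1, X z.2)) phi _ bphi).
apply: measurable_fun_pair; first exact: measurable_fst.
by apply: (measurableT_comp (measurable_funP X)); exact: measurable_snd.
Qed.

Lemma bounded_measurable_path phi w : bounded_measurable phi ->
  bounded_measurable (fun u => phi (u, X w) * Yc u w).
Proof.
move=> /bounded_measurable_integrand.
exact: (bounded_measurable_comp (pair2_measurable w)).
Qed.

Lemma measurable_time_int phi s t : bounded_measurable phi ->
  measurable_fun setT (time_int X Y phi s t).
Proof.
by move=> /bounded_measurable_integrand bq; exact: (measurable_itv_integral s t bq).
Qed.

(** The integral up to [t] sees the risk process only on [0, t], where predictability makes it
    measurable with respect to [F t]. *)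
Lemma measurable_time_int_F phi s t : bounded_measurable phi ->
  0 <= s -> s <= t -> t <= 1 -> measurable_fun setT (time_int X Y phi s t : T_ t -> R).
Proof.
move=> bphi s0 st t1; have t0 : 0 <= t by exact: le_trans st.
have bq : bounded_measurable (fun z : R * T_ t =>
    phi (z.1, X z.2) * (\1_(`[0, t]%classic : set R) z.1 * Yc z.1 z.2)).
  apply: bounded_measurableM; last by apply: bounded_measurable_risk_process_F; rewrite t0.
  apply: (@bounded_measurable_comp _ _ _ _ _ (fun z : R * T_ t => (z.1, X z.2 : borel R k)) phi _ bphi).
  apply: measurable_fun_pair; first exact: measurable_fst.
  by apply: (measurableT_comp (measurable_covariates_F t0)); exact: measurable_snd.
have := measurable_itv_integral s t bq.
apply: eq_measurable_fun => w _; apply: eq_Rintegral => u /set_mem/=.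
rewrite in_itv/= => /andP[su ut]; rewrite indicE mem_set ?mul1r//=.
by rewrite in_itv/= ut andbT (le_trans s0)// ltW.
Qed.

Lemma time_intD phi phi' s t w : bounded_measurable phi -> bounded_measurable phi' ->
  time_int X Y (fun z => phi z + phi' z) s t w
  = time_int X Y phi s t w + time_int X Y phi' s t w.
Proof.
move=> b b'; rewrite /time_int -itv_integralD; last 2 first.
- exact: bounded_measurable_path.
- exact: bounded_measurable_path.
by apply: eq_Rintegral => u _; rewrite mulrDl.
Qed.

Lemma time_intB phi phi' s t w : bounded_measurable phi -> bounded_measurable phi' ->
  time_int X Y (fun z => phi z - phi' z) s t w
  = time_int X Y phi s t w - time_int X Y phi' s t w.
Proof.
move=> b b'; rewrite /time_int -itv_integralB; last 2 first.
- exact: bounded_measurable_path.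
- exact: bounded_measurable_path.
by apply: eq_Rintegral => u _; rewrite mulrBl.
Qed.

Lemma time_intZ phi c s t w : bounded_measurable phi ->
  time_int X Y (fun z => c * phi z) s t w = c * time_int X Y phi s t w.
Proof.
move=> b; rewrite /time_int -itv_integralZ; last exact: bounded_measurable_path.
by apply: eq_Rintegral => u _; rewrite mulrA.
Qed.

Lemma time_int_le phi phi' s t w : bounded_measurable phi -> bounded_measurable phi' ->
  (forall z, phi z <= phi' z) -> time_int X Y phi s t w <= time_int X Y phi' s t w.
Proof.
move=> b b' H; apply: itv_integral_le; try exact: bounded_measurable_path.
by move=> u; rewrite ler_wpM2r//; case/andP: (risk_process01 u w).
Qed.

Lemma time_int_ge0 phi s t w : (forall z, 0 <= phi z) -> 0 <= time_int X Y phi s t w.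
Proof.
move=> H; apply: itv_integral_ge0 => u; rewrite mulr_ge0//.
by case/andP: (risk_process01 u w).
Qed.

Lemma time_int_norm phi M s t w : bounded_measurable phi -> s <= t ->
  (forall z, `|phi z| <= M) -> `|time_int X Y phi s t w| <= M * (t - s).
Proof.
move=> b st H; apply: itv_integral_norm => //; first exact: bounded_measurable_path.
move=> u; have /andP[y0 y1] := risk_process01 u w.
by rewrite normrM (ger0_norm y0) -[leRHS]mulr1 ler_pM.
Qed.

Lemma time_int_cat phi r s t w : bounded_measurable phi -> r <= s -> s <= t ->
  time_int X Y phi r t w = time_int X Y phi r s w + time_int X Y phi s t w.
Proof. by move=> b rs st; apply: itv_integral_cat => //; exact: bounded_measurable_path. Qed.

Lemma time_int_eq phi phi' s t w : (forall u, phi (u, X w) = phi' (u, X w)) ->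
  time_int X Y phi s t w = time_int X Y phi' s t w.
Proof. by move=> H; apply: eq_Rintegral => u _; rewrite H. Qed.

Lemma time_intxx phi s w : time_int X Y phi s s w = 0.
Proof. by rewrite /time_int set_itvxx Rintegral_set0. Qed.

Lemma time_int_empty phi s t w : t <= s -> time_int X Y phi s t w = 0.
Proof. by move=> ts; rewrite /time_int set_itv_ge ?Rintegral_set0// bnd_simp -leNgt. Qed.

(** Truncating [a] and [b] to [s, t] gives one formula for all relative positions of the two
    intervals. *)
Lemma time_int_rectangle phi a b s t (B : set (borel R k)) w :
  bounded_measurable phi -> s <= t ->
  time_int X Y (fun z => \1_(`]a, b]%classic `*` B) z * phi z) s t w
  = \1_B (X w) * time_int X Y phi (Num.min (Num.max a s) t) (Num.min (Num.max b s) t) w.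
Proof.
move=> b0 st; rewrite /time_int -itv_integralZ; last exact: bounded_measurable_path.
rewrite Rintegral_mkcond [RHS]Rintegral_mkcond; apply: eq_Rintegral => u _.
rewrite /patch (_ : (u \in `]Num.min (Num.max a s) t, _]%classic)
  = (u \in `]s, t]%classic) && (u \in `]a, b]%classic)).
  case: (boolP (u \in `]s, t]%classic)) => //= _.
  rewrite !indicE; case: (boolP (u \in `]a, b]%classic)) => [/set_mem uab|/negP uab].
    rewrite (_ : (u, X w) \in _ = (X w \in B)) -?mulrA//.
    by apply/idP/idP => [/set_mem[_ BX]|/set_mem BX]; exact/mem_set.
  rewrite [X in (nat_of_bool X)%:R * _](_ : _ = false) ?mul0r//.
  by apply/negbTE/negP => /set_mem[/= h _]; apply: uab; exact/mem_set.
apply/idP/andP => [/set_mem/=|[/set_mem/= us /set_mem/= ua]].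
  rewrite in_itv/= le_min gt_min le_max => /andP[+ /andP[ub ut]]; rewrite gt_max (ltNge t) ut orbF.
  move=> /andP[au su]; move: ub; rewrite (leNgt u s) su orbF => ub.
  by split; apply/mem_set; rewrite /= in_itv/= ?su ?au.
move: us ua; rewrite !in_itv/= => /andP[su ut] /andP[au ub]; apply/mem_set; rewrite /= in_itv/=.
by rewrite gt_min gt_max le_min le_max su ut au ub.
Qed.

Lemma time_int_EFin phi s t w : bounded_measurable phi ->
  (time_int X Y phi s t w)%:E
  = (\int[lebesgue_measure]_(u in `]s, t]) (phi (u, X w) * Yc u w)%:E)%E.
Proof. by move=> b; apply: itv_integral_EFin; exact: bounded_measurable_path. Qed.

End model_integrals.

#[global] Opaque time_int.

(** * The compensation formula *)

Section martingale_increments.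
Context {R : realType} {k : nat} {dT : measure_display} {T : measurableType dT}
  {P : probability T R} {F : R -> set (set T)}
  {alpha0 : R * borel R k -> R} {X : {RV P >-> borel R k}}
  {N : T -> cumulative R R} {Y : R -> T -> R}
  (hmodel : counting_model F alpha0 X N Y)
  {a0 : R} (alpha0_le : forall z, time_cube z -> alpha0 z <= a0).
Local Notation T_ t := (g_sigma_algebraType (F t)).

Let hF := model_filtration hmodel.

(** [alpha0] is bounded only on the cube. This truncation is bounded everywhere and yields the same
    compensator up to time 1 on the event that [X] lies in the cube. *)
Definition cube_intensity : R * borel R k -> R := fun z => \1_(@time_cube R k) z * alpha0 z.

Local Notation lam := cube_intensity.

Lemma cube_intensityE z : time_cube z -> lam z = alpha0 z.
Proof. by move=> cz; rewrite /lam indicE mem_set// mul1r. Qed.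

Lemma cube_intensity_out z : ~ time_cube z -> lam z = 0.
Proof. by move=> cz; rewrite /lam indicE memNset// mul0r. Qed.

Lemma cube_intensity_ge0 z : 0 <= lam z.
Proof. by rewrite mulr_ge0// (model_alpha0_ge0 hmodel). Qed.

Lemma cube_intensity_le z : lam z <= a0.
Proof.
have zc : time_cube (0 : R, (0 : 'rV[R]_k) : borel R k).
  by split => /= [|i]; rewrite ?in_itv/= ?mxE lexx ler01.
have [cz|cz] := pselect (time_cube z); first by rewrite cube_intensityE// alpha0_le.
by rewrite cube_intensity_out// (le_trans _ (alpha0_le zc))// (model_alpha0_ge0 hmodel).
Qed.

Lemma bounded_measurable_cube_intensity : bounded_measurable lam.
Proof.
split.
  have m1 : measurable_fun setT (\1_(@time_cube R k) : R * borel R k -> R).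
    by apply: measurable_indic; exact: measurable_time_cube.
  exact: measurable_funM m1 (model_alpha0_measurable hmodel).
by exists a0 => z; rewrite ger0_norm ?cube_intensity_ge0// cube_intensity_le.
Qed.

Local Notation Lam := (time_int X Y lam).

Lemma compensator_cube t w : unit_cube (X w) -> 0 <= t <= 1 ->
  compensator alpha0 X Y t w = (Lam 0 t w)%:E.
Proof.
move=> cX /andP[t0 t1].
rewrite (time_int_EFin hmodel) ?integral_itv_obnd_cbnd; last 2 first.
- apply/measurable_funTS/measurable_EFinP.
  by case: (bounded_measurable_path hmodel w bounded_measurable_cube_intensity).
- exact: bounded_measurable_cube_intensity.
apply: eq_integral => u /set_mem/=; rewrite in_itv/= => /andP[u0 ut].
have u01 : 0 <= u <= 1 by rewrite u0 (le_trans ut).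
rewrite cube_intensityE; last by split; rewrite //= in_itv.
by rewrite /risk_process indicE mem_set ?mul1r//= in_itv.
Qed.

Lemma measurable_count_F t : 0 <= t ->
  measurable_fun setT ((fun w => N w t) : T_ t -> R).
Proof.
move=> t0 _ B mB; rewrite setTI /measurable/= (filtrationE hF t0).
have [ad _ _ _] := model_counting hmodel.
by apply: (ad t t0); exists B => //; rewrite setTI.
Qed.

Lemma measurable_count t : 0 <= t -> measurable_fun setT (fun w => N w t).
Proof.
by move=> t0; apply: (measurableT_comp (measurable_count_F t0)); exact: (measurable_filtrationT hF t0).
Qed.

Lemma counting_pathP w : counting_path (N w).
Proof. by have [_ N0 Nn NJ] := model_counting hmodel; split; [exact: N0|exact: Nn|exact: NJ]. Qed.

Lemma count_ge0 t w : 0 <= t -> 0 <= N w t.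
Proof. by move=> t0; rewrite -(jump_countE (counting_pathP w) t0). Qed.

Lemma filtration_cube t : 0 <= t -> F t (X @^-1` @unit_cube R k).
Proof.
move=> t0; apply: (filtration_nondecreasing hF (lexx 0) t0).
apply: (model_covariates hmodel).
by exists (@unit_cube R k); rewrite ?setTI//; exact: measurable_unit_cube.
Qed.

Let a0_ge0 : 0 <= a0.
Proof. exact: le_trans (cube_intensity_ge0 point) (cube_intensity_le point). Qed.

Lemma cumulative_intensity_ge0 s t w : 0 <= Lam s t w.
Proof. by apply: (time_int_ge0 hmodel) => z; exact: cube_intensity_ge0. Qed.

Lemma cumulative_intensity_le s t w : 0 <= s -> s <= t -> t <= 1 -> Lam s t w <= a0.
Proof.
move=> s0 st t1.
have := @time_int_norm _ _ _ _ _ _ _ _ _ _ hmodel lam a0 s t w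
  bounded_measurable_cube_intensity st.
rewrite ger0_norm ?cumulative_intensity_ge0// => /(_ _)/le_trans; apply.
  by move=> z; rewrite ger0_norm ?cube_intensity_ge0// cube_intensity_le.
by rewrite ler_piMr//; lra.
Qed.

Let mLam s t := measurable_time_int hmodel s t bounded_measurable_cube_intensity.

Let compensated_count_integrable t : 0 <= t ->
  P.-integrable setT (EFin \o (fun w => N w t - fine (compensator alpha0 X Y t w))).
Proof. by move=> t0; have [_ + _] := model_martingale hmodel; apply. Qed.

Lemma Lam_integrable B s t : measurable B -> 0 <= s -> s <= t -> t <= 1 ->
  P.-integrable B (EFin \o Lam s t).
Proof.
move=> mB s0 st t1; apply: bounded_measurable_integrable => //.
  by rewrite (le_lt_trans (probability_le1 _ mB))// ltry.
split; first exact: mLam.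
exists a0 => w; rewrite ger0_norm ?cumulative_intensity_ge0//.
exact: cumulative_intensity_le.
Qed.

Lemma compensated_count_cube w t : unit_cube (X w) -> 0 <= t <= 1 ->
  N w t - fine (compensator alpha0 X Y t w) = N w t - Lam 0 t w.
Proof. by move=> cX t01; rewrite compensator_cube. Qed.

(* The martingale property, rearranged so that both sides are integrals of
   nonnegative functions. *)
Lemma martingale_cube s t B : 0 <= s -> s <= t -> t <= 1 -> F s B ->
  B `<=` X @^-1` @unit_cube R k ->
  (\int[P]_(w in B) (N w t + Lam 0 s w)%:E = \int[P]_(w in B) (N w s + Lam 0 t w)%:E)%E.
Proof.
move=> s0 st t1 FB BX.
have t0 : 0 <= t by exact: le_trans st.
have s1 : s <= 1 by exact: le_trans t1.
have mB : measurable B by exact: (filtration_measurable hF s0).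
have [_ _ mart] := model_martingale hmodel.
have iM u : 0 <= u -> P.-integrable B (EFin \o (fun w => N w u - fine (compensator alpha0 X Y u w))).
  by move=> u0; apply: integrableS (compensated_count_integrable u0).
have iL : P.-integrable B (EFin \o (fun w => Lam 0 t w + Lam 0 s w)).
  exact: (integrableD mB (Lam_integrable mB (lexx 0) t0 t1) (Lam_integrable mB (lexx 0) s0 s1)).
have H u v : 0 <= u <= 1 -> (forall w, Lam 0 t w + Lam 0 s w - Lam 0 u w = Lam 0 v w) ->
    (\int[P]_(w in B) (N w u + Lam 0 v w)%:E =
     \int[P]_(w in B) (N w u - fine (compensator alpha0 X Y u w))%:E
     + \int[P]_(w in B) (Lam 0 t w + Lam 0 s w)%:E)%E.
  move=> u01 uv; rewrite -integralD//; last by apply: iM; case/andP: u01.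
  apply: eq_integral => w /set_mem Bw /=.
  rewrite compensated_count_cube//; last exact: BX.
  by rewrite -EFinD; congr EFin; rewrite -uv; ring.
have t01 : 0 <= t <= 1 by rewrite t0.
have s01 : 0 <= s <= 1 by rewrite s0.
have et w : Lam 0 t w + Lam 0 s w - Lam 0 t w = Lam 0 s w by ring.
have es w : Lam 0 t w + Lam 0 s w - Lam 0 s w = Lam 0 t w by ring.
apply: (etrans (H t s t01 et)); apply: (etrans _ (esym (H s t s01 es))).
exact: (congr1 (fun x => x + \int[P]_(w in B) (Lam 0 t w + Lam 0 s w)%:E)%E (mart s t s0 st B FB)).
Qed.

(** Case [s = 0] of [martingale_cube]: on the cube event the mean of N(t) is the mean of a bounded
    time integral. *)
Lemma count_cube_finite t : 0 <= t <= 1 ->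
  (\int[P]_(w in X @^-1` @unit_cube R k) (N w t)%:E < +oo)%E.
Proof.
move=> /andP[t0 t1].
have FX : F 0 (X @^-1` @unit_cube R k) by exact: filtration_cube.
have mX := filtration_measurable hF (lexx 0) FX.
have := @martingale_cube 0 t _ (lexx 0) t0 t1 FX (fun _ h => h).
have L0 w : Lam 0 0 w = 0 by exact: time_intxx.
under eq_integral => w _ do rewrite L0 addr0.
move=> ->; have N0 w : N w 0 = 0 by case: (counting_pathP w).
under eq_integral => w _ do rewrite N0 add0r.
rewrite -ge0_fin_numE; last first.
  by apply: integral_ge0 => w _; rewrite lee_fin cumulative_intensity_ge0.
by apply: integral_fune_fin_num => //; exact: Lam_integrable.
Qed.

Lemma integral_mul_indic (B C : set T) (f : T -> R) :
  (\int[P]_(w in B) (\1_C w * f w)%:E = \int[P]_(w in B `&` C) (f w)%:E)%E.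
Proof.
rewrite [RHS]integral_mkcondr; apply: eq_integral => w _.
by rewrite /patch indicE; case: (w \in C); rewrite ?mul1r ?mul0r.
Qed.

Let C := X @^-1` @unit_cube R k.

Let W (u v : R) w := \1_C w * (N w u + Lam 0 v w).

Let m1C : measurable_fun setT (\1_C : T -> R).
Proof.
apply: measurable_indic; exact: (filtration_measurable hF (lexx 0) (filtration_cube (lexx 0))).
Qed.

Let mS u v : 0 <= u -> measurable_fun setT (fun w => N w u + Lam 0 v w).
Proof. by move=> u0; exact: (measurable_funD (measurable_count u0) (mLam 0 v)). Qed.

Let mW u v : 0 <= u -> measurable_fun setT (W u v).
Proof. by move=> u0; exact: (measurable_funM m1C (mS v u0)). Qed.

Let S0 u v w : 0 <= u -> 0 <= N w u + Lam 0 v w.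
Proof. move=> u0; exact: addr_ge0 (count_ge0 w u0) (cumulative_intensity_ge0 0 v w). Qed.

Let W0 u v w : 0 <= u -> 0 <= W u v w.
Proof. by move=> u0; apply: mulr_ge0 (S0 v w u0). Qed.

(** Read over all events of [F s], the martingale property says that two weighted images of [P] on
    [F s] coincide; hence they integrate every nonnegative [xi] alike. *)
Let weighted_martingale s t (xi : T -> R) : 0 <= s -> s <= t -> t <= 1 ->
  measurable_fun setT (xi : T_ s -> R) -> (forall w, 0 <= xi w) ->
  (\int[P]_w (xi w * W t s w)%:E = \int[P]_w (xi w * W s t w)%:E)%E.
Proof.
move=> s0 st t1 mxi xi0.
have t0 : 0 <= t by exact: le_trans st.
have mid := measurable_filtrationT hF s0.
have [nu1 nu1E nu1I] := weighted_image P (mW s t0) (fun w => W0 s w t0) mid.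
have [nu2 nu2E nu2I] := weighted_image P (mW t s0) (fun w => W0 t w s0) mid.
have nu12 B : measurable B -> nu1 B = nu2 B.
  move=> mB.
  have FBC : F s (B `&` C).
    rewrite -(filtrationE hF s0); apply: (@measurableI _ (T_ s)) => //.
    by rewrite /measurable/= (filtrationE hF s0); exact: filtration_cube.
  apply: (etrans (nu1E B mB)); apply: (etrans _ (esym (nu2E B mB))).
  apply: (etrans (integral_mul_indic B C _)).
  apply: (etrans _ (esym (integral_mul_indic B C _))).
  by apply: (martingale_cube s0 st t1 FBC) => w [].
have mxiE : measurable_fun setT (EFin \o (xi : T_ s -> R)) by exact/measurable_EFinP.
have xi0E w : (0 <= (EFin \o xi) w)%E by rewrite lee_fin.
have I1 := nu1I _ mxiE xi0E.
have I2 := nu2I _ mxiE xi0E.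
apply: (etrans (esym I1)); apply: (etrans _ I2).
by apply: eq_measure_integral => B mB _; exact: nu12.
Qed.

Lemma martingale_increment s t (xi : T -> R) : 0 <= s -> s <= t -> t <= 1 ->
  bounded_measurable (xi : T_ s -> R) -> (forall w, 0 <= xi w) ->
  (forall w, ~ unit_cube (X w) -> xi w = 0) ->
  (\int[P]_w (xi w * (N w t - N w s))%:E = \int[P]_w (xi w * Lam s t w)%:E)%E.
Proof.
move=> s0 st t1 [mxi [M xiM]] xi0 xiout.
have t0 : 0 <= t by exact: le_trans st.
have s1 : s <= 1 by exact: le_trans t1.
have mid := measurable_filtrationT hF s0.
have mC : measurable C by exact: (filtration_measurable hF (lexx 0) (filtration_cube (lexx 0))).
have mxiT : measurable_fun setT xi by exact: (measurableT_comp mxi mid).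
(* [V] is the part common to both sides of [weighted_martingale]; it can be subtracted once its
   integral is known to be finite. *)
pose V w := xi w * (N w s + Lam 0 s w).
have mV : measurable_fun setT V.
  exact: (measurable_funM mxiT (mS s s0)).
have V0 w : 0 <= V w.
  exact: mulr_ge0 (xi0 w) (S0 s w s0).
have xiC w : xi w * \1_C w = xi w.
  rewrite indicE; case: (boolP (w \in C)); rewrite ?mulr1// mulr0 => /negP wC.
  by rewrite xiout// => h; apply: wC; exact/mem_set.
have M0 : 0 <= M by rewrite (le_trans _ (xiM point)).
have Vfin : (\int[P]_w (V w)%:E)%E \is a fin_num.
  rewrite ge0_fin_numE; last by apply: integral_ge0 => w _; rewrite lee_fin.
  apply: (@le_lt_trans _ _ (\int[P]_w (M * (\1_C w * (N w s + Lam 0 s w)))%:E)%E).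
    apply: ge0_le_integral => //; try exact/measurable_EFinP.
    - by move=> w _; rewrite lee_fin; exact: V0.
    - apply/measurable_EFinP; exact: measurable_funM (measurable_cst M) (mW s s0).
    - move=> w _; rewrite lee_fin.
      have -> : V w = xi w * (\1_C w * (N w s + Lam 0 s w)) by rewrite mulrA xiC.
      apply: (ler_wpM2r (W0 s w s0)).
      exact: le_trans (ler_norm _) (xiM w).
  under eq_integral do rewrite EFinM.
  rewrite ge0_integralZl//; last 2 first.
  - by apply/measurable_EFinP; exact: (mW s s0).
  - by move=> w _; rewrite lee_fin; exact: (W0 s w s0).
  rewrite lte_mul_pinfty ?lee_fin// integral_mul_indic setTI.
  under eq_integral do rewrite EFinD.
  rewrite ge0_integralD//; last 4 first.
  - by move=> w _; rewrite lee_fin count_ge0.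
  - by apply/measurable_funTS/measurable_EFinP/measurable_count.
  - by move=> w _; rewrite lee_fin cumulative_intensity_ge0.
  - by apply/measurable_funTS/measurable_EFinP/mLam.
  rewrite lte_add_pinfty ?count_cube_finite ?s0//.
  rewrite -ge0_fin_numE; last first.
    by apply: integral_ge0 => w _; rewrite lee_fin cumulative_intensity_ge0.
  by apply: integral_fune_fin_num => //; exact: Lam_integrable.
have split_ (f : T -> R) g : measurable_fun setT f -> (forall w, 0 <= f w) ->
    (forall w, xi w * g w = f w + V w) ->
    (\int[P]_w (xi w * g w)%:E = \int[P]_w (f w)%:E + \int[P]_w (V w)%:E)%E.
  move=> mf f0 fgV; rewrite -ge0_integralD//.
  - by apply: eq_integral => w _; rewrite fgV EFinD.
  - by move=> w _; rewrite lee_fin.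
  - exact/measurable_EFinP.
  - by move=> w _; rewrite lee_fin.
  - exact/measurable_EFinP.
have Nst w : 0 <= N w t - N w s by rewrite subr_ge0 (cumulative_is_nondecreasing (N w)).
have LE w : Lam 0 t w = Lam 0 s w + Lam s t w.
  exact: (time_int_cat hmodel w bounded_measurable_cube_intensity s0 st).
move: (weighted_martingale s0 st t1 mxi xi0); rewrite (split_ (fun w => xi w * (N w t - N w s))); last 3 first.
- apply: measurable_funM => //; apply: measurable_funB; exact: measurable_count.
- by move=> w; rewrite mulr_ge0.
- by move=> w; rewrite /W mulrA xiC /V; ring.
rewrite (split_ (fun w => xi w * Lam s t w)); last 3 first.
- by apply: measurable_funM => //; exact: mLam.
- by move=> w; rewrite mulr_ge0 ?cumulative_intensity_ge0.
- by move=> w; rewrite /W mulrA xiC /V LE; ring.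
by move=> /(congr1 (fun z => z - \int[P]_w (V w)%:E)%E); rewrite !addeK.
Qed.

End martingale_increments.

(** For fixed [B] both sides are measures in the first factor that agree on half-open intervals,
    hence on Borel sets. Measurable rectangles are stable under intersection and generate the
    product. *)
Lemma measure_unique_rectangles {R : realType} d (T2 : measurableType d)
    (m1 m2 : {measure set (R * T2) -> \bar R}) :
  (m1 setT < +oo)%E ->
  (forall a b B, measurable B -> m1 (`]a, b]%classic `*` B) = m2 (`]a, b]%classic `*` B)) ->
  forall U, measurable U -> m1 U = m2 U.
Proof.
move=> m1fin m12.
have fin1 U : measurable U -> (m1 U < +oo)%E.
  by move=> mU; apply: le_lt_trans m1fin; apply: le_measure; rewrite ?inE.
have rect A B : measurable A -> measurable B -> m1 (A `*` B) = m2 (A `*` B).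
  move=> mA mB.
  have mTB : measurable (setT `*` B : set (R * T2)) by exact: measurableX.
  have m1B : measurable_fun setT (\1_(setT `*` B) : R * T2 -> R) by exact: measurable_indic.
  have fB0 x : 0 <= \1_(setT `*` B : set (R * T2)) x :> R by [].
  have nuB (m : {measure set (R * T2) -> \bar R}) A' : measurable A' ->
      (\int[m]_(x in fst @^-1` A') (\1_(setT `*` B : set (R * T2)) x)%:E = m (A' `*` B))%E.
    move=> mA'; rewrite integral_indic//.
      by congr (m _); apply/seteqP; split => [[u w] [[]]|[u w] []].
    by rewrite -[X in measurable X]setTI; exact: measurable_fst.
  have [n1 n1E _] := weighted_image m1 m1B fB0 measurable_fst.
  have [n2 n2E _] := weighted_image m2 m1B fB0 measurable_fst.
  rewrite -!nuB// -n1E// -n2E//.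
  apply: (@measure_unique _ R R (@ocitv R) (fun k => `](- k%:R), k%:R]%classic)) => //.
  - exact: ocitvI.
  - by move=> i; exact: is_ocitv.
  - rewrite -subTset => /= x _ /=.
    by exists (Num.bound x); rewrite //= in_itv/= ltrNl unstable.ltrNbound ltW// unstable.ltr_bound.
  - move=> _ [[a b] _ <-] /=.
    by rewrite n1E ?n2E ?nuB//; exact: m12.
  - by move=> i; rewrite n1E ?nuB//; apply: fin1; exact: measurableX.
move=> U mU.
apply: (@measure_unique _ R (R * T2)%type
  [set A `*` B | A in measurable & B in measurable] (fun _ => setT)) => //.
- exact: measurable_prod_measurableType.
- move=> _ _ [A mA [B mB <-]] [A' mA' [B' mB' <-]].
  by rewrite -setXI; exists (A `&` A'); [exact: measurableI|exists (B `&` B'); [exact: measurableI|]].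
- by move=> _; exists setT => //; exists setT => //; rewrite setXTT.
- by rewrite bigcup_const.
- by move=> _ [A mA [B mB <-]]; exact: rect.
Qed.

Section compensation.
Context {R : realType} {k : nat} {dT : measure_display} {T : measurableType dT}
  {P : probability T R} {F : R -> set (set T)}
  {alpha0 : R * borel R k -> R} {X : {RV P >-> borel R k}}
  {N : T -> cumulative R R} {Y : R -> T -> R}
  (hmodel : counting_model F alpha0 X N Y)
  {a0 : R} (alpha0_le : forall z, time_cube z -> alpha0 z <= a0).
Local Notation T_ t := (g_sigma_algebraType (F t)).
Local Notation lam := (@cube_intensity R k alpha0).

Let hF := model_filtration hmodel.
Let blam := bounded_measurable_cube_intensity hmodel alpha0_le.

Lemma measurable_jump_count_lt l t : 0 <= t ->
  measurable [set w | (l < jump_count (N w) t)%N].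
Proof.
move=> t0; rewrite (_ : mkset _ = (fun w => N w t) @^-1` `[l.+1%:R, +oo[%classic).
  by rewrite -[X in measurable X]setTI; apply: (measurable_count hmodel t0).
by apply/seteqP; split => w /=; rewrite in_itv/= andbT
  -(jump_countE (counting_pathP hmodel w) t0) ler_nat.
Qed.

Lemma measurable_jump_time l : measurable_fun setT (fun w => jump_time (N w) l).
Proof.
have T0 w : 0 <= jump_time (N w) l.
  have [l1|l1] := ltnP l (jump_count (N w) 1); first exact: jump_time_ge0.
  rewrite /jump_time (_ : mkset _ = set0) ?inf0//; apply/seteqP; split => // t [/andP[_ t1]].
  by rewrite ltnNge (leq_trans _ l1)// jump_count_le.
apply: (measurability (@RGenOInfty.G R)); first exact: RGenOInfty.measurableE.
move=> _ [_ [r ->] <-]; rewrite setTI -[X in measurable X]setCK; apply: measurableC.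
rewrite (_ : ~` _ = (fun w => jump_time (N w) l) @^-1` `]-oo, r]%classic); last first.
  by apply/seteqP; split => w /=; rewrite !in_itv/= andbT leNgt => /negP.
have [r0|r0] := ltP r 0.
  rewrite (_ : _ @^-1` _ = set0); first exact: measurable0.
  apply/seteqP; split => // w /=; rewrite in_itv/= => Tr.
  by have := le_lt_trans Tr r0; rewrite ltNge T0.
have mr : measurable [set w | (l < jump_count (N w) (Num.min r 1)%R)%N].
  by apply: measurable_jump_count_lt; rewrite le_min r0 ler01.
have m1 := measurable_jump_count_lt l (@ler01 R).
(* Paths with at most [l] jumps up to time 1 have jump time 0 by convention and belong to the set
   since [r >= 0]. *)
rewrite (_ : _ @^-1` _ = [set w | (l < jump_count (N w) (Num.min r 1)%R)%N]
    `|` ~` [set w | (l < jump_count (N w) 1)%N]).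
  by apply: measurableU => //; exact: measurableC.
have r01 : 0 <= Num.min r 1 <= 1 by rewrite le_min r0 ler01 ge_min lexx orbT.
apply/seteqP; split => w /=; rewrite in_itv/=; have [l1|l1] := ltnP l (jump_count (N w) 1).
- move=> Tr; left; rewrite -(jump_time_le (counting_pathP hmodel w) l1 r01) le_min Tr/=.
  exact: (jump_time_le1 (counting_pathP hmodel w) l1).
- by move=> _; right.
- case=> [|/(_ isT)//]; rewrite -(jump_time_le (counting_pathP hmodel w) l1 r01).
  by rewrite le_min => /andP[].
- move=> _; rewrite /jump_time (_ : mkset _ = set0) ?inf0//.
  apply/seteqP; split => // t [/andP[_ t1]].
  by rewrite ltnNge (leq_trans _ l1)// jump_count_le.
Qed.

Lemma measurable_jump_point l : measurable_fun setT (fun w => (jump_time (N w) l, X w) : R * borel R k).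
Proof. by apply: measurable_fun_pair; [exact: measurable_jump_time|exact: (measurable_funP X)]. Qed.

(** Counterpart of [time_int_rectangle]: the indicator of a rectangle leaves an increment of the
    path over the same truncated interval. *)
Lemma jump_sum_rectangle (a b s t : R) (B : set (borel R k)) w : 0 <= s -> s <= t -> t <= 1 ->
  jump_sum (N w) (fun u => \1_(`]a, b]%classic `*` B) (u, X w)) s t
  = \1_B (X w) * jump_sum (N w) (cst 1) (Num.min (Num.max a s) t)
                   (Num.min (Num.max b s) t).
Proof.
move=> s0 st t1.
have hN := counting_pathP hmodel w.
set a' := Num.min _ t; set b' := Num.min _ t.
have in01 c : s <= Num.min (Num.max c s) t <= t.
  by rewrite ge_min lexx orbT le_min le_max lexx orbT st.
have /andP[sa' a't] := in01 a; have /andP[sb' b't] := in01 b.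
have T1 l : (l < jump_count (N w) t)%N -> (l < jump_count (N w) 1)%N.
  by move=> lt; rewrite (leq_trans lt)// jump_count_le.
have t01 : 0 <= t <= 1 by rewrite t1 (le_trans s0).
have TP c l : (jump_count (N w) s <= l < jump_count (N w) t)%N ->
    (l < jump_count (N w) (Num.min (Num.max c s) t))%N = (jump_time (N w) l <= c).
  move=> /andP[sl lt]; have l1 := T1 _ lt; have /andP[sc ct] := in01 c.
  rewrite -(jump_time_le hN l1); last by rewrite (le_trans s0)//= (le_trans ct).
  have -> : jump_time (N w) l <= Num.min (Num.max c s) t = (jump_time (N w) l <= c) && true.
    rewrite le_min le_max (jump_time_le hN l1 t01) lt andbT.
    rewrite [X in _ || X](_ : _ = false) ?orbF ?andbT//.
    by rewrite (jump_time_le hN l1) ?s0 ?(le_trans st)// ltnNge sl.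
  by rewrite andbT.
have vE l : (jump_count (N w) s <= l < jump_count (N w) t)%N ->
    \1_(`]a, b]%classic `*` B) (jump_time (N w) l, X w)
    = \1_B (X w) * (jump_count (N w) a' <= l < jump_count (N w) b')%N%:R :> R.
  move=> lst; rewrite leqNgt /a' /b' !TP// -ltNge !indicE -natrM mulnb.
  congr (nat_of_bool _)%:R; apply/idP/idP.
    by move=> /set_mem[/=]; rewrite in_itv/= => -> BX; rewrite mem_set.
  by move=> /andP[/set_mem BX ab]; apply/mem_set; split; rewrite //= in_itv.
have [ba|ab] := leP b' a'.
  rewrite {2}/jump_sum big_geq ?jump_count_le// mulr0 /jump_sum big_nat big1// => l lst.
  rewrite vE// [X in (nat_of_bool X)%:R](_ : _ = false) ?mulr0//; apply/negbTE/negP => /andP[al lb].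
  by have := leq_ltn_trans al lb; rewrite ltnNge jump_count_le.
rewrite (jump_sum_cat _ _ sa' a't) (jump_sum_cat _ _ (ltW ab) b't).
rewrite {1}/jump_sum big_nat big1 ?add0r; last first.
  move=> l /andP[sl la]; rewrite vE; first by rewrite leqNgt la mulr0.
  by rewrite sl (leq_trans la)// jump_count_le.
rewrite [X in _ + X](_ : _ = 0) ?addr0; last first.
  rewrite /jump_sum big_nat big1// => l /andP[bl lt]; rewrite vE.
    by rewrite (ltnNge l) bl andbF mulr0.
  by rewrite lt andbT (leq_trans _ bl)// jump_count_le.
rewrite /jump_sum big_distrr/= [LHS]big_nat [RHS]big_nat; apply: eq_bigr => l /andP[al lb].
rewrite vE ?al ?lb//; apply/andP; split.
  by rewrite (leq_trans _ al)// jump_count_le.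
by rewrite (leq_trans lb)// jump_count_le.
Qed.

(** Turns the right-hand side into a measure applied to [phi]: the mass [xi w] is placed at the
    [l]-th jump point whenever that jump falls in ]s, t]. *)
Lemma integral_jump_sum (s t : R) (xi : T -> R) : 0 <= s -> s <= t -> t <= 1 ->
  measurable_fun setT xi -> (forall w, 0 <= xi w) ->
  exists nu : {measure set (R * borel R k) -> \bar R},
  forall phi : R * borel R k -> R, measurable_fun setT phi -> (forall z, 0 <= phi z) ->
  (\int[nu]_z (phi z)%:E
   = \int[P]_w (xi w * jump_sum (N w) (fun u => phi (u, X w)) s t)%:E)%E.
Proof.
move=> s0 st t1 mxi xi0.
have t0 : 0 <= t by exact: le_trans st.
pose W l w : R := xi w * (jump_count (N w) s <= l < jump_count (N w) t)%N%:R.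
have mlt l u : 0 <= u -> measurable_fun setT (fun w => (l < jump_count (N w) u)%N).
  move=> u0; apply: (measurable_fun_bool true); rewrite setTI.
  exact: (measurable_jump_count_lt l u0).
have mW l : measurable_fun setT (W l).
  apply: measurable_funM => //.
  rewrite (_ : (fun _ => _) = (fun w => if ~~ (l < jump_count (N w) s)%N && (l < jump_count (N w) t)%N then 1 else 0 : R)); last first.
    by apply/funext => w; rewrite -leqNgt; case: ifP.
  apply: measurable_fun_ifT => //; apply: measurable_and; last exact: mlt.
  by apply: measurable_neg; exact: mlt.
have W0 l w : 0 <= W l w by rewrite mulr_ge0.
have [nu nuE nuI] := weighted_image_series P mW W0 measurable_jump_point.
exists nu => phi mphi phi0.
rewrite nuI//; last exact/measurable_EFinP.
rewrite -integral_nneseries//.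
- apply: eq_integral => w _.
  rewrite (nneseries_split 0 (jump_count (N w) t))%E; last first.
    by move=> l _; rewrite mule_ge0// lee_fin.
  rewrite add0n eseries0; last first.
    by move=> l tl _; rewrite /W (ltnNge l) tl andbF mulr0 mule0.
  rewrite adde0 /jump_sum.
  rewrite (big_cat_nat (n := jump_count (N w) s))//=; last exact: jump_count_le.
  rewrite big_nat big1 ?add0e; last first.
    by move=> l /andP[_ ls]; rewrite /W leqNgt ls/= mulr0 mule0.
  rewrite big_distrr/= -sumEFin [in LHS]big_nat [in RHS]big_nat.
  by apply: eq_bigr => l lst; rewrite /W lst mulr1 -EFinM mulrC.
- move=> l; apply: emeasurable_funM; apply/measurable_EFinP => //.
  exact: (measurableT_comp mphi (measurable_jump_point l)).
- by move=> l w _; rewrite mule_ge0// lee_fin.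
Qed.

(** The compensator side as a measure: the image of one with a density with respect to Lebesgue
    measure times [P]. *)
Lemma integral_time_int (s t : R) (xi : T -> R) : 0 <= s -> s <= t -> t <= 1 ->
  measurable_fun setT xi -> (forall w, 0 <= xi w) ->
  exists nu : {measure set (R * borel R k) -> \bar R},
  forall phi : R * borel R k -> R, bounded_measurable phi -> (forall z, 0 <= phi z) ->
  (\int[nu]_z (phi z)%:E
   = \int[P]_w (xi w * time_int X Y (fun z => phi z * lam z) s t w)%:E)%E.
Proof.
move=> s0 st t1 mxi xi0.
pose q (z : R * T) := lam (z.1, X z.2) * risk_process Y z.1 z.2.
have bq : bounded_measurable q by exact: (bounded_measurable_integrand hmodel blam).
have q0 z : 0 <= q z.
  by rewrite mulr_ge0 ?(cube_intensity_ge0 hmodel)//; case/andP: (risk_process01 hmodel z.1 z.2).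
pose W (z : R * T) := xi z.2 * (\1_(`]s, t]%classic : set R) z.1 * q z).
have mW : measurable_fun setT W.
  apply: measurable_funM; first by apply: (measurableT_comp mxi); exact: measurable_snd.
  apply: measurable_funM; last by case: bq.
  by apply: (measurableT_comp (measurable_indic _)) => //; exact: measurable_fst.
have W0 z : 0 <= W z by rewrite mulr_ge0// mulr_ge0.
have mf : measurable_fun setT (fun z : R * T => (z.1, X z.2) : R * borel R k).
  apply: measurable_fun_pair; first exact: measurable_fst.
  by apply: (measurableT_comp (measurable_funP X)); exact: measurable_snd.
have [nu nuE nuI] := weighted_image (lebesgue_measure \x P)%E mW W0 mf.
exists nu => phi bphi phi0; have [mphi _] := bphi.
have phi0E z : (0 <= (EFin \o phi) z)%E by rewrite lee_fin.
have mphiE : measurable_fun setT (EFin \o phi) by exact/measurable_EFinP.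
apply: (etrans (nuI _ mphiE phi0E)).
pose h (z : measurableTypeR R * T) := ((phi (z.1, X z.2))%:E * (W z)%:E)%E.
have mh : measurable_fun setT h.
  apply: emeasurable_funM; apply/measurable_EFinP => //.
  exact: (measurableT_comp mphi mf).
have h0 z : (0 <= h z)%E by rewrite mule_ge0// lee_fin.
apply: (etrans (@fubini_tonelli2 _ _ _ _ _ lebesgue_measure P h mh h0)).
apply: eq_integral => w _; rewrite /fubini_G /= EFinM (time_int_EFin hmodel); last first.
  exact: bounded_measurableM.
rewrite -ge0_integralZl//; last 3 first.
- apply/measurable_funTS/measurable_EFinP.
  by case: (bounded_measurable_path hmodel w (bounded_measurableM bphi blam)).
- move=> u _; rewrite lee_fin; apply: mulr_ge0.
    by rewrite mulr_ge0// (cube_intensity_ge0 hmodel).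
  by case/andP: (risk_process01 hmodel u w).
- by rewrite lee_fin.
rewrite [RHS]integral_mkcond; apply: eq_integral => u _.
rewrite /patch /h /W/= indicE; case: (_ \in _); last by rewrite mul0r mulr0 mule0.
by rewrite mul1r /q/= -!EFinM; congr EFin; ring.
Qed.

(** Both sides are measures applied to [phi], so rectangles suffice. There the formula is
    [martingale_increment] on the truncated interval with the weight [xi] times the indicator of [B]
    at [X], which is known at the left end because [X] is [F 0]-measurable. *)
Lemma compensation_formula (s t : R) (xi : T -> R) (phi : R * borel R k -> R) :
  0 <= s -> s <= t -> t <= 1 ->
  bounded_measurable (xi : T_ s -> R) -> (forall w, 0 <= xi w) ->
  (forall w, ~ unit_cube (X w) -> xi w = 0) ->
  bounded_measurable phi -> (forall z, 0 <= phi z) ->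
  (\int[P]_w (xi w * jump_sum (N w) (fun u => phi (u, X w)) s t)%:E
   = \int[P]_w (xi w * time_int X Y (fun z => phi z * lam z) s t w)%:E)%E.
Proof.
move=> s0 st t1 bxi xi0 xiout bphi phi0.
have t0 : 0 <= t by exact: le_trans st.
have mxi : measurable_fun setT xi.
  by case: bxi => mxi _; exact: (measurableT_comp mxi (measurable_filtrationT hF s0)).
have [nu1 nu1I] := integral_jump_sum s0 st t1 mxi xi0.
have [nu2 nu2I] := integral_time_int s0 st t1 mxi xi0.
have i0 (U : set (R * borel R k)) z : 0 <= \1_U z :> R by [].
have nu1E U : measurable U ->
    nu1 U = (\int[P]_w (xi w * jump_sum (N w) (fun u => \1_U (u, X w)) s t)%:E)%E.
  move=> mU; rewrite -(nu1I (\1_U)) ?integral_indic ?setIT//.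
have nu2E U : measurable U ->
    nu2 U = (\int[P]_w (xi w * time_int X Y (fun z => \1_U z * lam z) s t w)%:E)%E.
  move=> mU; rewrite -(nu2I (\1_U)) ?integral_indic ?setIT//.
  exact: bounded_measurable_indic.
have rect a b B : measurable B -> nu1 (`]a, b]%classic `*` B) = nu2 (`]a, b]%classic `*` B).
  move=> mB.
  have mU : measurable (`]a, b]%classic `*` B : set (R * borel R k)) by exact: measurableX.
  apply: (etrans (nu1E _ mU)); apply: (etrans _ (esym (nu2E _ mU))).
  set a' := Num.min (Num.max a s) t; set b' := Num.min (Num.max b s) t.
  have sa' : s <= a' by rewrite le_min le_max lexx orbT st.
  have a'0 : 0 <= a' by exact: le_trans sa'.
  have b't : b' <= t by rewrite ge_min lexx orbT.
  pose xi' w := xi w * \1_B (X w).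
  have E1 : (fun w => (xi w * jump_sum (N w) (fun u => \1_(`]a, b]%classic `*` B) (u, X w)) s t)%:E)
      = (fun w => (xi' w * jump_sum (N w) (cst 1) a' b')%:E).
    by apply/funext => w; rewrite jump_sum_rectangle// mulrA.
  have E2 : (fun w => (xi' w * time_int X Y lam a' b' w)%:E)
      = (fun w => (xi w * time_int X Y (fun z => \1_(`]a, b]%classic `*` B) z * lam z) s t w)%:E).
    by apply/funext => w; rewrite (time_int_rectangle hmodel)// mulrA.
  apply: (etrans (congr1 (integral P setT) E1)).
  apply: (etrans _ (congr1 (integral P setT) E2)).
  have [ba|ab] := ltP b' a'.
    apply: eq_integral => w _; rewrite (time_int_empty _ _ (ltW ba)).
    by rewrite /jump_sum big_geq// jump_count_le// ltW.
  have Fsa := measurable_filtration_le hF s0 sa'.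
  have bxi' : bounded_measurable (xi' : T_ a' -> R).
    apply: bounded_measurableM; first exact: (bounded_measurable_comp Fsa bxi).
    apply: (@bounded_measurable_comp _ _ _ _ _ (X : T_ a' -> borel R k) (\1_B)).
      exact: (measurable_covariates_F hmodel a'0).
    exact: bounded_measurable_indic.
  have xi'0 w : 0 <= xi' w by rewrite mulr_ge0.
  have xi'out w : ~ unit_cube (X w) -> xi' w = 0 by move=> /xiout; rewrite /xi' => ->; rewrite mul0r.
  have := martingale_increment hmodel alpha0_le a'0 ab (le_trans b't t1) bxi' xi'0 xi'out.
  apply: etrans; apply: eq_integral => w _.
  by rewrite (jump_sum_const (counting_pathP hmodel w) 1 a'0 ab) mul1r.
(* Uniqueness needs a finite measure. The total mass is the mean of [xi] times an increment, which
   [martingale_increment] turns into a bounded integral. *)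
have fin1 : (nu1 setT < +oo)%E.
  have -> : nu1 setT = (\int[P]_w (xi w * (N w t - N w s))%:E)%E.
    apply: (etrans (nu1E _ measurableT)); apply: eq_integral => w _.
    rewrite -[in RHS](mul1r (N w t - N w s)) -(jump_sum_const (counting_pathP hmodel w) 1 s0 st).
    by congr (_ * _)%:E; apply: eq_bigr => l _; rewrite indicT.
  rewrite (martingale_increment hmodel alpha0_le s0 st t1 bxi xi0 xiout).
  have [_ [M xiM]] := bxi.
  have M0 : 0 <= M by rewrite (le_trans _ (xiM point)).
  have a00 : 0 <= a0.
    exact: le_trans (cube_intensity_ge0 hmodel point) (cube_intensity_le hmodel alpha0_le point).
  have mL := measurable_time_int hmodel s t blam.
  apply: (@le_lt_trans _ _ (\int[P]_w (M * a0)%:E)%E).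
    apply: ge0_le_integral => //.
    - by move=> w _; rewrite lee_fin; apply: mulr_ge0 => //; exact: (cumulative_intensity_ge0 hmodel).
    - apply/measurable_EFinP; exact: measurable_funM mxi mL.
    - move=> w _; rewrite lee_fin; apply: ler_pM => //.
      + exact: (cumulative_intensity_ge0 hmodel).
      + exact: le_trans (ler_norm _) (xiM w).
      + exact: (cumulative_intensity_le hmodel alpha0_le).
  by rewrite integral_cst//= probability_setT mule1 ltry.
have nu12 := measure_unique_rectangles fin1 rect.
have [mphi _] := bphi.
apply: (etrans (esym (nu1I _ mphi phi0))); apply: (etrans _ (nu2I _ bphi phi0)).
by apply: eq_measure_integral => B mB _; exact: nu12.
Qed.

End compensation.

(** * The exponential supermartingale *)

(** The rank from which the pathwise bound holds may depend on [w] and [eps]; Fatou's lemma needs no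
    uniformity. *)
Lemma fatou_eventually {R : realType} d (T : measurableType d)
    (mu : {measure set T -> \bar R}) (U : T -> R) (h : nat -> T -> R) (c : \bar R) :
  measurable_fun setT U -> (forall w, 0 <= U w) ->
  (forall n, measurable_fun setT (h n)) -> (forall n w, 0 <= h n w) ->
  (forall n, (\int[mu]_w (h n w)%:E <= c)%E) ->
  (forall w eps, 0 < eps -> \forall n \near \oo, U w <= h n w + eps) ->
  (\int[mu]_w (U w)%:E <= c)%E.
Proof.
move=> mU U0 mh h0 hc Uh.
have mhE n : measurable_fun setT (EFin \o h n) by exact/measurable_EFinP.
apply: (@le_trans _ _ (\int[mu]_w limn_einf (fun n => (h n w)%:E))%E).
  apply: ge0_le_integral => //.
  - by move=> w _; rewrite lee_fin.
  - exact/measurable_EFinP.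
  - rewrite /limn_einf; apply: measurableT_comp => //.
    apply: (measurable_fun_limn_esup (f := fun n w => (- h n w)%:E)) => n.
    exact/measurable_EFinP/measurable_funN.
  - move=> w _; apply/lee_subgt0Pr => eps eps0.
    rewrite limn_einf_lim; apply: lime_ge; first exact: is_cvg_einfs.
    have [n0 _ n0U] := Uh w eps eps0.
    exists n0 => // n /= n0n; apply: le_ereal_inf_tmp => _ [m /= nm <-].
    by rewrite -EFinB lee_fin lerBlDr; apply: n0U => /=; exact: leq_trans nm.
apply: (le_trans (@fatou _ _ _ mu setT measurableT (fun n => EFin \o h n) mhE _)).
  by move=> n w _; rewrite lee_fin.
rewrite limn_einf_lim; apply: lime_le; first exact: is_cvg_einfs.
apply: nearW => n; apply: le_trans (hc n).
by apply: ereal_inf_lbound; exists n => /=.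
Qed.

Lemma ge0_integral_EFinD {R : realType} d (T : measurableType d)
    (mu : {measure set T -> \bar R}) (f f' : T -> R) :
  measurable_fun setT f -> measurable_fun setT f' ->
  (forall w, 0 <= f w) -> (forall w, 0 <= f' w) ->
  (\int[mu]_w (f w + f' w)%:E = \int[mu]_w (f w)%:E + \int[mu]_w (f' w)%:E)%E.
Proof.
move=> mf mf' f0 f'0; under eq_integral do rewrite EFinD.
rewrite ge0_integralD//.
- by move=> w _; rewrite lee_fin.
- exact/measurable_EFinP.
- by move=> w _; rewrite lee_fin.
- exact/measurable_EFinP.
Qed.

Section exponential_process.
Context {R : realType} {k : nat} {dT : measure_display} {T : measurableType dT}
  {P : probability T R} {F : R -> set (set T)}
  {alpha0 : R * borel R k -> R} {X : {RV P >-> borel R k}}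
  {N : T -> cumulative R R} {Y : R -> T -> R}
  (hmodel : counting_model F alpha0 X N Y)
  {a0 : R} (alpha0_le : forall z, time_cube z -> alpha0 z <= a0).
Context (g : R * borel R k -> R) (bg : bounded_measurable g)
  (gout : forall z, ~ time_cube z -> g z = 0).
Local Notation T_ t := (g_sigma_algebraType (F t)).
Local Notation lam := (@cube_intensity R k alpha0).

Let hF := model_filtration hmodel.
Let blam := bounded_measurable_cube_intensity hmodel alpha0_le.

Let psi z := expR (g z) - 1.

Let bpsi : bounded_measurable psi.
Proof.
apply: bounded_measurableB; last exact: bounded_measurable_cst.
exact: bounded_measurable_exp.
Qed.

Let bpl : bounded_measurable (fun z => psi z * lam z).
Proof. exact: bounded_measurableM. Qed.

Definition log_martingale t w : R := jump_sum (N w) (fun u => g (u, X w)) 0 t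
  - time_int X Y (fun z => (expR (g z) - 1) * lam z) 0 t w.

Let Cset := X @^-1` @unit_cube R k.

(** Set to 0 from the [m]-th jump on and off the cube event, the exponential becomes bounded and
    [F t]-measurable, hence a legitimate weight in [compensation_formula]. *)
Let xi m t w : R :=
  \1_Cset w * ((jump_count (N w) t < m)%N%:R * expR (log_martingale t w)).

Let xi_ge0 m t w : 0 <= xi m t w.
Proof. by apply: mulr_ge0 => //; apply: mulr_ge0 => //; exact: expR_ge0. Qed.

Let xi_out m t w : ~ unit_cube (X w) -> xi m t w = 0.
Proof. by move=> h; rewrite /xi indicE memNset ?mul0r. Qed.

Let FltE l t : 0 <= t -> measurable_fun setT
  ((fun w => (l < jump_count (N w) t)%N) : T_ t -> bool).
Proof.
move=> t0; apply: (measurable_fun_bool true); rewrite setTI.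
rewrite (_ : _ @^-1` _ = (fun w => N w t) @^-1` `[l.+1%:R, +oo[%classic).
  by rewrite -[X in measurable X]setTI; apply: (measurable_count_F hmodel t0).
by apply/seteqP; split => w /=; rewrite in_itv/= andbT
  -(jump_countE (counting_pathP hmodel w) t0) ler_nat.
Qed.

(** [jump_time] is computed from the path up to time 1; to be known at time [t] it is replaced by 0
    as long as the jump has not occurred. *)
Let stopped_time l t w : R := if (l < jump_count (N w) t)%N then jump_time (N w) l else 0.

Let mstopped l t : 0 <= t <= 1 -> measurable_fun setT (stopped_time l t : T_ t -> R).
Proof.
move=> /andP[t0 t1].
have st0 w : 0 <= stopped_time l t w.
  rewrite /stopped_time; case: ifPn => // lt; apply: jump_time_ge0.
  by rewrite (leq_trans lt)// jump_count_le.
apply: (measurability (@RGenOInfty.G R)); first exact: RGenOInfty.measurableE.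
move=> _ [_ [r ->] <-]; rewrite setTI.
have [r0|r0] := ltP r 0.
  rewrite (_ : _ @^-1` _ = setT); first exact: measurableT.
  by apply/seteqP; split => // w _ /=; rewrite in_itv/= andbT (lt_le_trans r0).
have m_ s : 0 <= s <= t -> measurable ([set w | (l < jump_count (N w) s)%N] : set (T_ t)).
  move=> /andP[s0 st].
  have := measurableT_comp (FltE l s0) (measurable_filtration_le hF s0 st).
  move=> /(_ measurableT [set true] I); rewrite setTI => H.
  exact: H.
have rt : 0 <= Num.min r t <= t by rewrite le_min r0 t0 ge_min lexx orbT.
rewrite (_ : _ @^-1` _ = [set w | (l < jump_count (N w) t)%N]
   `\` [set w | (l < jump_count (N w) (Num.min r t)%R)%N]).
  by apply: measurableD; apply: m_; rewrite ?t0 ?lexx.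
apply/seteqP; split => w /=; rewrite in_itv/= andbT /stopped_time.
  case: ifPn => [lt rT|_ r0']; last by move: r0'; rewrite ltNge r0.
  split => // /idP.
  rewrite -(jump_time_le (counting_pathP hmodel w)).
  - by rewrite le_min leNgt rT.
  - by rewrite (leq_trans lt)// jump_count_le.
  - by case/andP: rt => -> /le_trans ->.
move=> [lt] /negP; rewrite lt.
rewrite -(jump_time_le (counting_pathP hmodel w)).
- rewrite le_min negb_and -!ltNge => /orP[//|].
  by rewrite ltNge (jump_time_le (counting_pathP hmodel w)) ?lt ?t0// (leq_trans lt)// jump_count_le.
- by rewrite (leq_trans lt)// jump_count_le.
- by case/andP: rt => -> /le_trans ->.
Qed.

Let G := projT1 (cid (proj2 bg)).
Let gG z : `|g z| <= G. Proof. exact: (projT2 (cid (proj2 bg))). Qed.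
Let D := projT1 (cid (proj2 bpl)).
Let plD z : `|psi z * lam z| <= D. Proof. exact: (projT2 (cid (proj2 bpl))). Qed.
Let G0 : 0 <= G. Proof. exact: le_trans (gG point). Qed.
Let D0 : 0 <= D. Proof. exact: le_trans (plD point). Qed.

Let jump_sum_le m t w : (jump_count (N w) t < m)%N -> 0 <= t ->
  `|jump_sum (N w) (fun u => g (u, X w)) 0 t| <= G * m%:R.
Proof.
move=> tm t0; apply: (le_trans (ler_norm_sum _ _ _)).
apply: (@le_trans _ _ (\sum_(jump_count (N w) 0 <= l < jump_count (N w) t) G)).
  by apply: ler_sum => l _.
rewrite big_const_nat iter_addr_0 -[leLHS]mulr_natr ler_wpM2l// ler_nat.
by rewrite (leq_trans (leq_subr _ _))// ltnW.
Qed.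

Let xi_le m t w : 0 <= t <= 1 -> xi m t w <= \1_Cset w * expR (G * m%:R + D).
Proof.
move=> /andP[t0 t1]; rewrite /xi ler_wpM2l//.
case: ltnP => tm; last by rewrite mul0r expR_ge0.
rewrite mul1r ler_expR /log_martingale lerD//.
  exact: le_trans (ler_norm _) (jump_sum_le tm t0).
rewrite lerNl; have := @time_int_norm _ _ _ _ _ _ _ _ _ _ hmodel _ D 0 t w bpl t0 plD.
rewrite ler_norml subr0 => /andP[+ _].
by apply: le_trans; rewrite lerN2 ler_piMr.
Qed.

Let bxi m t : 0 <= t <= 1 -> bounded_measurable (xi m t : T_ t -> R).
Proof.
move=> t01; have /andP[t0 t1] := t01; split; last first.
  exists (expR (G * m%:R + D)) => w; rewrite ger0_norm//.
  apply: (le_trans (xi_le m w t01)).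
  by rewrite ler_piMl ?expR_ge0// indicE; case: (_ \in _).
(* A fixed number of [F t]-measurable terms, equal to the jump sum when fewer than [m] jumps have
   occurred. *)
pose J w := \sum_(l < m) (l < jump_count (N w) t)%N%:R * g (stopped_time l t w, X w).
have mb (f : T_ t -> bool) : measurable_fun setT f -> measurable_fun setT (fun w => (f w)%:R : R).
  move=> mf; rewrite (_ : (fun _ => _) = (fun w => if f w then 1 else 0 : R)); last first.
    by apply/funext => w; case: (f w).
  exact: measurable_fun_ifT.
have mJ : measurable_fun setT (J : T_ t -> R).
  apply: measurable_sum => l; apply: measurable_funM.
    by apply: mb; exact: FltE.
  apply: (measurableT_comp (proj1 bg)); apply: measurable_fun_pair; first exact: mstopped.
  exact: (measurable_covariates_F hmodel t0).
have m1 : measurable_fun setT ((fun w => \1_Cset w) : T_ t -> R).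
  apply: measurable_indic; rewrite /measurable/= (filtrationE hF t0).
  exact: (filtration_cube hmodel t0).
have ms : measurable_fun setT ((fun w => (jump_count (N w) t < m)%N%:R) : T_ t -> R).
  case: (m) => [|m']; first exact: measurable_cst.
  rewrite (_ : (fun _ => _) = (fun w => (~~ (m' < jump_count (N w) t)%N)%:R)).
    by apply: mb; apply: measurable_neg; exact: FltE.
  by apply/funext => w; rewrite -leqNgt ltnS.
have mC := measurable_time_int_F hmodel bpl (lexx 0) t0 t1.
have me : measurable_fun setT ((fun w => expR (J w - time_int X Y (fun z => psi z * lam z) 0 t w)) : T_ t -> R).
  apply: measurableT_comp => //; exact: measurable_funB mJ mC.
have JE w : (jump_count (N w) t < m)%N ->
    J w = jump_sum (N w) (fun u => g (u, X w)) 0 t.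
  move=> tm; rewrite /J /jump_sum jump_count0; last exact: (counting_pathP hmodel w).
  rewrite -(big_mkord xpredT (fun l => (l < jump_count (N w) t)%N%:R * g (stopped_time l t w, X w))).
  rewrite (big_cat_nat (n := jump_count (N w) t))//=; last exact: ltnW.
  rewrite [X in _ + X](_ : _ = 0) ?addr0; last first.
    by rewrite big_nat big1// => l /andP[tl _]; rewrite ltnNge tl mul0r.
  by apply: eq_big_nat => l /andP[_ lt]; rewrite /stopped_time lt mul1r.
have := measurable_funM m1 (measurable_funM ms me).
apply: eq_measurable_fun => w _ /=; rewrite /xi /log_martingale.
by case: (ltnP (jump_count (N w) t) m) => tm; [rewrite (JE w tm)|rewrite !mul0r].
Qed.

Lemma measurable_jump_sum phi s t : measurable_fun setT phi -> 0 <= s -> s <= t ->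
  measurable_fun setT (fun w => jump_sum (N w) (fun u => phi (u, X w)) s t : R).
Proof.
move=> mphi s0 st; have t0 : 0 <= t by exact: le_trans st.
pose W n w : R := \sum_(l < n) (jump_count (N w) s <= l < jump_count (N w) t)%N%:R
  * phi (jump_time (N w) l, X w).
have mlt l u : 0 <= u -> measurable_fun setT (fun w => (l < jump_count (N w) u)%N).
  move=> u0; apply: (measurable_fun_bool true); rewrite setTI.
  exact: (measurable_jump_count_lt hmodel l u0).
apply: (measurable_fun_cvg (h := W)) => [n|w _].
  apply: measurable_sum => l; apply: measurable_funM; last first.
    exact: (measurableT_comp mphi (measurable_jump_point hmodel l)).
  rewrite (_ : (fun _ => _) = (fun w => if ~~ (l < jump_count (N w) s)%N && (l < jump_count (N w) t)%N then 1 else 0 : R)); last first.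
    by apply/funext => w; rewrite -leqNgt; case: ifP.
  apply: measurable_fun_ifT => //; apply: measurable_and; last exact: mlt.
  by apply: measurable_neg; exact: mlt.
apply: cvg_near_cst; exists (jump_count (N w) t) => // n /= tn.
rewrite /W -(big_mkord xpredT (fun l => (jump_count (N w) s <= l < jump_count (N w) t)%N%:R
  * phi (jump_time (N w) l, X w))).
rewrite (big_cat_nat (n := jump_count (N w) t))//=.
rewrite [X in _ + X](_ : _ = 0) ?addr0; last first.
  by rewrite big_nat big1// => l /andP[tl _]; rewrite (ltnNge l) tl andbF mul0r.
rewrite (big_cat_nat (n := jump_count (N w) s))//=; last exact: jump_count_le.
rewrite [X in X + _](_ : _ = 0) ?add0r; last first.
  by rewrite big_nat big1// => l /andP[_ ls]; rewrite leqNgt ls mul0r.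
by apply: eq_big_nat => l lst; rewrite lst mul1r.
Qed.

(** The compensation formula is stated for nonnegative integrands, so [psi] is split by sign. *)
Let psiP z := Num.max (psi z) 0.
Let psiN z := Num.max (- psi z) 0.

Let psiPN z : psiP z - psiN z = psi z. Proof. exact: maxr0B. Qed.

Let bmax (f : R * borel R k -> R) : bounded_measurable f ->
  bounded_measurable (fun z => Num.max (f z) 0).
Proof.
move=> [mf [M fM]]; split; first by apply: measurable_maxr => //; exact: measurable_cst.
exists M => z; rewrite ger0_norm ?le_max ?lexx ?orbT// ge_max (le_trans (ler_norm _))//=.
exact: le_trans (fM z).
Qed.

Let bpsiP : bounded_measurable psiP. Proof. exact: bmax. Qed.
Let bpsiN : bounded_measurable psiN.
Proof.
apply: bmax; rewrite (_ : (fun _ => _) = (fun z => -1 * psi z)).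
  exact: bounded_measurableZ.
by apply/funext => z; rewrite mulN1r.
Qed.
Let psiP0 z : 0 <= psiP z. Proof. by rewrite le_max lexx orbT. Qed.
Let psiN0 z : 0 <= psiN z. Proof. by rewrite le_max lexx orbT. Qed.

Let Gp := projT1 (cid (proj2 bpsi)).
Let psiG z : `|psi z| <= Gp. Proof. exact: (projT2 (cid (proj2 bpsi))). Qed.
Let Gp0 : 0 <= Gp. Proof. exact: le_trans (psiG point). Qed.
Let psiPG z : psiP z <= Gp.
Proof. by rewrite ge_max Gp0 andbT (le_trans (ler_norm _)). Qed.
Let psiNG z : psiN z <= Gp.
Proof. by rewrite ge_max Gp0 andbT (le_trans (ler_norm _))// normrN. Qed.

Let bl phi : bounded_measurable phi -> bounded_measurable (fun z => phi z * lam z).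
Proof. by move=> b; exact: bounded_measurableM. Qed.

Let I phi s t w := time_int X Y (fun z => phi z * lam z) s t w.
Let J phi s t w : R := jump_sum (N w) (fun u => phi (u, X w)) s t.

Let I_ge0 phi s t w : (forall z, 0 <= phi z) -> 0 <= I phi s t w.
Proof.
by move=> H; apply: (time_int_ge0 hmodel) => z; apply: mulr_ge0 => //; exact: (cube_intensity_ge0 hmodel).
Qed.

Let J_ge0 phi s t w : (forall z, 0 <= phi z) -> 0 <= J phi s t w.
Proof. by move=> H; apply: sumr_ge0 => l _. Qed.

Let a0_ge0 : 0 <= a0.
Proof. exact: le_trans (cube_intensity_ge0 hmodel point) (cube_intensity_le hmodel alpha0_le point). Qed.

Let I_le phi s t w : bounded_measurable phi -> (forall z, 0 <= phi z) -> (forall z, phi z <= Gp) ->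
  s <= t -> I phi s t w <= Gp * a0 * (t - s).
Proof.
move=> b p0 pG st; apply: (le_trans (ler_norm _)).
apply: (time_int_norm hmodel) => //; first exact: bl.
move=> z; rewrite ger0_norm; last by apply: mulr_ge0 => //; exact: (cube_intensity_ge0 hmodel).
by apply: ler_pM => //; [exact: (cube_intensity_ge0 hmodel)|exact: (cube_intensity_le hmodel)].
Qed.

Let J_le phi s t w : (forall z, phi z <= Gp) -> 0 <= s -> s <= t ->
  J phi s t w <= Gp * (N w t - N w s).
Proof.
move=> pG s0 st; rewrite -(jump_sum_const (counting_pathP hmodel w))//.
by apply: ler_sum => l _.
Qed.

Let mI phi s t : bounded_measurable phi -> measurable_fun setT (I phi s t).
Proof. by move=> b; apply: (measurable_time_int hmodel); exact: bl. Qed.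

Let mxi m t : 0 <= t <= 1 -> measurable_fun setT (xi m t).
Proof.
move=> t01; have [mx _] := bxi m t01.
by apply: (measurableT_comp mx); apply: (measurable_filtrationT hF); case/andP: t01.
Qed.

(** The weighted compensated increment is [incr] for ([psiP], [psiN]) minus [incr] for ([psiN],
    [psiP]). Compensation trades a jump sum for a time integral, so the two have the same mean. *)
Let incr m phi phi' s t w := xi m s w * (J phi s t w + I phi' s t w).

Let incr_ge0 m phi phi' s t w : (forall z, 0 <= phi z) -> (forall z, 0 <= phi' z) ->
  0 <= incr m phi phi' s t w.
Proof. by move=> p p'; apply: mulr_ge0 => //; apply: addr_ge0; [exact: J_ge0|exact: I_ge0]. Qed.

Let mincr m phi phi' s t : bounded_measurable phi -> bounded_measurable phi' ->
  0 <= s -> s <= t -> t <= 1 -> measurable_fun setT (incr m phi phi' s t).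
Proof.
move=> b b' s0 st t1; apply: measurable_funM.
  by apply: mxi; rewrite s0 (le_trans st).
exact: measurable_funD (measurable_jump_sum (proj1 b) s0 st) (mI s t b').
Qed.

Let xiI_fin m phi s t : bounded_measurable phi -> (forall z, 0 <= phi z) ->
  (forall z, phi z <= Gp) -> 0 <= s -> s <= t -> t <= 1 ->
  (\int[P]_w (xi m s w * I phi s t w)%:E)%E \is a fin_num.
Proof.
move=> b p0 pG s0 st t1; have s01 : 0 <= s <= 1 by rewrite s0 (le_trans st).
rewrite ge0_fin_numE; last first.
  by apply: integral_ge0 => w _; rewrite lee_fin; apply: mulr_ge0 => //; exact: I_ge0.
apply: (@le_lt_trans _ _ (\int[P]_w (expR (G * m%:R + D) * (Gp * a0))%:E)%E).
  apply: ge0_le_integral => //.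
  - by move=> w _; rewrite lee_fin; apply: mulr_ge0 => //; exact: I_ge0.
  - apply/measurable_EFinP; exact: measurable_funM (mxi m s01) (mI s t b).
  - move=> w _; rewrite lee_fin; apply: ler_pM => //.
    + exact: I_ge0.
    + apply: (le_trans (xi_le m w s01)).
      by rewrite ler_piMl ?expR_ge0// indicE; case: (_ \in _).
    + apply: (le_trans (I_le w b p0 pG st)).
      by apply: ler_piMr; [exact: mulr_ge0|lra].
by rewrite integral_cst//= probability_setT mule1 ltry.
Qed.

Let integral_incr m phi phi' s t : bounded_measurable phi -> bounded_measurable phi' ->
  (forall z, 0 <= phi z) -> (forall z, 0 <= phi' z) ->
  0 <= s -> s <= t -> t <= 1 ->
  (\int[P]_w (incr m phi phi' s t w)%:E
   = \int[P]_w (xi m s w * I phi s t w)%:E + \int[P]_w (xi m s w * I phi' s t w)%:E)%E.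
Proof.
move=> b b' p0 p'0 s0 st t1; have s01 : 0 <= s <= 1 by rewrite s0 (le_trans st).
have xJ0 w : (0 <= (xi m s w * J phi s t w)%:E)%E.
  by rewrite lee_fin; apply: mulr_ge0 => //; exact: J_ge0.
have xI0 w : (0 <= (xi m s w * I phi' s t w)%:E)%E.
  by rewrite lee_fin; apply: mulr_ge0 => //; exact: I_ge0.
have mxJ : measurable_fun setT (fun w => (xi m s w * J phi s t w)%:E).
  apply/measurable_EFinP; exact: measurable_funM (mxi m s01) (measurable_jump_sum (proj1 b) s0 st).
have mxI : measurable_fun setT (fun w => (xi m s w * I phi' s t w)%:E).
  apply/measurable_EFinP; exact: measurable_funM (mxi m s01) (mI s t b').
have E : (fun w => (incr m phi phi' s t w)%:E)
    = (fun w => (xi m s w * J phi s t w)%:E + (xi m s w * I phi' s t w)%:E)%E.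
  by apply/funext => w; rewrite -EFinD -mulrDr.
apply: (etrans (congr1 (integral P setT) E)).
apply: (etrans (ge0_integralD P measurableT (fun w _ => xJ0 w) mxJ (fun w _ => xI0 w) mxI)).
congr (_ + _)%E.
exact: (compensation_formula hmodel alpha0_le s0 st t1 (bxi m s01) (xi_ge0 m s) (fun w => @xi_out m s w) b p0).
Qed.

Let incr_sym m s t : 0 <= s -> s <= t -> t <= 1 ->
  (\int[P]_w (incr m psiP psiN s t w)%:E = \int[P]_w (incr m psiN psiP s t w)%:E)%E /\
  (\int[P]_w (incr m psiN psiP s t w)%:E)%E \is a fin_num.
Proof.
move=> s0 st t1.
have EP := integral_incr m bpsiP bpsiN psiP0 psiN0 s0 st t1.
have EN := integral_incr m bpsiN bpsiP psiN0 psiP0 s0 st t1.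
split; first exact: (etrans EP (etrans (addeC _ _) (esym EN))).
apply: (eq_ind_r (fun z => z \is a fin_num) _ EN); rewrite fin_numD; apply/andP; split.
  exact: (xiI_fin m bpsiN psiN0 psiNG s0 st t1).
exact: (xiI_fin m bpsiP psiP0 psiPG s0 st t1).
Qed.

Let grid (K i : nat) : R := i%:R / K%:R.

Let grid_ge0 K i : 0 <= grid K i. Proof. by rewrite divr_ge0. Qed.
Let grid_leS K i : grid K i <= grid K i.+1.
Proof. by rewrite ler_wpM2r ?invr_ge0// ler_nat. Qed.
Let grid_le1 K i : (i <= K)%N -> grid K i <= 1.
Proof.
case: K => [|K] iK; first by rewrite /grid invr0 mulr0 ler01.
by rewrite ler_pdivrMr ?mul1r ?ler_nat ?ltr0n.
Qed.

Let mC : measurable Cset.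
Proof. exact: (filtration_measurable hF (lexx 0) (filtration_cube hmodel (lexx 0))). Qed.

Let Mf m := expR (G * m%:R + D).

(** An integrable bound on [sumB] for all grids at once; added to the discretization, it makes the
    functions nonnegative, as Fatou's lemma demands. *)
Let dom m w : R := \1_Cset w * (Mf m * (Gp * N w 1 + Gp * a0)).

Let dom_ge0 m w : 0 <= dom m w.
Proof.
apply: mulr_ge0 => //; apply: mulr_ge0; first exact: expR_ge0.
by apply: addr_ge0; apply: mulr_ge0 => //; exact: (count_ge0 hmodel).
Qed.

Let mdom m : measurable_fun setT (dom m).
Proof.
apply: measurable_funM; first exact: measurable_indic.
apply: measurable_funM => //; apply: measurable_funD => //.
by apply: measurable_funM => //; exact: (measurable_count hmodel).
Qed.

Let dom_fin m : (\int[P]_w (dom m w)%:E)%E \is a fin_num.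
Proof.
have f0 w : 0 <= Mf m * (Gp * N w 1 + Gp * a0).
  apply: mulr_ge0; first exact: expR_ge0.
  by apply: addr_ge0; apply: mulr_ge0 => //; exact: (count_ge0 hmodel).
rewrite ge0_fin_numE; last by apply: integral_ge0 => w _; rewrite lee_fin.
rewrite integral_mul_indic setTI.
have E : (\int[P]_(w in Cset) (Mf m * (Gp * N w 1 + Gp * a0))%:E
  = \int[P]_(w in Cset) ((Mf m * Gp)%:E * (N w 1)%:E + (Mf m * Gp * a0)%:E))%E.
  by apply: eq_integral => w _; rewrite -EFinM -EFinD; congr EFin; ring.
have MG0 : (0 <= (Mf m * Gp)%:E)%E by rewrite lee_fin; apply: mulr_ge0 => //; exact: expR_ge0.
have N0 w : (0 <= (N w 1)%:E)%E by rewrite lee_fin; exact: (count_ge0 hmodel).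
have mN : measurable_fun Cset (fun w => (N w 1)%:E).
  by apply/measurable_EFinP/measurable_funTS; exact: (measurable_count hmodel).
rewrite E ge0_integralD//; last 3 first.
- by move=> w _; exact: mule_ge0.
- by apply: emeasurable_funM => //; exact: measurable_cst.
- by move=> w _; rewrite lee_fin; apply: mulr_ge0 => //; rewrite -lee_fin.
rewrite (ge0_integralZl P mC mN (fun w _ => N0 w) MG0) integral_cst//.
rewrite lte_add_pinfty//.
  apply: lte_mul_pinfty => //; apply: (count_cube_finite hmodel alpha0_le).
  by rewrite ler01 lexx.
apply: lte_mul_pinfty => //; last by rewrite (le_lt_trans (probability_le1 _ mC))// ltry.
by rewrite lee_fin; apply: mulr_ge0 => //; rewrite -lee_fin.
Qed.

Let sumA K m w := \sum_(i < K) incr m psiP psiN (grid K i) (grid K i.+1) w.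
Let sumB K m w := \sum_(i < K) incr m psiN psiP (grid K i) (grid K i.+1) w.

Let sum_ge0 K m phi phi' w : (forall z, 0 <= phi z) -> (forall z, 0 <= phi' z) ->
  0 <= \sum_(i < K) incr m phi phi' (grid K i) (grid K i.+1) w.
Proof. by move=> p p'; apply: sumr_ge0 => i _; exact: incr_ge0. Qed.

Let msum K m phi phi' : bounded_measurable phi -> bounded_measurable phi' ->
  measurable_fun setT (fun w => \sum_(i < K) incr m phi phi' (grid K i) (grid K i.+1) w).
Proof.
move=> b b'.
have -> : (fun w => \sum_(i < K) incr m phi phi' (grid K i) (grid K i.+1) w)
    = (fun w => \sum_(i <- index_enum 'I_K) (if (i < K)%N then incr m phi phi' (grid K i) (grid K i.+1) w else 0)).
  by apply/funext => w; apply: eq_bigr => i _; rewrite ltn_ord.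
apply: measurable_sum => i; rewrite ltn_ord.
by apply: mincr => //; exact: grid_le1.
Qed.

Let integral_sum K m phi phi' : bounded_measurable phi -> bounded_measurable phi' ->
  (forall z, 0 <= phi z) -> (forall z, 0 <= phi' z) ->
  (\int[P]_w (\sum_(i < K) incr m phi phi' (grid K i) (grid K i.+1) w)%:E
   = \sum_(i < K) \int[P]_w (incr m phi phi' (grid K i) (grid K i.+1) w)%:E)%E.
Proof.
move=> b b' p p'; under eq_integral do rewrite -sumEFin.
rewrite ge0_integral_sum//.
- by move=> i; apply/measurable_EFinP; apply: mincr => //; exact: grid_le1.
- by move=> i w _; rewrite lee_fin; exact: incr_ge0.
Qed.

Let sumB_le K m w : sumB K m w <= dom m w.
Proof.
(* Each increment is at most a constant times an increment of [v], so the sum telescopes. *)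
pose v i := Gp * N w (grid K i) + Gp * a0 * grid K i.
apply: (@le_trans _ _ (\sum_(i < K) \1_Cset w * Mf m * (v i.+1 - v i))).
  apply: ler_sum => i _; apply: ler_pM => //.
  - by apply: addr_ge0; [exact: J_ge0|exact: I_ge0].
  - by apply: xi_le; rewrite grid_ge0 grid_le1// ltnW.
  rewrite (_ : v i.+1 - v i = Gp * (N w (grid K i.+1) - N w (grid K i)) + Gp * a0 * (grid K i.+1 - grid K i)).
    by apply: lerD; [exact: J_le|exact: I_le].
  by rewrite /v; ring.
rewrite -mulr_sumr -(big_mkord xpredT (fun i => v i.+1 - v i)) telescope_sumr//.
rewrite /dom -mulrA; apply: ler_wpM2l => //; apply: ler_wpM2l; first exact: expR_ge0.
have N0 : 0 <= N w (grid K 0) by exact: (count_ge0 hmodel).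
have NK : N w (grid K K) <= N w 1 by apply: cumulative_is_nondecreasing; exact: grid_le1.
rewrite /v /grid mul0r mulr0 addr0 -/(grid K K) lerBlDr; apply: (@le_trans _ _ (Gp * N w 1 + Gp * a0)).
  apply: lerD; first exact: ler_wpM2l.
  by apply: ler_piMr; [exact: mulr_ge0|exact: grid_le1].
by rewrite lerDl; apply: mulr_ge0 => //; move: N0; rewrite /grid mul0r.
Qed.

Let h K m w := \1_Cset w + (sumA K m w - sumB K m w) + dom m w.

(** [sumA] and [sumB] have the same finite mean, so they cancel for every grid. *)
Let integral_h K m : (\int[P]_w (h K m w)%:E = \int[P]_w (\1_Cset w + dom m w)%:E)%E.
Proof.
have m1 : measurable_fun setT (\1_Cset : T -> R) by exact: measurable_indic.
have i1 w : 0 <= \1_Cset w :> R by [].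
have mA : measurable_fun setT (sumA K m) by exact: msum.
have mB : measurable_fun setT (sumB K m) by exact: msum.
have A0 w : 0 <= sumA K m w by exact: sum_ge0.
have B0 w : 0 <= sumB K m w by exact: sum_ge0.
have h0 w : 0 <= h K m w.
  by have := sumB_le K m w; have := A0 w; have := i1 w; rewrite /h; lra.
have mh : measurable_fun setT (h K m).
  exact: measurable_funD (measurable_funD m1 (measurable_funB mA mB)) (mdom m).
have AB : (\int[P]_w (sumA K m w)%:E = \int[P]_w (sumB K m w)%:E)%E.
  apply: (etrans (integral_sum K m bpsiP bpsiN psiP0 psiN0)).
  apply: (etrans _ (esym (integral_sum K m bpsiN bpsiP psiN0 psiP0))).
  apply: eq_bigr => i _.
  by case: (incr_sym m (grid_ge0 K i) (grid_leS K i) (grid_le1 (ltn_ord i))).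
have Bfin : (\int[P]_w (sumB K m w)%:E)%E \is a fin_num.
  apply: (eq_ind_r (fun z => z \is a fin_num) _ (integral_sum K m bpsiN bpsiP psiN0 psiP0)).
  apply: (big_ind (fun z => z \is a fin_num)) => [//|x y xf yf|i _].
    by rewrite fin_numD xf.
  by case: (incr_sym m (grid_ge0 K i) (grid_leS K i) (grid_le1 (ltn_ord i))).
have d0 w : 0 <= \1_Cset w + dom m w by apply: addr_ge0.
have md : measurable_fun setT (fun w => \1_Cset w + dom m w) by exact: measurable_funD m1 (mdom m).
have : (\int[P]_w (h K m w + sumB K m w)%:E
    = \int[P]_w ((\1_Cset w + dom m w) + sumA K m w)%:E)%E.
  by apply: eq_integral => w _; congr EFin; rewrite /h; ring.
move=> E; have {}E := etrans (esym (ge0_integral_EFinD P mh mB h0 B0)) (etrans E (ge0_integral_EFinD P md mA d0 A0)).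
have {}E := etrans E (congr1 (fun z => \int[P]_w (\1_Cset w + dom m w)%:E + z)%E AB).
have := congr1 (fun z => z - \int[P]_w (sumB K m w)%:E)%E E.
by move=> H; apply: (etrans (esym (addeK _ Bfin))); apply: (etrans H); exact: addeK.
Qed.

Let stopped_exponential m : (\int[P]_w (xi m 1 w)%:E <= P Cset)%E.
Proof.
have m1 : measurable_fun setT (\1_Cset : T -> R) by exact: measurable_indic.
have i1 w : 0 <= \1_Cset w :> R by [].
have mx : measurable_fun setT (xi m 1) by apply: mxi; rewrite ler01 lexx.
have key : (\int[P]_w (xi m 1 w + dom m w)%:E <= \int[P]_w (\1_Cset w + dom m w)%:E)%E.
  apply: (@fatou_eventually _ _ _ _ (fun w => xi m 1 w + dom m w) (fun K => h K m)).
  - exact: measurable_funD mx (mdom m).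
  - by move=> w; apply: addr_ge0.
  - move=> K; apply: measurable_funD (mdom m); apply: measurable_funD m1 _.
    by apply: measurable_funB; exact: msum.
  - move=> K w; have := sumB_le K m w; have := i1 w.
    by have := sum_ge0 K m w psiP0 psiN0; rewrite /h /sumA; lra.
  - by move=> K; apply: (eq_ind_r (fun z => (z <= _)%E) _ (integral_h K m)).
  move=> w eps eps0.
  have [cw|cw] := pselect (Cset w); last first.
    apply: nearW => K; have -> : xi m 1 w = 0 by exact: xi_out.
    have i0 : \1_Cset w = 0 :> R by rewrite indicE memNset.
    have x0 s t phi phi' : incr m phi phi' s t w = 0.
      by rewrite /incr xi_out ?mul0r.
    rewrite /h i0 /sumA /sumB !big1 ?subrr ?add0r//; lra.
  have i1w : \1_Cset w = 1 :> R by rewrite indicE mem_set.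
  have Clip s t : 0 <= s -> s <= t -> t <= 1 ->
      `|time_int X Y (fun z => psi z * lam z) 0 t w
        - time_int X Y (fun z => psi z * lam z) 0 s w| <= D * (t - s).
    move=> s0 st t1; rewrite (time_int_cat hmodel w bpl s0 st) addrC addKr.
    exact: (time_int_norm hmodel).
  have := @exponential_discretization _ (N w) (fun u => g (u, X w))
    (fun t => time_int X Y (fun z => psi z * lam z) 0 t w) G D m eps
    (counting_pathP hmodel w) G0 (fun u => gG _) D0 (time_intxx _ _ _) Clip eps0.
  apply: filterS => K H.
  have -> : xi m 1 w = if (jump_count (N w) 1 < m)%N then expR (log_martingale 1 w) else 0.
    by rewrite /xi i1w mul1r; case: ifP; rewrite ?mul1r ?mul0r.
  apply: (@le_trans _ _ (1 + \sum_(i < K) (jump_count (N w) (grid K i) < m)%N%:R *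
         (expR (log_martingale (grid K i) w) *
          (jump_sum (N w) (fun t => expR (g (t, X w)) - 1) (grid K i) (grid K i.+1)
           - (time_int X Y (fun z => psi z * lam z) 0 (grid K i.+1) w
              - time_int X Y (fun z => psi z * lam z) 0 (grid K i) w))) + eps + dom m w)).
    by rewrite lerD2r; exact: H.
  rewrite /h i1w /sumA /sumB -sumrB.
  rewrite [leLHS]addrAC lerD2r lerD2r lerD2l.
  rewrite le_eqVlt; apply/orP; left; apply/eqP; apply: eq_bigr => i _.
  have -> : time_int X Y (fun z => psi z * lam z) 0 (grid K i.+1) w
      - time_int X Y (fun z => psi z * lam z) 0 (grid K i) w
      = time_int X Y (fun z => psi z * lam z) (grid K i) (grid K i.+1) w.
    by rewrite (time_int_cat hmodel w bpl (grid_ge0 K i) (grid_leS K i)) addrAC subrr add0r.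
  rewrite /incr /xi i1w mul1r -mulrBr -mulrA; congr (_ * (_ * _)).
  have -> : time_int X Y (fun z => psi z * lam z) (grid K i) (grid K i.+1) w
      = I psiP (grid K i) (grid K i.+1) w - I psiN (grid K i) (grid K i.+1) w.
    rewrite /I -(time_intB hmodel _ _ _ (bl bpsiP) (bl bpsiN)); congr (time_int _ _ _ _ _ _).
    by apply/funext => z; rewrite -mulrBl psiPN.
  have -> : jump_sum (N w) (fun t => expR (g (t, X w)) - 1) (grid K i) (grid K i.+1)
      = J psiP (grid K i) (grid K i.+1) w - J psiN (grid K i) (grid K i.+1) w.
    by rewrite /J /jump_sum -sumrB; apply: eq_bigr => l _; rewrite psiPN.
  ring.
have E1 := ge0_integral_EFinD P mx (mdom m) (xi_ge0 m 1) (dom_ge0 m).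
have E2 := ge0_integral_EFinD P m1 (mdom m) i1 (dom_ge0 m).
rewrite -(leeD2rE _ _ (dom_fin m)).
apply: (le_trans _ (le_trans key _)); first by rewrite -E1.
have E3 : (\int[P]_w (\1_Cset w)%:E = P Cset)%E by rewrite integral_indic ?setIT.
by rewrite E2 E3.
Qed.

(** A second use of Fatou's lemma removes the bound [m] on the number of jumps. Off the cube event
    [g] vanishes along the path and the exponential is 1, which supplies the missing mass. *)
Lemma exponential_supermartingale :
  (\int[P]_w (expR (log_martingale 1 w))%:E <= 1)%E.
Proof.
have mL : measurable_fun setT (fun w => expR (log_martingale 1 w)).
  apply: measurableT_comp => //; apply: measurable_funB.
    exact: (measurable_jump_sum (proj1 bg) (lexx 0) ler01).
  exact: (measurable_time_int hmodel _ _ bpl).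
have mCc : measurable (~` Cset) by exact: measurableC.
have mx m : measurable_fun setT (xi m 1) by apply: mxi; rewrite ler01 lexx.
have m1 : measurable_fun setT (\1_(~` Cset) : T -> R) by exact: measurable_indic.
have i1 w : 0 <= \1_(~` Cset) w :> R by [].
apply: (@fatou_eventually _ _ _ _ _ (fun m w => xi m 1 w + \1_(~` Cset) w)) => //.
- by move=> m; exact: measurable_funD.
- by move=> m w; apply: addr_ge0.
- move=> m; apply: (@le_trans _ _ (P Cset + P (~` Cset))%E).
    rewrite (ge0_integral_EFinD P (mx m) m1 (xi_ge0 m 1) i1).
    apply: leeD; first exact: stopped_exponential.
    by rewrite integral_indic ?setIT.
  rewrite -measureU//; last exact: setICr.
  by apply: probability_le1; exact: measurableU.
move=> w eps eps0; have [cw|cw] := pselect (Cset w).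
  exists (jump_count (N w) 1).+1 => // m /= ltm.
  by rewrite /xi !indicE mem_set// memNset ?ltm; [rewrite !mul1r addr0 lerDl ltW|apply].
apply: nearW => m; rewrite xi_out// add0r indicE mem_set//.
have out u : ~ time_cube (u, X w) by case.
have L0 : log_martingale 1 w = 0.
  rewrite /log_martingale /jump_sum big1 ?sub0r; last by move=> l _; exact: gout.
  rewrite (_ : time_int _ _ _ _ _ _ = 0) ?oppr0//.
  have ez : time_int X Y (fun z => 0 * lam z) 0 1 w = 0 by rewrite (time_intZ hmodel)// mul0r.
  apply: (etrans _ ez); by apply: time_int_eq => u; rewrite gout// expR0 subrr.
by rewrite L0 expR0 lerDl ltW.
Qed.

End exponential_process.

(** * Exponential moments of the excess loss *)

Section scalar_exponentials.
Context {R : realType}.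
Implicit Types a b p q w v z x I H : R.

(** Convexity of exp, from its tangent line at [c]. *)
Lemma expR_young p q a b : 0 <= p -> 0 <= q -> p + q = 1 ->
  expR (p * a + q * b) <= p * expR a + q * expR b.
Proof.
move=> p0 q0 pq1; set c := p * a + q * b.
have Ea : expR a = expR c * expR (a - c) by rewrite -expRD addrCA subrr addr0.
have Eb : expR b = expR c * expR (b - c) by rewrite -expRD addrCA subrr addr0.
have Ha := ler_wpM2l p0 (expR_ge1Dx (a - c)).
have Hb := ler_wpM2l q0 (expR_ge1Dx (b - c)).
have : 1 <= p * expR (a - c) + q * expR (b - c).
  apply: (le_trans _ (lerD Ha Hb)).
  have -> : p * (1 + (a - c)) + q * (1 + (b - c)) = (p + q) * (1 - c) + c by rewrite /c; ring.
  by rewrite pq1; lra.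
move=> /(ler_wpM2l (expR_ge0 c)); rewrite mulr1 Ea Eb => /le_trans; apply.
by rewrite le_eqVlt; apply/orP; left; apply/eqP; ring.
Qed.

(** [I] and [H] stand for the normalized first and second moments of |h| along a path. The remainder
    of exp w is quadratic in [I], hence linear in [H]; so is exp v - 1, by convexity. The two
    coefficients, psi2 z and exp z (exp x - 1), add up to psi2 (z + x) + x. *)
Lemma expR_split w v z x I H : 0 <= z -> 0 <= x -> `|w| <= z * I -> 0 <= v <= x * H ->
  0 <= I <= 1 -> I ^+ 2 <= H <= 1 ->
  expR (w + v) <= 1 + w + H * (psi2 (z + x) + x).
Proof.
move=> z0 x0 wz /andP[v0 vx] /andP[I0 I1] /andP[IH H1].
have H0 : 0 <= H by apply: le_trans IH; exact: sqr_ge0.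
have pw : psi2 w <= H * psi2 z.
  apply: (@le_trans _ _ (I ^+ 2 * psi2 z)).
    by apply: psi2_le_scaled; rewrite ?I0// mulrC.
  by rewrite ler_wpM2r// psi2_ge0.
have pv : expR v - 1 <= H * (expR x - 1).
  apply: (@le_trans _ _ (expR (H * x) - 1)); first by rewrite lerD2r ler_expR mulrC.
  have : psi2 (H * x) <= H ^+ 2 * psi2 x.
    by apply: psi2_le_scaled; rewrite ?H0// ger0_norm// mulr_ge0.
  have : H ^+ 2 * psi2 x <= H * psi2 x.
    by rewrite ler_wpM2r ?psi2_ge0// expr2 ler_piMl.
  by rewrite /psi2; lra.
have ez : expR w <= expR z.
  rewrite ler_expR (le_trans (ler_norm _))// (le_trans wz)//.
  by rewrite ler_piMr.
have v1 : 0 <= expR v - 1 by rewrite subr_ge0 -(expR0 R) ler_expR.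
have : expR w * (expR v - 1) <= expR z * (H * (expR x - 1)).
  by apply: ler_pM => //; exact: expR_ge0.
move: pw; rewrite expRD /psi2 expRD; move: (expR w) (expR v) (expR z) (expR x).
by move=> ew ev ez' ex; nra.
Qed.

(** The summand 1/4 absorbs z/6, which is below 1/4; then s / (s + 1/4 - z/6) is at most 1. *)
Lemma psi2_le_half_sq (s z : R) : 0 <= s -> 0 <= z < 3 / 2 ->
  s ^+ 2 * psi2 (z / (s + 4^-1)) <= z ^+ 2 / 2.
Proof.
move=> s0 /andP[z0 z32].
have A0 : 0 < s + 4^-1 by lra.
have u0 : 0 <= z / (s + 4^-1) by rewrite divr_ge0// ltW.
have u6 : z / (s + 4^-1) < 6 by rewrite ltr_pdivrMr//; lra.
have H := psi2_le (u := z / (s + 4^-1)) ltac:(by rewrite u0 u6).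
apply: (le_trans (ler_wpM2l (sqr_ge0 s) H)).
have d0 : 0 < s + 4^-1 - z / 6 by lra.
have -> : s ^+ 2 * ((z / (s + 4^-1)) ^+ 2 / (2 * (1 - z / (s + 4^-1) / 6) ^+ 2))
   = z ^+ 2 / 2 * (s / (s + 4^-1 - z / 6)) ^+ 2.
  by field; repeat (apply/andP; split); apply/negP => /eqP; lra.
rewrite ler_piMr ?divr_ge0 ?sqr_ge0//.
apply: exprn_ile1; first by apply: divr_ge0 => //; exact: ltW.
by rewrite ler_pdivrMr// mul1r; lra.
Qed.

End scalar_exponentials.

(** * Losses and risks as path integrals *)

Section loss.
Context {R : realType} {k : nat} {dT : measure_display} {T : measurableType dT}
  {P : probability T R} {F : R -> set (set T)}
  {alpha0 : R * borel R k -> R} {X : {RV P >-> borel R k}}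
  {N : T -> cumulative R R} {Y : R -> T -> R}
  (hmodel : counting_model F alpha0 X N Y)
  {a0 : R} (alpha0_le : forall z, time_cube z -> alpha0 z <= a0).
Local Notation lam := (@cube_intensity R k alpha0).
Implicit Type phi : R * borel R k -> R.

Let hF := model_filtration hmodel.
Let blam := bounded_measurable_cube_intensity hmodel alpha0_le.

Definition jump_integral phi w : R := jump_sum (N w) (fun u => phi (u, X w)) 0 1.

Lemma loss_model phi w : bounded_measurable phi ->
  loss phi (X w) (Y ^~ w) (N w)
  = time_int X Y (fun z => phi z ^+ 2) 0 1 w - 2 * jump_integral phi w.
Proof.
move=> b; rewrite /loss; congr (_ - 2 * _); last first.
  rewrite integral_stieltjes_path//; first exact: (counting_pathP hmodel w).
  exact: (measurableT_comp (proj1 b) (pair2_measurable (X w))).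
have b2 : bounded_measurable (fun z => phi z ^+ 2) by exact: bounded_measurableM.
have [mp _] := bounded_measurable_path hmodel w b2.
apply: (etrans _ (itv_integral_cc 0 1 mp)).
apply: eq_Rintegral => u u01; rewrite /risk_process indicE.
by rewrite u01 mul1r.
Qed.

Lemma bounded_measurable_time_int phi s t : bounded_measurable phi -> s <= t ->
  bounded_measurable (time_int X Y phi s t).
Proof.
move=> b st; split; first exact: (measurable_time_int hmodel).
have [_ [M bM]] := b.
by exists (M * (t - s)) => w; exact: (time_int_norm hmodel).
Qed.

Lemma bounded_measurable_P_integrable (f : T -> R) : bounded_measurable f ->
  P.-integrable setT (EFin \o f).
Proof.
move=> b; apply: bounded_measurable_integrable => //.
by rewrite (le_lt_trans (probability_le1 _ _))// ltry.
Qed.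

Lemma measurable_jump_integral phi : measurable_fun setT phi ->
  measurable_fun setT (jump_integral phi).
Proof. by move=> m; exact: (measurable_jump_sum hmodel m (lexx 0) ler01). Qed.

Lemma log_martingaleE phi w :
  @log_martingale R k dT T P alpha0 X N Y phi 1 w
  = jump_integral phi w - time_int X Y (fun z => (expR (phi z) - 1) * lam z) 0 1 w.
Proof. by []. Qed.

Lemma jump_integralB phi phi' w :
  jump_integral (fun z => phi z - phi' z) w = jump_integral phi w - jump_integral phi' w.
Proof. by rewrite /jump_integral /jump_sum -sumrB. Qed.

Lemma jump_integralZ c phi w :
  jump_integral (fun z => c * phi z) w = c * jump_integral phi w.
Proof. by rewrite /jump_integral /jump_sum mulr_sumr. Qed.

(** Compensation over ]0, 1] with the indicator of the cube event as weight; off that event both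
    integrands vanish because [phi] does. *)
Lemma integral_jump_ge0 phi : bounded_measurable phi -> (forall z, 0 <= phi z) ->
  (forall z, ~ time_cube z -> phi z = 0) ->
  (\int[P]_w (jump_integral phi w)%:E
   = \int[P]_w (time_int X Y (fun z => phi z * lam z) 0 1 w)%:E)%E.
Proof.
move=> b p0 pout.
set C := X @^-1` @unit_cube R k.
have bx : bounded_measurable ((\1_C : T -> R) : g_sigma_algebraType (F 0) -> R).
  apply: bounded_measurable_indic; rewrite /measurable/= (filtrationE hF (lexx 0)).
  exact: (filtration_cube hmodel (lexx 0)).
have x0 w : 0 <= \1_C w :> R by [].
have xout w : ~ unit_cube (X w) -> \1_C w = 0 :> R.
  by move=> h; rewrite indicE memNset.
have H := compensation_formula hmodel alpha0_le (lexx 0) ler01 (lexx 1) bx x0 xout b p0.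
have EJ : (fun w => (jump_integral phi w)%:E)
    = (fun w => (\1_C w * jump_sum (N w) (fun u => phi (u, X w)) 0 1)%:E).
  apply/funext => w; congr EFin; rewrite /jump_integral indicE.
  case: (boolP (w \in C)) => [_|/negP wC]; first by rewrite mul1r.
  rewrite mul0r /jump_sum big1// => l _; apply: pout => -[_ h].
  by apply: wC; exact/mem_set.
have EI : (fun w => (\1_C w * time_int X Y (fun z => phi z * lam z) 0 1 w)%:E)
    = (fun w => (time_int X Y (fun z => phi z * lam z) 0 1 w)%:E).
  apply/funext => w; congr EFin; rewrite indicE.
  case: (boolP (w \in C)) => [_|/negP wC]; first by rewrite mul1r.
  have ez : time_int X Y (fun z => 0 * lam z) 0 1 w = 0 by rewrite (time_intZ hmodel)// mul0r.
  rewrite mul0r; apply: (etrans (esym ez)); apply: time_int_eq => u; rewrite pout// => -[_ h].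
  by apply: wC; exact/mem_set.
exact: (etrans (congr1 (integral P setT) EJ) (etrans H (congr1 (integral P setT) EI))).
Qed.

Lemma integral_jump phi : bounded_measurable phi ->
  (forall z, ~ time_cube z -> phi z = 0) ->
  P.-integrable setT (EFin \o jump_integral phi) /\
  \int[P]_w jump_integral phi w
  = \int[P]_w time_int X Y (fun z => phi z * lam z) 0 1 w.
Proof.
move=> b pout.
have bmax (f : R * borel R k -> R) : bounded_measurable f ->
    bounded_measurable (fun z => Num.max (f z) 0).
  move=> [mf [M fM]]; split; first by apply: measurable_maxr => //; exact: measurable_cst.
  exists M => z; rewrite ger0_norm ?le_max ?lexx ?orbT// ge_max (le_trans (ler_norm _))//=.
  exact: le_trans (fM z).
have bN : bounded_measurable (fun z => - phi z).
  rewrite (_ : (fun _ => _) = (fun z => -1 * phi z)); first exact: bounded_measurableZ.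
  by apply/funext => z; rewrite mulN1r.
have part (f : R * borel R k -> R) : bounded_measurable f -> (forall z, ~ time_cube z -> f z = 0) ->
    P.-integrable setT (EFin \o jump_integral (fun z => Num.max (f z) 0)) /\
    \int[P]_w jump_integral (fun z => Num.max (f z) 0) w
    = \int[P]_w time_int X Y (fun z => Num.max (f z) 0 * lam z) 0 1 w.
  move=> bf fout; have bm := bmax _ bf.
  have f0 z : 0 <= Num.max (f z) 0 by rewrite le_max lexx orbT.
  have fmout z : ~ time_cube z -> Num.max (f z) 0 = 0 by move=> /fout ->; rewrite maxxx.
  have H := integral_jump_ge0 bm f0 fmout.
  split; last exact: (congr1 fine H).
  have iI := bounded_measurable_P_integrable
    (bounded_measurable_time_int (bounded_measurableM bm blam) (@ler01 R)).
  apply/integrableP; split; first by apply/measurable_EFinP/measurable_jump_integral; case: bm.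
  pose fm z : R := Num.max (f z) 0.
  have EJ : (fun w => abse ((EFin \o jump_integral fm) w)) = (fun w => (jump_integral fm w)%:E).
    by apply/funext => w /=; congr EFin; apply: ger0_norm; apply: sumr_ge0 => l _; exact: f0.
  apply: (eq_ind_r (fun z => (z < +oo)%E) _ (etrans (congr1 (integral P setT) EJ) H)).
  have I0 : (0 <= \int[P]_w (time_int X Y (fun z => (fm z * lam z)%R) 0%R 1%R w)%:E)%E.
    apply: integral_ge0 => w _; rewrite lee_fin; apply: (time_int_ge0 hmodel) => z.
    by apply: mulr_ge0 => //; [exact: f0|exact: (cube_intensity_ge0 hmodel)].
  rewrite -(ge0_fin_numE I0).
  exact: (integrable_fin_num measurableT iI).
have [iP eP] := part _ b pout.
have [iN eN] := part _ bN (fun z h => etrans (congr1 -%R (pout z h)) (oppr0 R)).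
have EJ : jump_integral phi = (fun w => jump_integral (fun z => Num.max (phi z) 0) w
    - jump_integral (fun z => Num.max (- phi z) 0) w).
  apply/funext => w; rewrite -jump_integralB; congr (jump_integral _ w).
  by apply/funext => z; rewrite maxr0B.
split; first by rewrite EJ; exact: (integrableB measurableT iP iN).
have i1 := bounded_measurable_P_integrable
  (bounded_measurable_time_int (bounded_measurableM (bmax _ b) blam) (@ler01 R)).
have i2 := bounded_measurable_P_integrable
  (bounded_measurable_time_int (bounded_measurableM (bmax _ bN) blam) (@ler01 R)).
apply: (etrans (congr1 (Rintegral P setT) EJ)).
apply: (etrans (RintegralB measurableT iP iN)).
apply: (etrans (congr2 (fun x y => x - y) eP eN)).
apply: (etrans (esym (RintegralB measurableT i1 i2))).
apply: eq_Rintegral => w _; rewrite -(time_intB hmodel); last 2 first.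
- by apply: bounded_measurableM => //; exact: bmax.
- by apply: bounded_measurableM => //; exact: bmax.
by apply: time_int_eq => u; rewrite -mulrBl maxr0B.
Qed.

Lemma risk_model phi : bounded_measurable phi -> (forall z, ~ time_cube z -> phi z = 0) ->
  risk P X N Y phi
  = \int[P]_w time_int X Y (fun z => phi z ^+ 2 - 2 * (phi z * lam z)) 0 1 w.
Proof.
move=> b pout; have [iJ eJ] := integral_jump b pout.
have b2 : bounded_measurable (fun z => phi z ^+ 2) by exact: bounded_measurableM.
have bl : bounded_measurable (fun z => phi z * lam z) by exact: bounded_measurableM.
have i2 := bounded_measurable_P_integrable (bounded_measurable_time_int b2 (@ler01 R)).
have il := bounded_measurable_P_integrable (bounded_measurable_time_int bl (@ler01 R)).
have iZ (f : T -> R) : P.-integrable setT (EFin \o f) -> P.-integrable setT (EFin \o (fun w => 2 * f w)).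
  by move=> i; exact: (integrableZl measurableT 2 i).
have EL : (fun w => loss phi (X w) (Y ^~ w) (N w))
    = (fun w => time_int X Y (fun z => phi z ^+ 2) 0 1 w - 2 * jump_integral phi w).
  by apply/funext => w; exact: loss_model.
rewrite /risk EL unlock.
apply: (etrans (RintegralB measurableT i2 (iZ _ iJ))).
rewrite (RintegralZl _ measurableT iJ) eJ -(RintegralZl _ measurableT il).
rewrite -(RintegralB measurableT i2 (iZ _ il)).
apply: eq_Rintegral => w _; rewrite (time_intB hmodel)//; last exact: bounded_measurableZ.
by rewrite (time_intZ hmodel).
Qed.

End loss.

(** * Bernstein bound for one observation *)

Section deviation_mgf.
Context {R : realType} {k : nat} {dT : measure_display} {T : measurableType dT}
  {P : probability T R} {F : R -> set (set T)}
  {alpha0 : R * borel R k -> R} {X : {RV P >-> borel R k}}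
  {N : T -> cumulative R R} {Y : R -> T -> R}
  (hmodel : counting_model F alpha0 X N Y)
  {a0 : R} (alpha0_le : forall z, time_cube z -> alpha0 z <= a0).
Local Notation lam := (@cube_intensity R k alpha0).

Local Notation Jint := (@jump_integral R k dT T P X N).
Local Notation Lmart := (@log_martingale R k dT T P alpha0 X N Y).

Let blam := bounded_measurable_cube_intensity hmodel alpha0_le.

Lemma P_integral_EFin (f : T -> R) : bounded_measurable f ->
  (\int[P]_w (f w)%:E)%E = (\int[P]_w f w)%:E.
Proof.
move=> bf; rewrite /Rintegral fineK//.
exact: (integrable_fin_num measurableT (bounded_measurable_P_integrable bf)).
Qed.

Lemma P_integral_cst (c : R) : \int[P]_w c = c.
Proof. by rewrite Rintegral_cst//= probability_setT mulr1. Qed.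

Let a0_ge0 : 0 <= a0.
Proof. exact: le_trans (cube_intensity_ge0 hmodel point) (cube_intensity_le hmodel alpha0_le point). Qed.

Let lam0 z : 0 <= lam z. Proof. exact: (cube_intensity_ge0 hmodel). Qed.
Let lama0 z : lam z <= a0. Proof. exact: (cube_intensity_le hmodel). Qed.

Context (b : R) (b0 : 0 < b) (al be : R * borel R k -> R)
  (mal : bounded_measurable al) (mbe : bounded_measurable be)
  (alb : forall z, `|al z| <= b) (beb : forall z, `|be z| <= b)
  (alout : forall z, ~ time_cube z -> al z = 0)
  (beout : forall z, ~ time_cube z -> be z = 0).

(** The loss of [al] is the subtracted one, so that the empirical mean of the centred variable is P
    - P_n applied to the loss of [al] minus that of [be]. *)
Definition excess_loss w := loss be (X w) (Y ^~ w) (N w) - loss al (X w) (Y ^~ w) (N w).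

Let h z := al z - be z.
Let bh : bounded_measurable h. Proof. exact: bounded_measurableB. Qed.
Let hout z : ~ time_cube z -> h z = 0.
Proof. by move=> hz; rewrite /h alout// beout// subrr. Qed.

(* A and B are the weights of Young's inequality, which separates the compensated
   jumps from the part of the excess loss that is absolutely continuous in time. *)
Definition deviation_const_A : R := Num.sqrt a0 + 4^-1.
Definition deviation_const_B : R := 6 / 5 * (b + a0) + 3^-1.
Definition deviation_const : R := deviation_const_A + deviation_const_B.

Local Notation A_ := deviation_const_A.
Local Notation B_ := deviation_const_B.
Local Notation S := deviation_const.

Let A_gt0 : 0 < A_. Proof. by rewrite /deviation_const_A ltr_wpDl ?sqrtr_ge0// invr_gt0. Qed.
Let B_gt0 : 0 < B_. Proof. by rewrite /deviation_const_B ltr_wpDl ?invr_gt0// mulr_ge0// addr_ge0// ltW. Qed.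
Let S_gt0 : 0 < S. Proof. exact: addr_gt0. Qed.

(* k <= 5/4 is where the constants 1/4 and 1/3 of the scale are used. *)
Let k_le : A_ / B_ <= 5 / 4.
Proof.
rewrite ler_pdivrMr// /deviation_const_A /deviation_const_B.
have := sqr_sqrtr a0_ge0; have := sqr_ge0 (3 * Num.sqrt a0 - 1).
by move: (Num.sqrt a0) => s; move: b0 => b0'; nra.
Qed.

Context (D v l : R) (D0 : 0 < D) (hD : forall z, `|h z| <= D) (l0 : 0 <= l)
  (hv : \int[P]_w time_int X Y (fun z => h z ^+ 2) 0 1 w <= v)
  (lD : 4 / 3 * S * l * D < 1).

Let z_ := 2 * S * l * D.
Let z_ge0 : 0 <= z_.
Proof. by rewrite /z_ !mulr_ge0// ltW. Qed.
Let z_lt : z_ < 3 / 2.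
Proof. by move: lD; rewrite /z_; lra. Qed.

(** Scaled so that, with the Young weight A/S, the jumps of the log-martingale of [g] reproduce
    those of [l] times the excess loss exactly. *)
Let g z := (2 * l * S / A_) * h z.
Let bg : bounded_measurable g. Proof. exact: bounded_measurableZ. Qed.
Let gout z : ~ time_cube z -> g z = 0.
Proof. by move=> hz; rewrite /g hout// mulr0. Qed.

Let bpsi : bounded_measurable (fun z => psi2 (g z) * lam z).
Proof.
apply: bounded_measurableM => //; apply: bounded_measurableB => //.
apply: bounded_measurableB; last exact: bounded_measurable_cst.
exact: bounded_measurable_exp.
Qed.
Let bhl : bounded_measurable (fun z => h z * lam z). Proof. exact: bounded_measurableM. Qed.
Let bhs : bounded_measurable (fun z => h z * (al z + be z)).
Proof. by apply: bounded_measurableM => //; exact: bounded_measurableD. Qed.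
Let bh2 : bounded_measurable (fun z => h z ^+ 2). Proof. exact: bounded_measurableM. Qed.

Let T1 := time_int X Y (fun z => psi2 (g z) * lam z) 0 1.
Let T2 := time_int X Y (fun z => h z * lam z) 0 1.
Let T3 := time_int X Y (fun z => h z * (al z + be z)) 0 1.
(** The excess loss with its jumps replaced by their compensator; it has the same mean. *)
Let W0 w := 2 * T2 w - T3 w.
Let H w := time_int X Y (fun z => h z ^+ 2) 0 1 w / D ^+ 2.
Let I w := time_int X Y (fun z => `|h z|) 0 1 w / D.

Let bT1 : bounded_measurable T1. Proof. exact: (bounded_measurable_time_int hmodel). Qed.
Let bT2 : bounded_measurable T2. Proof. exact: (bounded_measurable_time_int hmodel). Qed.
Let bT3 : bounded_measurable T3. Proof. exact: (bounded_measurable_time_int hmodel). Qed.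
Let bW0 : bounded_measurable W0.
Proof. by apply: bounded_measurableB => //; exact: bounded_measurableZ. Qed.
Let bH : bounded_measurable H.
Proof.
apply: bounded_measurableM; last exact: bounded_measurable_cst.
exact: (bounded_measurable_time_int hmodel).
Qed.

Let excess_lossE w : excess_loss w = 2 * Jint h w - T3 w.
Proof.
rewrite /excess_loss !(loss_model hmodel)// /h jump_integralB.
have b2 : bounded_measurable (fun z => be z ^+ 2) by exact: bounded_measurableM.
have a2 : bounded_measurable (fun z => al z ^+ 2) by exact: bounded_measurableM.
have -> : T3 w = time_int X Y (fun z => al z ^+ 2) 0 1 w - time_int X Y (fun z => be z ^+ 2) 0 1 w.
  by rewrite -(time_intB hmodel)//; apply: time_int_eq => u; rewrite /h; ring.
by ring.
Qed.

Let mean_W0 : \int[P]_w W0 w = risk P X N Y be - risk P X N Y al.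
Proof.
have bf (a : R * borel R k -> R) : bounded_measurable a ->
    bounded_measurable (fun z => a z ^+ 2 - 2 * (a z * lam z)).
  move=> ba; apply: bounded_measurableB; first exact: bounded_measurableM.
  by apply: bounded_measurableZ; exact: bounded_measurableM.
have ib := bounded_measurable_P_integrable (bounded_measurable_time_int hmodel (bf _ mbe) (@ler01 R)).
have ia := bounded_measurable_P_integrable (bounded_measurable_time_int hmodel (bf _ mal) (@ler01 R)).
rewrite !(risk_model hmodel alpha0_le)//.
apply: (etrans _ (RintegralB measurableT (ib P) (ia P))).
apply: eq_Rintegral => w _; rewrite -(time_intB hmodel); [|exact: bf|exact: bf].
rewrite /W0 -(time_intZ hmodel)// -(time_intB hmodel)//; last exact: bounded_measurableZ.
by apply: time_int_eq => u; rewrite /h; ring.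
Qed.

(** The compensator of the log-martingale involves exp g - 1 = psi2 g + g: the linear part turns the
    excess loss into [W0], the remainder becomes [T1]. *)
Let exponent_split w y m : l * (excess_loss w - m) - y
  = A_ / S * Lmart g 1 w
  + B_ / S * (S / B_ * l * W0 w + A_ / B_ * T1 w - (S / B_ * l * m + S / B_ * y)).
Proof.
have LE := log_martingaleE (P := P) (alpha0 := alpha0) (X := X) (N := N) (Y := Y) g w.
have JE : Jint g w = 2 * l * S / A_ * Jint h w by exact: jump_integralZ.
have TE : time_int X Y (fun z => (expR (g z) - 1) * lam z) 0 1 w = T1 w + 2 * l * S / A_ * T2 w.
  rewrite /T2 -(time_intZ hmodel)// -(time_intD hmodel)//; last exact: bounded_measurableZ.
  by apply: time_int_eq => u; rewrite /psi2 /g; ring.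
rewrite LE JE TE excess_lossE /W0; move: (Jint h w) (T1 w) (T2 w) (T3 w) => j t1 t2 t3.
field; repeat (apply/andP; split).
- by rewrite lt0r_neq0.
- by rewrite lt0r_neq0.
- by rewrite lt0r_neq0.
Qed.

Let bI : bounded_measurable I.
Proof.
apply: bounded_measurableM; last exact: bounded_measurable_cst.
by apply: (bounded_measurable_time_int hmodel) => //; exact: bounded_measurable_norm.
Qed.

Let Dinv c : c / D = D^-1 * c. Proof. exact: mulrC. Qed.

Let IE w : I w = time_int X Y (fun z => D^-1 * `|h z|) 0 1 w.
Proof. exact: (etrans (mulrC _ _) (esym (time_intZ hmodel D^-1 0 1 w (bounded_measurable_norm bh)))). Qed.

Let HE w : H w = time_int X Y (fun z => (D^-1 * `|h z|) ^+ 2) 0 1 w.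
Proof.
rewrite /H mulrC -(time_intZ hmodel)//; apply: time_int_eq => u.
by rewrite exprMn exprVn real_normK// num_real.
Qed.

Let bu : bounded_measurable (fun z => D^-1 * `|h z|).
Proof. by apply: bounded_measurableZ; exact: bounded_measurable_norm. Qed.

Let u01 z : 0 <= D^-1 * `|h z| <= 1.
Proof.
rewrite mulr_ge0 ?invr_ge0 ?(ltW D0)//= mulrC ler_pdivrMr// mul1r.
exact: hD.
Qed.

Let I01 w : 0 <= I w <= 1.
Proof.
rewrite IE (time_int_ge0 hmodel) => [|z]; last by case/andP: (u01 z).
apply: (le_trans (ler_norm _)).
have := @time_int_norm _ _ _ _ _ _ _ _ _ _ hmodel _ 1 0 1 w bu (@ler01 R).
rewrite subr0 mulr1; apply => z.
by have /andP[u0 u1] := u01 z; rewrite ger0_norm.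
Qed.

(** The lower bound is Cauchy-Schwarz, obtained from a nonnegative variance; the risk process has
    mass at most 1 on ]0, 1]. *)
Let IH w : I w ^+ 2 <= H w <= 1.
Proof.
have bu2 : bounded_measurable (fun z => (D^-1 * `|h z|) ^+ 2) by exact: bounded_measurableM.
have b1 : bounded_measurable (fun _ : R * borel R k => 1 : R) by exact: bounded_measurable_cst.
apply/andP; split; last first.
  rewrite HE; apply: (le_trans (ler_norm _)).
  have := @time_int_norm _ _ _ _ _ _ _ _ _ _ hmodel _ 1 0 1 w bu2 (@ler01 R).
  rewrite subr0 mulr1; apply => z; have /andP[u0 u1] := u01 z.
  by rewrite ger0_norm ?exprn_ge0// exprn_ile1.
have t1 : time_int X Y (fun=> 1) 0 1 w <= 1.
  apply: (le_trans (ler_norm _)).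
  have := @time_int_norm _ _ _ _ _ _ _ _ _ _ hmodel _ 1 0 1 w b1 (@ler01 R).
  by rewrite subr0 mulr1; apply => z; rewrite normr1.
set c := I w.
have : 0 <= time_int X Y (fun z => (D^-1 * `|h z| - c) ^+ 2) 0 1 w.
  by apply: (time_int_ge0 hmodel) => z; exact: sqr_ge0.
have -> : time_int X Y (fun z => (D^-1 * `|h z| - c) ^+ 2) 0 1 w
    = H w - 2 * c * I w + c ^+ 2 * time_int X Y (fun=> 1) 0 1 w.
  rewrite HE IE -(time_intZ hmodel)// -(time_intZ hmodel)// -(time_intB hmodel)//; last exact: bounded_measurableZ.
  rewrite -(time_intD hmodel)//; last 2 first.
  - by apply: bounded_measurableB => //; exact: bounded_measurableZ.
  - exact: bounded_measurableZ.
  by apply: time_int_eq => u; ring.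
have : c ^+ 2 * time_int X Y (fun=> 1) 0 1 w <= c ^+ 2 by rewrite ler_piMr ?sqr_ge0.
by rewrite -/c expr2; lra.
Qed.

(** [z'] and [x'] are the scales of the [W0] and [T1] terms relative to [I] and [H]. The factor 6/5
    in [B_] gives [z' <= 5 / 6 * z_]; [x'] is reduced by [psi2_le_half_sq] with s = sqrt a0. *)
Let z' := S / B_ * l * (2 * (b + a0) * D).
Let x' := A_ / B_ * (a0 * psi2 (z_ / A_)).

Let K_ge0 : 0 <= b + a0. Proof. by rewrite addr_ge0// ltW. Qed.

Let z'_bounds : 0 <= z' <= 5 / 6 * z_.
Proof.
have qq : 0 <= S / B_ * l by rewrite mulr_ge0// divr_ge0// ltW.
apply/andP; split; first by rewrite mulr_ge0// !mulr_ge0// ltW.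
have -> : z' = (b + a0) / B_ * z_ by rewrite /z' /z_; field; rewrite lt0r_neq0.
rewrite ler_wpM2r// ler_pdivrMr// /deviation_const_B; have := K_ge0; lra.
Qed.

Let x'_bounds : 0 <= x' <= A_ / B_ * (z_ ^+ 2 / 2).
Proof.
have kk : 0 <= A_ / B_ by rewrite divr_ge0// ltW.
rewrite mulr_ge0//=; last by rewrite mulr_ge0// psi2_ge0.
rewrite ler_wpM2l// -[X in X * _](sqr_sqrtr a0_ge0).
by apply: psi2_le_half_sq; rewrite ?sqrtr_ge0// z_ge0.
Qed.

Let W0_le w : `|S / B_ * l * W0 w| <= z' * I w.
Proof.
have qq : 0 <= S / B_ * l by rewrite mulr_ge0// divr_ge0// ltW.
rewrite normrM (ger0_norm qq) /z' -[leRHS]mulrA ler_wpM2l//.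
have W0E : W0 w = time_int X Y (fun z => h z * (2 * lam z - al z - be z)) 0 1 w.
  rewrite /W0 -(time_intZ hmodel)// -(time_intB hmodel)//; last exact: bounded_measurableZ.
  by apply: time_int_eq => u; ring.
have bW : bounded_measurable (fun z => h z * (2 * lam z - al z - be z)).
  apply: bounded_measurableM => //; apply: bounded_measurableB => //.
  by apply: bounded_measurableB => //; exact: bounded_measurableZ.
rewrite W0E IE -(time_intZ hmodel)//.
have bz : bounded_measurable (fun z => 2 * (b + a0) * D * (D^-1 * `|h z|)).
  exact: bounded_measurableZ.
have pw z : `|h z * (2 * lam z - al z - be z)| <= 2 * (b + a0) * D * (D^-1 * `|h z|).
  rewrite -mulrA mulVKf ?lt0r_neq0// normrM mulrC ler_wpM2r//.
  have := alb z; have := beb z; have := lam0 z; have := lama0 z.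
  rewrite !ler_norml => ? ? /andP[? ?] /andP[? ?]; apply/andP; split; lra.
rewrite ler_norml; apply/andP; split.
  rewrite -mulN1r -(time_intZ hmodel)//; apply: (time_int_le hmodel) => //.
    exact: bounded_measurableZ.
  by move=> z; have := pw z; rewrite ler_norml mulN1r => /andP[].
apply: (time_int_le hmodel) => // z; exact: le_trans (ler_norm _) (pw z).
Qed.

Let T1_le w : 0 <= A_ / B_ * T1 w <= x' * H w.
Proof.
have kk : 0 <= A_ / B_ by rewrite divr_ge0// ltW.
rewrite mulr_ge0//=; last first.
  by apply: (time_int_ge0 hmodel) => z; rewrite mulr_ge0// psi2_ge0.
rewrite /x' -[leRHS]mulrA ler_wpM2l// HE -(time_intZ hmodel); last exact: bounded_measurableM.
apply: (time_int_le hmodel) => //.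
  by apply: bounded_measurableZ; exact: bounded_measurableM.
move=> z; rewrite -mulrA mulrC; apply: ler_pM => //; first exact: psi2_ge0.
rewrite mulrC; apply: psi2_le_scaled => //; first by rewrite divr_ge0// ltW.
have c0 : 0 <= 2 * l * S / A_ by apply: divr_ge0; [apply: mulr_ge0; [exact: mulr_ge0|exact: ltW]|exact: ltW].
rewrite /g normrM (ger0_norm c0).
rewrite le_eqVlt; apply/orP; left; apply/eqP; rewrite /z_; field.
by rewrite !lt0r_neq0.
Qed.

Let G_ := psi2 (z' + x') + x'.
Let y_ := 2 * S ^+ 2 * l ^+ 2 * v / (1 - 4 / 3 * S * l * D).

Let G_le : G_ * (v / D ^+ 2) <= S / B_ * y_.
Proof.
have Hm := mgf_scalar (k := A_ / B_) (z := z_) (z' := z') (X' := x').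
have kk : 0 <= A_ / B_ <= 5 / 4 by rewrite k_le divr_ge0// ltW.
have {Hm} := Hm kk ltac:(by rewrite z_ge0 z_lt) z'_bounds x'_bounds.
have v0 : 0 <= v / D ^+ 2.
  rewrite divr_ge0 ?sqr_ge0//; apply: le_trans hv; apply: Rintegral_ge0 => w _.
  by apply: (time_int_ge0 hmodel) => z; exact: sqr_ge0.
move=> /(ler_wpM2r v0) /le_trans; apply.
rewrite le_eqVlt; apply/orP; left; apply/eqP; rewrite /y_ /z_ /deviation_const.
have d1 : 1 - 4 / 3 * (A_ + B_) * l * D != 0.
  by apply/negP => /eqP; move: lD; rewrite /deviation_const; lra.
have d2 : 1 - 2 / 3 * (2 * (A_ + B_) * l * D) != 0.
  by apply/negP => /eqP; move: lD; rewrite /deviation_const; lra.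
field.
repeat (apply/andP; split); rewrite ?lt0r_neq0//.
move: lD; rewrite /deviation_const; lra.
Qed.

(** [expR_split] is integrated without centring: [W0] has mean [m], [H] has mean at most v/D^2, and
    the mean is removed at the end through 1 + c <= exp c. *)
Let second_le m : m = \int[P]_w W0 w ->
  \int[P]_w expR (S / B_ * l * W0 w + A_ / B_ * T1 w - (S / B_ * l * m + S / B_ * y_)) <= 1.
Proof.
move=> mE; set c := S / B_ * l * m + S / B_ * y_.
pose E w := expR (S / B_ * l * W0 w + A_ / B_ * T1 w).
pose E' w := 1 + S / B_ * l * W0 w + G_ * H w.
have bE : bounded_measurable E.
  by apply: bounded_measurable_exp; apply: bounded_measurableD; exact: bounded_measurableZ.
have bwl : bounded_measurable (fun w => S / B_ * l * W0 w) by exact: bounded_measurableZ.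
have b1 : bounded_measurable (fun _ : T => 1 : R) by exact: bounded_measurable_cst.
have bG : bounded_measurable (fun w => G_ * H w) by exact: bounded_measurableZ.
have b1w : bounded_measurable (fun w => 1 + S / B_ * l * W0 w) by exact: bounded_measurableD.
have bE' : bounded_measurable E' by exact: bounded_measurableD.
have int (f : T -> R) : bounded_measurable f -> P.-integrable setT (EFin \o f).
  exact: bounded_measurable_P_integrable.
have EE' w : E w <= E' w.
  rewrite /E' [G_ * _]mulrC.
  apply: (expR_split (z := z') (x := x') (I := I w)) => //.
  - by case/andP: z'_bounds.
  - by case/andP: x'_bounds.
have iE : \int[P]_w E w <= \int[P]_w E' w.
  by apply: le_Rintegral => //; exact: int.
have iE'E : \int[P]_w E' w = 1 + S / B_ * l * m + G_ * \int[P]_w H w.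
  apply: (etrans (RintegralD measurableT (int _ b1w) (int _ bG))).
  rewrite (RintegralZl _ measurableT (int _ bH)); congr (_ + _).
  apply: (etrans (RintegralD measurableT (int _ b1) (int _ bwl))).
  by rewrite P_integral_cst (RintegralZl _ measurableT (int _ bW0)) mE.
have iH : \int[P]_w H w <= v / D ^+ 2.
  have bh2' : bounded_measurable (time_int X Y (fun z => h z ^+ 2) 0 1).
    exact: (bounded_measurable_time_int hmodel).
  have -> : \int[P]_w H w = D ^- 2 * \int[P]_w time_int X Y (fun z => h z ^+ 2) 0 1 w.
    rewrite -(RintegralZl _ measurableT (int _ bh2')).
    by apply: eq_Rintegral => w _; rewrite /H mulrC.
  by rewrite mulrC ler_wpM2r ?invr_ge0 ?sqr_ge0.
have G0 : 0 <= G_.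
  rewrite addr_ge0 ?psi2_ge0//; by case/andP: x'_bounds.
have : \int[P]_w E w <= expR c.
  apply: (le_trans iE); rewrite iE'E; apply: (le_trans _ (expR_ge1Dx c)).
  rewrite /c addrA lerD2l; apply: le_trans G_le; exact: ler_wpM2l.
move=> H1; have -> : \int[P]_w expR (S / B_ * l * W0 w + A_ / B_ * T1 w - c)
    = expR (- c) * \int[P]_w E w.
  rewrite -(RintegralZl _ measurableT (int _ bE)).
  by apply: eq_Rintegral => w _; rewrite /E -expRD addrC.
by rewrite -(expR0 R) -(addNr c) expRD ler_wpM2l// expR_ge0.
Qed.

Lemma excess_loss_mgf :
  (\int[P]_w (expR (l * (excess_loss w - (risk P X N Y be - risk P X N Y al))))%:E
   <= (expR (2 * S ^+ 2 * l ^+ 2 * v / (1 - 4 / 3 * S * l * D)))%:E)%E.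
Proof.
set m := risk P X N Y be - risk P X N Y al; rewrite -/y_.
pose U w := S / B_ * l * W0 w + A_ / B_ * T1 w - (S / B_ * l * m + S / B_ * y_).
pose p := A_ / S; pose q := B_ / S.
have p0 : 0 <= p by rewrite divr_ge0// ltW.
have q0 : 0 <= q by rewrite divr_ge0// ltW.
have pq : p + q = 1 by rewrite /p /q -mulrDl divff// lt0r_neq0.
have bU : bounded_measurable U.
  apply: bounded_measurableB; last exact: bounded_measurable_cst.
  by apply: bounded_measurableD; exact: bounded_measurableZ.
have beU : bounded_measurable (fun w => expR (U w)) by exact: bounded_measurable_exp.
have mL : measurable_fun setT (fun w => expR (Lmart g 1 w)).
  apply: measurableT_comp => //; apply: measurable_funB.
    exact: (measurable_jump_integral hmodel (proj1 bg)).
  apply: (measurable_time_int hmodel); apply: bounded_measurableM => //.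
  apply: bounded_measurableB; last exact: bounded_measurable_cst.
  exact: bounded_measurable_exp.
have mx : measurable_fun setT (fun w => expR (l * (excess_loss w - m))).
  rewrite (_ : (fun _ => _) = (fun w => expR (p * Lmart g 1 w + q * U w + y_))); last first.
    by apply/funext => w; congr expR; rewrite -exponent_split subrK.
  apply: measurableT_comp => //; apply: measurable_funD => //; apply: measurable_funD.
    apply: measurable_funM => //; apply: measurable_funB.
      exact: (measurable_jump_integral hmodel (proj1 bg)).
    apply: (measurable_time_int hmodel); apply: bounded_measurableM => //.
    apply: bounded_measurableB; last exact: bounded_measurable_cst.
    exact: bounded_measurable_exp.
  by apply: measurable_funM => //; case: bU.
have e0 c : 0 <= expR c :> R by exact: expR_ge0.
have y0 : 0 <= expR y_ by [].
have pt w : expR (l * (excess_loss w - m))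
    <= expR y_ * p * expR (Lmart g 1 w) + expR y_ * q * expR (U w).
  have -> : l * (excess_loss w - m) = y_ + (l * (excess_loss w - m) - y_) by ring.
  have Y1 := expR_young (Lmart g 1 w) (U w) p0 q0 pq.
  rewrite expRD -(mulrA _ p) -(mulrA _ q) -mulrDr ler_wpM2l//.
  by rewrite exponent_split.
have c1 : 0 <= expR y_ * p by exact: mulr_ge0.
have c2 : 0 <= expR y_ * q by exact: mulr_ge0.
have m1 : measurable_fun setT (fun w => expR y_ * p * expR (Lmart g 1 w)).
  by apply: measurable_funM.
have m2 : measurable_fun setT (fun w => expR y_ * q * expR (U w)).
  by apply: measurable_funM => //; case: beU.
have n1 w : 0 <= expR y_ * p * expR (Lmart g 1 w) by exact: mulr_ge0.
have n2 w : 0 <= expR y_ * q * expR (U w) by exact: mulr_ge0.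
apply: (@le_trans _ _ (\int[P]_w (expR y_ * p * expR (Lmart g 1 w) + expR y_ * q * expR (U w))%:E)%E).
  apply: ge0_le_integral; first exact: measurableT.
  - by move=> w _; rewrite lee_fin.
  - exact/measurable_EFinP.
  - by apply/measurable_EFinP; exact: measurable_funD m1 m2.
  - by move=> w _; rewrite lee_fin.
apply: (eq_ind_r (fun t => (t <= _)%E) _ (ge0_integral_EFinD P m1 m2 n1 n2)).
have Z (c : R) (f : T -> R) : 0 <= c -> measurable_fun setT f -> (forall w, 0 <= f w) ->
    (\int[P]_w (f w)%:E <= 1 -> \int[P]_w (c * f w)%:E <= c%:E)%E.
  move=> c0 mf f0 f1; under eq_integral do rewrite EFinM.
  rewrite ge0_integralZl//.
  - by rewrite -[leRHS]mule1; apply: lee_wpmul2l.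
  - exact/measurable_EFinP.
  - by move=> w _; rewrite lee_fin.
have Z1 := Z _ _ c1 mL (fun w => e0 _) (exponential_supermartingale hmodel alpha0_le bg gout).
have U1 : (\int[P]_w (expR (U w))%:E <= 1)%E.
  apply: (eq_ind_r (fun t => (t <= _)%E) _ (P_integral_EFin beU)).
  by rewrite lee_fin; apply: second_le; rewrite mean_W0.
have Z2 := Z _ _ c2 (proj1 beU) (fun w => e0 _) U1.
apply: (le_trans (leeD Z1 Z2)).
by rewrite -EFinD lee_fin -mulrDr pq mulr1.
Qed.

End deviation_mgf.

(** * Independent copies *)

Section independent_products.
Context {R : realType} d d' (T : measurableType d) (S : measurableType d')
  (P : probability T R) (Q : probability S R) (n : nat)
  (Z : 'I_n -> S -> R) (zeta : T -> R)
  (mZ : forall i, measurable_fun setT (Z i)) (mzeta : measurable_fun setT zeta)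
  (indep : forall U : 'I_n -> set R, (forall i, measurable (U i)) ->
     Q [set s | forall i, U i (Z i s)] = (\prod_(i < n) P (zeta @^-1` U i))%E).

(* The indicators in the product rule are replaced by f one at a time: as a
   function of the set in the j-th indicator, both sides are measures. *)
Lemma integral_prod_iid (f : R -> R) (c : R) : measurable_fun setT f ->
  (forall x, 0 <= f x) -> (\int[P]_w (f (zeta w))%:E = c%:E)%E ->
  (\int[Q]_s (\prod_(i < n) f (Z i s))%:E = (c ^+ n)%:E)%E.
Proof.
move=> mf f0 fc.
pose F (j : nat) (U : 'I_n -> set R) (i : 'I_n) (x : R) : R :=
  if (i < j)%N then f x else \1_(U i) x.
pose G (j : nat) (U : 'I_n -> set R) (i : 'I_n) : R :=
  if (i < j)%N then c else fine (P (zeta @^-1` U i)).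
have mF j U i : (forall i, measurable (U i)) -> measurable_fun setT (F j U i).
  by move=> mU; rewrite /F; case: (i < j)%N => //; exact: measurable_indic.
have F0 j U i x : 0 <= F j U i x by rewrite /F; case: ifP => // _; rewrite indicE.
have c0 : 0 <= c by rewrite -lee_fin -fc; apply: integral_ge0 => w _; rewrite lee_fin.
have G0 j U i : 0 <= G j U i by rewrite /G; case: ifP => _ //; exact: fine_ge0.
have mzU U : measurable U -> measurable (zeta @^-1` U).
  by move=> mU; rewrite -[X in measurable X]setTI; exact: mzeta.
have Pfin U : measurable U -> P (zeta @^-1` U) = (fine (P (zeta @^-1` U)))%:E.
  by move=> mU; rewrite fineK// fin_num_measure//; exact: mzU.
have mprod (I : seq 'I_n) (p : pred 'I_n) j U : (forall i, measurable (U i)) ->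
    measurable_fun setT (fun s => \prod_(i <- I | p i) F j U i (Z i s)).
  move=> mU; under eq_fun do rewrite big_mkcond/=.
  apply: measurable_prod => i _; case: (p i) => //.
  exact: (measurableT_comp (mF j U i mU) (mZ i)).
suff H : forall j, (j <= n)%N -> forall U, (forall i, measurable (U i)) ->
    (\int[Q]_s (\prod_(i < n) F j U i (Z i s))%:E = (\prod_(i < n) G j U i)%:E)%E.
  have := H n (leqnn n) (fun=> setT) (fun=> measurableT).
  have -> : \prod_(i < n) G n (fun=> setT) i = c ^+ n.
    by rewrite (eq_bigr (fun=> c)) ?prodr_const ?card_ord// => i _; rewrite /G ltn_ord.
  move=> <-; apply: eq_integral => s _; congr EFin.
  by apply: eq_bigr => i _; rewrite /F ltn_ord.
elim=> [_ U mU|j IH jn U mU].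
  have -> : (\prod_(i < n) G 0 U i)%:E = Q [set s | forall i, U i (Z i s)].
    rewrite indep// -prodEFin; apply: eq_bigr => i _.
    by rewrite /G ltn0 -Pfin.
  rewrite -[X in Q X]setIT -integral_indic//; last first.
    rewrite (_ : mkset _ = \bigcap_(i in [set: 'I_n]) (Z i @^-1` U i)); last first.
      by apply/seteqP; split => s h i; [move=> _|]; exact: h.
    apply: fin_bigcap_measurable => // i _.
    by rewrite -[X in measurable X]setTI; exact: mZ.
  apply: eq_integral => s _; congr EFin; rewrite indicE.
  case: (boolP (s \in _)) => [/set_mem h|/negP h].
    by rewrite big1// => i _; rewrite /F ltn0 indicE mem_set//; exact: h.
  have [i Ui] : exists i, ~ U i (Z i s).
    by apply/existsNP => h'; apply: h; exact/mem_set.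
  by rewrite (bigD1 i)//= /F ltn0 indicE memNset// mul0r.
pose j0 := Ordinal jn.
pose W s := \prod_(i < n | i != j0) F j.+1 U i (Z i s).
pose C := \prod_(i < n | i != j0) G j.+1 U i.
have mW : measurable_fun setT W by exact: mprod.
have W0 s : 0 <= W s by apply: prodr_ge0 => i _.
have C0 : 0 <= C by apply: prodr_ge0 => i _.
have FE V i x : i != j0 -> F j (fun i => if i == j0 then V else U i) i x = F j.+1 U i x.
  move=> ij; have ij' : (i == j :> nat) = false by exact: (negbTE ij).
  by rewrite /F (negbTE ij) ltnS [in RHS]leq_eqVlt ij'.
have GE V i : i != j0 -> G j (fun i => if i == j0 then V else U i) i = G j.+1 U i.
  move=> ij; have ij' : (i == j :> nat) = false by exact: (negbTE ij).
  by rewrite /G (negbTE ij) ltnS [in RHS]leq_eqVlt ij'.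
have [nu1 nu1E nu1I] := weighted_image Q mW W0 (mZ j0).
have [nu2 nu2E nu2I] := weighted_image P (@measurable_cst _ _ T R setT C) (fun=> C0) mzeta.
have nu12 V : measurable V -> nu1 V = nu2 V.
  move=> mV; have mV' i : measurable ((fun i => if i == j0 then V else U i) i) by case: ifP.
  have := IH (ltnW jn) _ mV'.
  rewrite (bigD1 j0)//= [X in (_ * X)%:E](eq_bigr (G j.+1 U)); last by move=> i; exact: GE.
  rewrite /G ltnn eqxx -/C => H.
  have IC : (\int[P]_(w in zeta @^-1` V) C%:E = C%:E * P (zeta @^-1` V))%E.
    by apply: integral_cst; exact: mzU.
  rewrite nu1E// nu2E// IC Pfin// -EFinM mulrC -H integral_mkcond.
  apply: eq_integral => s _.
  rewrite (bigD1 j0)//= (eq_bigr (fun i => F j.+1 U i (Z i s))); last by move=> i; exact: FE.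
  rewrite /F ltnn eqxx -/(W s) /patch indicE.
  case: (boolP (s \in _)) => [/set_mem h|/negP h].
    by rewrite mem_set// mul1r.
  by rewrite memNset ?mul0r// => h'; apply: h; exact/mem_set.
have mfE : measurable_fun setT (EFin \o f) by exact/measurable_EFinP.
have f0E x : (0 <= (EFin \o f) x)%E by rewrite lee_fin.
have E1 := nu1I _ mfE f0E; have E2 := nu2I _ mfE f0E.
have E12 : (\int[nu1]_x (EFin \o f) x = \int[nu2]_x (EFin \o f) x)%E.
  by apply: eq_measure_integral => V mV _; exact: nu12.
rewrite [in RHS](bigD1 j0)//= -/C {1}/G ltnSn EFinM -fc.
transitivity (\int[Q]_s ((EFin \o f) (Z j0 s) * (W s)%:E))%E.
  by apply: eq_integral => s _; rewrite (bigD1 j0)//= {1}/F ltnSn EFinM.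
rewrite -E1 E12 E2.
have mfz : measurable_fun setT (fun w => (f (zeta w))%:E).
  by apply/measurable_EFinP; exact: (measurableT_comp mf mzeta).
have fz0 w : setT w -> (0 <= (f (zeta w))%:E)%E by rewrite lee_fin.
have C0E : (0 <= C%:E)%E by rewrite lee_fin.
exact: (ge0_integralZr P measurableT mfz fz0 C0E).
Qed.

Lemma bernstein_iid (m v c u : R) : 0 < v -> 0 <= c -> 0 < u -> (0 < n)%N ->
  (forall l, 0 <= l -> c * l < 1 ->
     (\int[P]_w (expR (l * (zeta w - m)))%:E <= (expR (l ^+ 2 * v / (2 * (1 - c * l))))%:E)%E) ->
  (Q [set s | (Num.sqrt (2 * n%:R * v * u) + c * u < \sum_(i < n) (Z i s - m))%R]
   <= (expR (- u))%:E)%E.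
Proof.
move=> v0 c0 u0 n0 mgf.
have nR : 0 < n%:R :> R by rewrite ltr0n.
(* With [l = r / (1 + c * r)] one has 1 - c l = 1 / (1 + c r), and the Chernoff exponent n y - l t
   is exactly -u. *)
pose r := Num.sqrt (2 * u / (n%:R * v)).
have r0 : 0 <= r by exact: sqrtr_ge0.
have d0 : 0 < 1 + c * r by rewrite ltr_wpDr// mulr_ge0.
pose l := r / (1 + c * r).
have l0 : 0 <= l by rewrite divr_ge0// ltW.
have cl : 1 - c * l = (1 + c * r)^-1 by rewrite /l; field; rewrite lt0r_neq0.
have cl1 : c * l < 1 by rewrite -subr_gt0 cl invr_gt0.
set t := _ + c * u.
have r2 : r ^+ 2 = 2 * u / (n%:R * v).
  by rewrite sqr_sqrtr// divr_ge0// ?mulr_ge0// ltW.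
have rt : r * Num.sqrt (2 * n%:R * v * u) = 2 * u.
  rewrite /r -sqrtrM; last by rewrite divr_ge0// ?mulr_ge0// ltW.
  have -> : 2 * u / (n%:R * v) * (2 * n%:R * v * u) = (2 * u) ^+ 2.
    by field; rewrite !lt0r_neq0.
  by rewrite sqrtr_sqr ger0_norm// mulr_ge0// ltW.
pose y := l ^+ 2 * v / (2 * (1 - c * l)).
have yE : n%:R * y - l * t = - u.
  have -> : l * t = (2 * u + c * r * u) / (1 + c * r).
    by rewrite /l /t -rt; field; rewrite lt0r_neq0.
  rewrite /y cl /l.
  have -> : n%:R * ((r / (1 + c * r)) ^+ 2 * v / (2 / (1 + c * r)))
     = r ^+ 2 * (n%:R * v) / (2 * (1 + c * r)) by field; rewrite lt0r_neq0.
  by rewrite r2; field; rewrite !lt0r_neq0.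
pose f x := expR (l * (x - m)).
have mf : measurable_fun setT f.
  apply: measurableT_comp => //; apply: measurable_funM => //.
  exact: measurable_funB.
have f0 x : 0 <= f x by exact: expR_ge0.
have I0 : (0 <= \int[P]_w (f (zeta w))%:E)%E by apply: integral_ge0 => w _; rewrite lee_fin.
have Ile := mgf l l0 cl1.
have Ifin : (\int[P]_w (f (zeta w))%:E)%E \is a fin_num.
  by rewrite ge0_fin_numE// (le_lt_trans Ile)// ltry.
pose e := fine (\int[P]_w (f (zeta w))%:E)%E.
have eE : (\int[P]_w (f (zeta w))%:E = e%:E)%E by rewrite fineK.
have e0 : 0 <= e by exact: fine_ge0.
have ey : e <= expR y by rewrite -lee_fin -eE.
have prodE := integral_prod_iid mf f0 eE.
have sumE s : \prod_(i < n) f (Z i s) = expR (l * \sum_(i < n) (Z i s - m)).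
  by rewrite mulr_sumr expR_sum.
have mS : measurable_fun setT (fun s => \sum_(i < n) (Z i s - m)).
  by apply: measurable_sum => i; exact: measurable_funB.
set A := [set s | _].
have mA : measurable A.
  rewrite (_ : A = (fun s => \sum_(i < n) (Z i s - m)) @^-1` `]t, +oo[%classic).
    by rewrite -[X in measurable X]setTI; exact: mS.
  by apply/seteqP; split => s /=; rewrite in_itv/= andbT.
have mE : measurable_fun setT (fun s => expR (l * \sum_(i < n) (Z i s - m))).
  by apply: measurableT_comp => //; exact: measurable_funM.
rewrite -[X in Q X](@setIT _ A) -integral_indic//.
apply: (@le_trans _ _ (\int[Q]_s ((expR (- (l * t)))%:E * (expR (l * \sum_(i < n) (Z i s - m)))%:E))%E).
  apply: ge0_le_integral => //.
  - exact/measurable_EFinP/measurable_indic.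
  - by apply: emeasurable_funM => //; exact/measurable_EFinP.
  - move=> s _; rewrite -EFinM lee_fin -expRD indicE.
    case: (boolP (s \in A)) => [/set_mem As|_]; last exact: expR_ge0.
    rewrite -[leLHS](expR0 R) ler_expR addrC subr_ge0 ler_wpM2l//; exact: ltW.
have mEE : measurable_fun setT (fun s => (expR (l * \sum_(i < n) (Z i s - m)))%:E).
  exact/measurable_EFinP.
have E0 s : setT s -> (0 <= (expR (l * \sum_(i < n) (Z i s - m)))%:E)%E.
  by rewrite lee_fin expR_ge0.
have e0' : (0 <= (expR (- (l * t)))%:E)%E by rewrite lee_fin expR_ge0.
rewrite (ge0_integralZl Q measurableT mEE E0 e0').
under eq_integral do rewrite -sumE.
rewrite prodE -EFinM lee_fin -yE expRD mulrC ler_wpM2r ?expR_ge0//.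
by rewrite expRM_natl lerXn2r// nnegrE expR_ge0.
Qed.

End independent_products.

(** * Transfer of losses from the model to the sample *)

Section iid_transfer.
Context {R : realType} {V : Type} {d d'} {T : measurableType d} {S : measurableType d'}
  {P : probability T R} {Q : probability S R} {n : nat}
  {D : T -> V} {Ds : 'I_n -> S -> V} (hiid : iid_copies P Q D Ds).

(** The copies are controlled only through sets with a measurable preimage under [D]. The range of
    [D] is one of them and has full mass, so almost surely every copy is a value of [D]. *)
Definition observed : set S := [set s | forall i, range D (Ds i s)].

Let mrange i : measurable (Ds i @^-1` range D).
Proof.
apply: (proj1 hiid); rewrite (_ : _ @^-1` _ = setT) ?measurableT//.
by apply/seteqP; split => // w _; exists w.
Qed.

Lemma measurable_observed : measurable observed.
Proof.
rewrite (_ : observed = \bigcap_(i in [set: 'I_n]) (Ds i @^-1` range D)).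
  by apply: fin_bigcap_measurable => // i _; exact: mrange.
by apply/seteqP; split => s h i; [move=> _|]; exact: h.
Qed.

Lemma observed_null : Q (~` observed) = 0%E.
Proof.
rewrite probability_setC; last exact: measurable_observed.
have DT : D @^-1` range D = setT by apply/seteqP; split => // w _; exists w.
have /(proj2 hiid) QE (i : 'I_n) : measurable (D @^-1` range D) by rewrite DT.
rewrite (_ : Q observed = 1%E) ?subee//; apply: (etrans QE).
by rewrite big1// => i _; rewrite DT probability_setT.
Qed.

Context (zeta : T -> R) (zs : 'I_n -> S -> R) (mzeta : measurable_fun setT zeta)
  (zetaD : forall w w', D w = D w' -> zeta w = zeta w')
  (zsD : forall i s w, D w = Ds i s -> zs i s = zeta w).

(** Nothing is assumed on the measurability of [zs i]; put to 0 where the copy is not a value of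
    [D], it is determined by [zeta] and becomes measurable. *)
Definition observed_part i s : R := zs i s * \1_(Ds i @^-1` range D) s.

(** As [zeta] factors through [D], the preimage of this set under [D] is exactly the event that
    [zeta] lies in [U]; so independence passes from the copies to their losses. *)
Let image_set (U : set R) : set V := [set o | exists w, D w = o /\ U (zeta w)].

Let preimage_image U : D @^-1` image_set U = zeta @^-1` U.
Proof.
apply/seteqP; split => w /=; last by exists w.
by move=> [w' [/zetaD <-]].
Qed.

Let mzU U : measurable U -> measurable (D @^-1` image_set U).
Proof.
by move=> mU; rewrite preimage_image -[X in measurable X]setTI; exact: mzeta.
Qed.

Let observed_partE i s U : range D (Ds i s) ->
  U (observed_part i s) <-> image_set U (Ds i s).
Proof.
move=> [w _ wE]; rewrite /observed_part indicE mem_set; last by exists w.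
rewrite mulr1 (zsD wE); split=> [h|[w' [w'E h]]]; first by exists w.
by rewrite (@zetaD w w')// w'E.
Qed.

Lemma measurable_observed_part i : measurable_fun setT (observed_part i).
Proof.
move=> _ U mU; rewrite setTI.
rewrite (_ : _ @^-1` _ = (Ds i @^-1` image_set U) `|`
    (~` (Ds i @^-1` range D) `&` [set s | U 0])).
  apply: measurableU; first exact/(proj1 hiid)/mzU.
  apply: measurableI; first exact/measurableC/mrange.
  have [U0|U0] := pselect (U 0).
    by rewrite (_ : mkset _ = setT)//; apply/seteqP; split.
  by rewrite (_ : mkset _ = set0)//; apply/seteqP; split.
apply/seteqP; split => s /=.
  have [r|r] := pselect (range D (Ds i s)); first by move=> /(observed_partE _ r); left.
  by rewrite /observed_part indicE memNset// mulr0; right.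
move=> [h|[r h]].
  by apply/observed_partE => //; case: h => w [wE _]; exists w.
by rewrite /observed_part indicE memNset// mulr0.
Qed.

Lemma observed_part_indep (U : 'I_n -> set R) : (forall i, measurable (U i)) ->
  Q [set s | forall i, U i (observed_part i s)] = (\prod_(i < n) P (zeta @^-1` U i))%E.
Proof.
move=> mU.
have mA : measurable [set s | forall i, U i (observed_part i s)].
  rewrite (_ : mkset _ = \bigcap_(i in [set: 'I_n]) (observed_part i @^-1` U i)).
    apply: fin_bigcap_measurable => // i _.
    by rewrite -[X in measurable X]setTI; exact: measurable_observed_part.
  by apply/seteqP; split => s h i; [move=> _|]; exact: h.
have mO := measurable_observed.
set A := mkset _ in mA *.
have A0 : Q (A `\` observed) = 0%E.
  apply: (subset_measure0 _ _ _ observed_null) => //.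
  - exact: measurableD.
  - exact: measurableC.
have QA := measureDI Q mA mO; rewrite QA.
rewrite [X in (X + _)%E](A0) add0e.
have -> : A `&` observed = [set s | forall i, image_set (U i) (Ds i s)].
  apply/seteqP; split => s /=.
    by move=> [h o] i; apply/(observed_partE _ (o i)); exact: h.
  move=> h; have o : observed s by move=> i; have [w [wE _]] := h i; exists w.
  by split=> // i; apply/(observed_partE _ (o i)).
apply: (etrans (proj2 hiid (fun i => image_set (U i)) (fun i => mzU (mU i)))).
by apply: eq_bigr => i _; rewrite preimage_image.
Qed.

End iid_transfer.

Section observation.
Context {R : realType} {k : nat}.
Implicit Types (phi : R * borel R k -> R) (nu : cumulative R R).

(** The Stieltjes measure on ]0, 1] is determined by the path on [0, 1], by
    [stieltjes_unit_unique]. *)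
Lemma loss_observation phi x x' nu nu' (y y' : R -> R) :
  observation x nu y = observation x' nu' y' -> loss phi x y nu = loss phi x' y' nu'.
Proof.
case=> <- nunu' yy'.
have on01 (f g : R -> R) : f \_ `[0, 1] = g \_ `[0, 1] -> forall t, 0 <= t <= 1 -> f t = g t.
  move=> fg t t01; have := congr1 (fun h => h t) fg.
  by rewrite !patchE mem_set.
apply: (congr2 (fun v v' : R => v - 2 * v')).
  apply: eq_Rintegral => t; rewrite inE/= in_itv/= => t01.
  by rewrite (on01 _ _ yy').
apply: (congr1 fine); apply: eq_measure_integral => A mA A01.
apply: (@stieltjes_unit_unique _ nu (lebesgue_stieltjes_measure nu')) => // a c a0 ac c1.
apply: (etrans (stieltjes_itv nu' ac)).
by rewrite (on01 _ _ nunu' a) ?a0 ?(le_trans ac)// (on01 _ _ nunu' c) ?c1 ?(le_trans a0).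
Qed.

End observation.

Section empirical_tail.
Context {R : realType} {k n : nat} {dT : measure_display} {T : measurableType dT}
  {P : probability T R} {F : R -> set (set T)}
  {alpha0 : R * borel R k -> R} {X : {RV P >-> borel R k}}
  {N : T -> cumulative R R} {Y : R -> T -> R}
  (hmodel : counting_model F alpha0 X N Y)
  {a0 : R} (alpha0_le : forall z, time_cube z -> alpha0 z <= a0)
  {dS : measure_display} {S : measurableType dS} {Q : probability S R}
  {Xs : 'I_n -> S -> borel R k} {Ns : 'I_n -> S -> cumulative R R}
  {Ys : 'I_n -> R -> S -> R}
  (hiid : iid_copies P Q (fun w => observation (X w) (N w) (Y ^~ w))
     (fun i s => observation (Xs i s) (Ns i s) (Ys i ^~ s))).

Definition observable : set S :=
  observed (D := fun w => observation (X w) (N w) (Y ^~ w))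
    (Ds := fun i s => observation (Xs i s) (Ns i s) (Ys i ^~ s)).

Lemma deviation_const_gt0 (b : R) : 0 < b -> 0 <= a0 -> 0 < @deviation_const R a0 b.
Proof.
move=> b0 a00; rewrite /deviation_const /deviation_const_A /deviation_const_B.
have := sqrtr_ge0 a0; lra.
Qed.

Context (n0 : (0 < n)%N) (b : R) (b0 : 0 < b) (a00 : 0 <= a0)
  (al be : R * borel R k -> R)
  (mal : bounded_measurable al) (mbe : bounded_measurable be)
  (alb : forall z, `|al z| <= b) (beb : forall z, `|be z| <= b)
  (alout : forall z, ~ time_cube z -> al z = 0)
  (beout : forall z, ~ time_cube z -> be z = 0).

Local Notation K := (@deviation_const R a0 b).
Local Notation risk' := (risk P X N Y).
Local Notation emp := (empirical_risk Xs Ns Ys).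

(** This is [bernstein_iid] with variance factor (2 K sg)^2 and scale 4/3 K D. The exceptional event
    is defined by observed parts, which are measurable and coincide with the losses on
    [observable]. *)
Lemma empirical_tail (D sg u : R) : 0 < D -> (forall z, `|al z - be z| <= D) ->
  0 < sg -> \int[P]_w time_int X Y (fun z => (al z - be z) ^+ 2) 0 1 w <= sg ^+ 2 ->
  0 < u ->
  exists Bad : set S, [/\ measurable Bad, (Q Bad <= (expR (- u))%:E)%E &
    forall s, observable s -> ~ Bad s ->
      Num.sqrt n%:R * ((risk' al - risk' be) - (emp al s - emp be s))
      <= 2 * K * sg * Num.sqrt (2 * u) + 4 / 3 * K * D * u / Num.sqrt n%:R].
Proof.
move=> D0 hD sg0 hsg u0.
have K0 : 0 < K by exact: deviation_const_gt0.
have nR : 0 < n%:R :> R by rewrite ltr0n.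
pose m := risk' be - risk' al.
pose zeta := @excess_loss _ _ _ _ P X N Y al be.
pose zs i s := loss be (Xs i s) (Ys i ^~ s) (Ns i s) - loss al (Xs i s) (Ys i ^~ s) (Ns i s).
have mzeta : measurable_fun setT zeta.
  have ml phi : bounded_measurable phi ->
      measurable_fun setT (fun w => loss phi (X w) (Y ^~ w) (N w)).
    move=> bphi; rewrite (_ : (fun _ => _) = (fun w => time_int X Y (fun z => phi z ^+ 2) 0 1 w
        - 2 * @jump_integral R k dT T P X N phi w)); last first.
      by apply/funext => w; exact: (loss_model hmodel).
    apply: measurable_funB.
      by apply: (measurable_time_int hmodel); exact: bounded_measurableM.
    apply: measurable_funM => //; exact: (measurable_jump_integral hmodel (proj1 bphi)).
  exact: (measurable_funB (ml _ mbe) (ml _ mal)).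
have zetaD w w' : observation (X w) (N w) (Y ^~ w) = observation (X w') (N w') (Y ^~ w') ->
    zeta w = zeta w'.
  by move=> E; rewrite /zeta /excess_loss !(loss_observation _ E).
have zsD i s w : observation (X w) (N w) (Y ^~ w) = observation (Xs i s) (Ns i s) (Ys i ^~ s) ->
    zs i s = zeta w.
  by move=> E; rewrite /zeta /excess_loss !(loss_observation _ E).
have mgf l : 0 <= l -> 4 / 3 * K * D * l < 1 ->
    (\int[P]_w (expR (l * (zeta w - m)))%:E
     <= (expR (l ^+ 2 * (4 * K ^+ 2 * sg ^+ 2) / (2 * (1 - 4 / 3 * K * D * l))))%:E)%E.
  move=> l0 cl.
  have cl' : 4 / 3 * K * l * D < 1 by rewrite mulrAC.
  have := excess_loss_mgf hmodel alpha0_le b0 mal mbe alb beb alout beout D0 hD l0 hsg cl'.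
  rewrite (_ : 2 * K ^+ 2 * _ * _ / _ = l ^+ 2 * (4 * K ^+ 2 * sg ^+ 2) / (2 * (1 - 4 / 3 * K * D * l)))//.
  rewrite [4 / 3 * K * l * D]mulrAC; field.
  by rewrite lt0r_neq0//; lra.
have v0 : 0 < 4 * K ^+ 2 * sg ^+ 2 by rewrite !mulr_gt0// exprn_gt0.
have c0 : 0 <= 4 / 3 * K * D by rewrite !mulr_ge0// ltW.
have mZ i := measurable_observed_part hiid mzeta zetaD zsD i.
have tail := bernstein_iid mZ mzeta (observed_part_indep hiid mzeta zetaD zsD)
  v0 c0 u0 n0 mgf.
pose Zp := observed_part (D := fun w => observation (X w) (N w) (Y ^~ w))
  (Ds := fun i s => observation (Xs i s) (Ns i s) (Ys i ^~ s)) zs.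
pose t := Num.sqrt (2 * n%:R * (4 * K ^+ 2 * sg ^+ 2) * u) + 4 / 3 * K * D * u.
pose Bad := [set s | t < \sum_(i < n) (Zp i s - m)].
exists Bad; split; [|exact: tail|].
  rewrite (_ : Bad = (fun s => \sum_(i < n) (Zp i s - m)) @^-1` `]t, +oo[%classic).
    rewrite -[X in measurable X]setTI; apply: measurable_sum => //.
    by move=> i; exact: measurable_funB.
  by apply/seteqP; split => s /=; rewrite in_itv/= andbT.
move=> s os /negP; rewrite -leNgt => le_t.
have sE : \sum_(i < n) (Zp i s - m)
    = n%:R * ((risk' al - risk' be) - (emp al s - emp be s)).
  rewrite (eq_bigr (fun i => (loss be (Xs i s) (Ys i ^~ s) (Ns i s)
      - loss al (Xs i s) (Ys i ^~ s) (Ns i s)) - m)); last first.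
    move=> i _; congr (_ - _); rewrite /Zp /observed_part indicE mem_set ?mulr1//.
    exact: os.
  rewrite sumrB sumr_const card_ord -[m *+ n]mulr_natl /empirical_risk /m.
  rewrite [X in X - _](_ : _ = \sum_(i < n) loss be (Xs i s) (Ys i ^~ s) (Ns i s)
      - \sum_(i < n) loss al (Xs i s) (Ys i ^~ s) (Ns i s)); last by rewrite -sumrB.
  by field; rewrite lt0r_neq0.
rewrite sE in le_t.
have sn0 : 0 < Num.sqrt n%:R :> R by rewrite sqrtr_gt0.
have nE : n%:R = Num.sqrt n%:R * Num.sqrt n%:R :> R by rewrite -expr2 sqr_sqrtr// ltW.
rewrite -(ler_pM2l sn0) mulrA -nE; apply: (le_trans le_t).
rewrite /t le_eqVlt; apply/orP; left; apply/eqP.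
have -> : Num.sqrt (2 * n%:R * (4 * K ^+ 2 * sg ^+ 2) * u)
    = Num.sqrt n%:R * (2 * K * sg * Num.sqrt (2 * u)).
  rewrite (_ : 2 * n%:R * (4 * K ^+ 2 * sg ^+ 2) * u = n%:R * ((2 * K * sg) ^+ 2 * (2 * u))).
    rewrite sqrtrM ?ler0n// sqrtrM ?sqr_ge0// sqrtr_sqr ger0_norm//.
    by rewrite !mulr_ge0// ltW.
  by ring.
by field; rewrite lt0r_neq0.
Qed.

End empirical_tail.

(** * The norm of the model *)

Section ae_bounds.
Context {R : realType} {d} {T : measurableType d}.

(** The hypothesis is tested on the set where [f] is negative. *)
Lemma ae_ge0_integral (mu : {measure set T -> \bar R}) (f : T -> R) :
  measurable_fun setT f ->
  (forall B, measurable B -> (0 <= \int[mu]_(x in B) (f x)%:E)%E) ->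
  {ae mu, forall x, 0 <= f x}.
Proof.
move=> mf f0.
pose U := f @^-1` `]-oo, 0[%classic.
have mU : measurable U by rewrite -[U]setTI; exact: mf.
have Uf x : U x -> f x < 0 by rewrite /U /= in_itv.
have mg : measurable_fun U (fun x => (- f x)%:E).
  apply/measurable_EFinP/measurable_funN; exact: (measurable_funS measurableT _ mf).
have g0 x : U x -> (0 <= (- f x)%:E)%E by move=> /Uf ?; rewrite lee_fin oppr_ge0 ltW.
have : (\int[mu]_(x in U) (- f x)%:E <= 0)%E.
  have := integral_ge0N mu g0; under eq_integral do rewrite -EFinN opprK.
  by have := f0 U mU => + E; rewrite E oppe_ge0.
move=> le0; have : (\int[mu]_(x in U) `|(- f x)%:E| = 0)%E.
  apply/eqP; rewrite eq_le; apply/andP; split; last exact: integral_ge0.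
  apply: le_trans le0; rewrite le_eqVlt; apply/orP; left; apply/eqP.
  by apply: eq_integral => x /set_mem Ux; rewrite gee0_abs// g0.
move=> /(ae_eq_integral_abs mu mU mg).
apply: filterS => x Ux0; rewrite leNgt; apply/negP => fx.
have Ux : U x by rewrite /U /= in_itv.
by have [/eqP] := Ux0 Ux; rewrite oppr_eq0 lt_eqF.
Qed.

Lemma ae_in01_integral (mu : probability T R) (f : T -> R) : measurable_fun setT f ->
  (forall B, measurable B -> (0 <= \int[mu]_(x in B) (f x)%:E <= mu B)%E) ->
  {ae mu, forall x, 0 <= f x <= 1}.
Proof.
move=> mf f01.
have ae0 : {ae mu, forall x, 0 <= f x}.
  by apply: ae_ge0_integral => // B /f01/andP[].
have mfB B : measurable_fun B (EFin \o f).
  by apply/measurable_EFinP; exact: (measurable_funS measurableT _ mf).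
have int : mu.-integrable setT (EFin \o f).
  apply/integrableP; split; first exact: mfB.
  have absE : (\int[mu]_x `|(f x)%:E| = \int[mu]_x (f x)%:E)%E.
    have mf1 : measurable_fun setT (fun x => `|(f x)%:E|%E).
      by apply/measurable_EFinP; exact: measurableT_comp.
    have mf2 : measurable_fun setT (fun x => (f x)%:E) by exact/measurable_EFinP.
    apply: (ae_eq_integral _ _ measurableT mf1 mf2).
    by apply: filterS ae0 => x f0 _ /=; rewrite ger0_norm.
  rewrite /= absE; have /andP[_ /le_lt_trans->]// := f01 _ measurableT.
  by rewrite probability_setT ltry.
have ae1 : {ae mu, forall x, 0 <= 1 - f x}.
  apply: ae_ge0_integral => [|B mB]; first exact: measurable_funB.
  have i1 : mu.-integrable B (EFin \o cst 1).
    apply: (integrableS measurableT mB) => //.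
    by apply: finite_measure_integrable_cst.
  have i2 : mu.-integrable B (EFin \o f) by exact: (integrableS measurableT mB).
  have E : (\int[mu]_(x in B) (1 - f x)%:E = mu B - \int[mu]_(x in B) (f x)%:E)%E.
    apply: (etrans (integralB_EFin mB i1 i2)); congr (_ - _)%E.
    by apply: (etrans (integral_cst mu mB 1)); rewrite mul1e.
  have /andP[h0 h1] := f01 _ mB.
  have mufin : mu B \is a fin_num by exact: fin_num_measure.
  by rewrite E sube_ge0// mufin orbT.
by apply: filterS2 ae0 ae1 => x -> /=; rewrite subr_ge0.
Qed.

End ae_bounds.

Section cond_mean_integral.
Context {R : realType} {k : nat} {dT : measure_display} {T : measurableType dT}
  {P : probability T R} {F : R -> set (set T)}
  {alpha0 : R * borel R k -> R} {X : {RV P >-> borel R k}}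
  {N : T -> cumulative R R} {Y : R -> T -> R}
  (hmodel : counting_model F alpha0 X N Y)
  {m : R * borel R k -> R} (hm : is_cond_mean X Y m).

Local Notation mu := (distribution P X).
Local Notation leb := (@lebesgue_measure R).
Local Notation I01 := (`]0, 1]%classic : set R).

(* A version of m that is measurable on the whole space and lies in [0,1] everywhere. *)
Definition clamped_mean (z : R * borel R k) : R :=
  Num.min (Num.max (m z * \1_I01 z.1) 0) 1.

Lemma clamped_mean01 z : 0 <= clamped_mean z <= 1.
Proof. by rewrite /clamped_mean le_min ge_min le_max !lexx ler01 !orbT. Qed.

Let mm : measurable_fun setT (fun z => m z * \1_I01 z.1).
Proof.
have mD : measurable (I01 `*` setT : set (R * borel R k)) by apply: measurableX.
have : measurable_fun (I01 `*` setT) m.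
  apply: (measurable_funS _ _ (proj1 hm)).
    by apply: measurableX.
  by move=> z [/= z01 _]; split => //=; move: z01; rewrite !in_itv/= => /andP[/ltW -> ->].
move=> /(measurable_restrictT _ mD).
apply: eq_measurable_fun => z _; rewrite /patch indicE.
have [/set_mem[/= z01 _]|z01] := boolP (z \in _); first by rewrite mem_set// mulr1.
by rewrite memNset ?mulr0// => h; move/negP: z01; apply; exact/mem_set.
Qed.

Lemma measurable_clamped_mean : measurable_fun setT clamped_mean.
Proof.
apply: measurable_minr => //; exact: measurable_maxr.
Qed.

Let mt t : t \in I01 -> measurable_fun setT (fun x => m (t, x)).
Proof.
move=> t01; have := measurableT_comp mm (pair1_measurable t).
by apply: eq_measurable_fun => x _ /=; rewrite indicE t01 mulr1.
Qed.

Let mean_int t B : t \in I01 -> measurable B ->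
  (\int[mu]_(x in B) (m (t, x))%:E = \int[P]_(w in X @^-1` B) (risk_process Y t w)%:E)%E.
Proof.
move=> /set_mem; rewrite /= in_itv/= => /andP[t0 t1] mB.
have t01 : t \in `[0, 1] by rewrite in_itv/= t1 ltW.
rewrite (proj2 hm t t01 B mB); apply: eq_integral => w _.
by rewrite /risk_process indicE mem_set// mul1r.
Qed.

Let mYt t : measurable_fun setT (risk_process Y t).
Proof.
have [mY _] := bounded_measurable_risk_process hmodel.
exact: (measurableT_comp mY (pair1_measurable t)).
Qed.

(** The risk process lies in [0, 1], so the integral of [m (t, .)] over any set lies between 0 and
    the measure of that set. Clamping thus changes [m (t, .)] only on a null set, which may depend
    on [t]. *)
Lemma ae_clamped_mean t : t \in I01 -> {ae mu, forall x, m (t, x) = clamped_mean (t, x)}.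
Proof.
move=> t01; have := @ae_in01_integral _ _ _ mu _ (mt t01).
have mX B : measurable B -> measurable (X @^-1` B).
  by move=> mB; rewrite -[X in measurable X]setTI; exact: measurable_funPT.
move=> H; have /H : forall B, measurable B ->
    (0 <= \int[mu]_(x in B) (m (t, x))%:E <= mu B)%E.
  move=> B mB; rewrite mean_int//.
  have Y01 := risk_process01 hmodel t.
  rewrite integral_ge0/=; last by move=> w _; rewrite lee_fin; case/andP: (Y01 w).
  apply: (@le_trans _ _ (\int[P]_(w in X @^-1` B) (cst 1 w))%E).
    apply: ge0_le_integral.
    - exact: mX.
    - by move=> w _; rewrite lee_fin; case/andP: (Y01 w).
    - by apply/measurable_EFinP; exact: (measurable_funS measurableT _ (mYt t)).
    - exact: measurable_cst.
    - by move=> w _; rewrite lee_fin; case/andP: (Y01 w).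
  by rewrite (integral_cst P (mX _ mB) 1) mul1e.
apply: filterS => x /andP[x0 x1].
by rewrite /clamped_mean indicE t01 mulr1 max_l// min_l.
Qed.

Lemma integral_cond_mean (g : borel R k -> R) t : t \in I01 -> measurable_fun setT g ->
  (forall x, 0 <= g x) ->
  (\int[P]_w (g (X w) * risk_process Y t w)%:E
   = \int[mu]_x (g x * clamped_mean (t, x))%:E)%E.
Proof.
move=> t01 mg g0.
have Y0 w : 0 <= risk_process Y t w by case/andP: (risk_process01 hmodel t w).
have c0 x : 0 <= clamped_mean (t, x) by case/andP: (clamped_mean01 (t, x)).
have mc : measurable_fun setT (fun x => clamped_mean (t, x)).
  exact: (measurableT_comp measurable_clamped_mean (pair1_measurable t)).
have mX : measurable_fun setT X by exact: measurable_funPT.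
have [nu1 nu1E nu1I] := weighted_image P (mYt t) Y0 mX.
have [nu2 nu2E nu2I] := weighted_image mu mc c0 (@measurable_id _ (borel R k) setT).
have mgE : measurable_fun setT (EFin \o g) by exact/measurable_EFinP.
have g0E x : (0 <= (EFin \o g) x)%E by rewrite lee_fin.
transitivity (\int[nu1]_x (EFin \o g) x)%E.
  by rewrite nu1I//; apply: eq_integral => w _; rewrite EFinM.
transitivity (\int[nu2]_x (EFin \o g) x)%E; last first.
  by rewrite nu2I//; apply: eq_integral => w _; rewrite EFinM.
apply: eq_measure_integral => B mB _.
rewrite nu1E// nu2E// -mean_int//.
apply: ae_eq_integral => //.
- by apply/measurable_EFinP; exact: (measurable_funS measurableT _ (mt t01)).
- by apply/measurable_EFinP; exact: (measurable_funS measurableT _ mc).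
- by have := ae_clamped_mean t01; apply: filterS => x -> _.
Qed.

(** Identifies the variance parameter of [excess_loss_mgf] with the squared norm behind [d_2]. *)
Lemma mean_time_int_inner h : bounded_measurable h ->
  \int[P]_w time_int X Y (fun z => h z ^+ 2) 0 1 w = inner X m h h.
Proof.
move=> bh; have [mh _] := bh.
have bh2 : bounded_measurable (fun z => h z ^+ 2) by exact: bounded_measurableM.
pose g z := h z ^+ 2 * \1_I01 z.1.
have m1 : measurable_fun setT (fun z : R * borel R k => \1_I01 z.1 : R).
  by apply: (measurableT_comp (measurable_indic _)) => //; exact: measurable_fst.
have mg : measurable_fun setT g by exact: measurable_funM (proj1 bh2) m1.
have g0 z : 0 <= g z by rewrite mulr_ge0// sqr_ge0.
have gout t x : t \notin I01 -> g (t, x) = 0.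
  by move=> t01; rewrite /g indicE (negbTE t01) mulr0.
pose G z := (g z * clamped_mean z)%:E.
have mG : measurable_fun setT G.
  by apply/measurable_EFinP; exact: measurable_funM mg measurable_clamped_mean.
have G0 z : (0 <= G z)%E.
  by rewrite lee_fin mulr_ge0//; case/andP: (clamped_mean01 z).
pose H (z : R * T) := (g (z.1, X z.2) * risk_process Y z.1 z.2)%:E.
have mX : measurable_fun setT X by exact: measurable_funPT.
have mH : measurable_fun setT H.
  apply/measurable_EFinP; apply: measurable_funM.
    apply: (measurableT_comp mg); apply: measurable_fun_pair; first exact: measurable_fst.
    by apply: (measurableT_comp mX); exact: measurable_snd.
  by have [] := bounded_measurable_risk_process hmodel.
have H0 z : (0 <= H z)%E.
  by rewrite lee_fin mulr_ge0//; case/andP: (risk_process01 hmodel z.1 z.2).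
(* m may be unbounded on a null set, hence the signed kernel and its positive and negative parts. *)
pose M (z : R * borel R k) := (g z * (m z * \1_I01 z.1))%:E.
have mM : measurable_fun setT M.
  by apply/measurable_EFinP; exact: measurable_funM mg mm.
have E1 x : (\int[leb]_(t in `[0%R, 1%R]) (h (t, x) * h (t, x) * m (t, x))%:E
    = \int[leb]_t M (t, x))%E.
  have mhm : measurable_fun I01 (fun t => (h (t, x) * h (t, x) * m (t, x))%:E).
    have := measurableT_comp mM (pair2_measurable x).
    move=> /(measurable_funS measurableT (@subsetT _ I01)).
    apply: eq_measurable_fun => t t01 /=.
    by rewrite /M /g/= indicE t01 !mulr1 expr2.
  rewrite -(integral_itv_obnd_cbnd mhm) integral_mkcond.
  apply: eq_integral => t _; rewrite /patch /M /g/= indicE.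
  by case: (t \in _); rewrite ?mulr1 ?mulr0 ?mul0r// expr2.
have aeM : {ae mu, forall x, (\int[leb]_t M (t, x) = \int[leb]_t G (t, x))%E}.
  (* For every [t] the two kernels agree for almost every [x]. Tonelli applied to their distance
     exchanges the roles: for almost every [x] they agree for almost every [t]. *)
  pose Df z := (`|g z * (m z * \1_I01 z.1) - g z * clamped_mean z|)%:E.
  have mDf : measurable_fun setT Df.
    apply/measurable_EFinP; apply: measurableT_comp => //.
    by apply: measurable_funB; apply: measurable_funM => //; exact: measurable_clamped_mean.
  have Df0 z : (0 <= Df z)%E by rewrite lee_fin.
  have D0 : (\int[mu]_x \int[leb]_t Df (t, x) = 0)%E.
    rewrite -(@fubini_tonelli _ _ _ _ _ leb mu Df mDf Df0).
    apply: integral0_eq => t _.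
    apply: (etrans _ (integral0 mu setT)).
    have mDt : measurable_fun setT (fun x => Df (t, x)).
      exact: (measurableT_comp mDf (pair1_measurable t)).
    apply: ae_eq_integral => //.
    have [t01|t01] := boolP (t \in I01).
      have := ae_clamped_mean t01; apply: filterS => x mx _.
      by rewrite /Df/= indicE t01 mulr1 mx subrr normr0.
    by apply: aeW => x _; rewrite /Df gout// !mul0r subrr normr0.
  have mDfx : measurable_fun setT (fun x => (\int[leb]_t Df (t, x))%E).
    exact: (@measurable_fun_fubini_tonelli_G _ _ _ _ _ leb Df mDf Df0).
  have : (\int[mu]_x `|\int[leb]_t Df (t, x)| = 0)%E.
    rewrite -[RHS]D0; apply: eq_integral => x _; rewrite gee0_abs//.
    exact: integral_ge0.
  move=> /(ae_eq_integral_abs mu measurableT mDfx).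
  apply: filterS => x /(_ Logic.I) Dx.
  have mDx : measurable_fun setT (fun t => Df (t, x)).
    exact: (measurableT_comp mDf (pair2_measurable x)).
  have : (\int[leb]_t `|Df (t, x)| = 0)%E.
    by rewrite -[RHS]Dx; apply: eq_integral => t _; rewrite gee0_abs.
  move=> /(ae_eq_integral_abs leb measurableT mDx) aeD.
  apply: ae_eq_integral => //.
  - exact: (measurableT_comp mM (pair2_measurable x)).
  - exact: (measurableT_comp mG (pair2_measurable x)).
  - apply: filterS aeD => t /(_ Logic.I) [/eqP] + _.
    by rewrite normr_eq0 subr_eq0 => /eqP; rewrite /M /G => ->.
have mIM : measurable_fun setT (fun x => (\int[leb]_t M (t, x))%E).
  rewrite (_ : (fun _ => _) = (fun x => \int[leb]_t (M^\+ (t, x)) - \int[leb]_t (M^\- (t, x)))%E).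
    apply: emeasurable_funB.
    - exact: (@measurable_fun_fubini_tonelli_G _ _ _ _ _ leb _ (measurable_funepos mM) (funepos_ge0 M)).
    - exact: (@measurable_fun_fubini_tonelli_G _ _ _ _ _ leb _ (measurable_funeneg mM) (funeneg_ge0 M)).
  apply/funext => x; apply: (etrans (integralE leb setT (fun t => M (t, x)))).
  by congr (_ - _)%E; apply: eq_integral => t _; rewrite ?funeposE ?funenegE.
have innerE : (\int[mu]_x \int[leb]_(t in `[0%R, 1%R]) (h (t, x) * h (t, x) * m (t, x))%:E
    = \int[P]_w \int[leb]_t H (t, w))%E.
  transitivity (\int[mu]_x \int[leb]_t M (t, x))%E.
    by apply: eq_integral => x _; exact: E1.
  transitivity (\int[mu]_x \int[leb]_t G (t, x))%E.
    apply: ae_eq_integral => //.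
    - exact: (@measurable_fun_fubini_tonelli_G _ _ _ _ _ leb G mG G0).
    - by apply: filterS aeM => x ? _.
  rewrite -(@fubini_tonelli _ _ _ _ _ leb mu G mG G0).
  rewrite -(@fubini_tonelli _ _ _ _ _ leb P H mH H0).
  apply: eq_integral => t _.
  have [t01|t01] := boolP (t \in I01); last first.
    rewrite !integral0_eq// => x _; rewrite /G /H gout// mul0r//.
  have mgt : measurable_fun setT (fun x => g (t, x)).
    exact: (measurableT_comp mg (pair1_measurable t)).
  by apply/esym; exact: (integral_cond_mean t01 mgt).
rewrite /inner innerE /Rintegral; apply: (congr1 fine).
apply: eq_integral => w _; rewrite (time_int_EFin hmodel)// integral_mkcond.
apply: eq_integral => t _; rewrite /patch /H /g/= indicE.
by case: (t \in _); rewrite ?mulr1// mulr0 mul0r.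
Qed.

End cond_mean_integral.

(** * Generic chaining *)

Section admissible_sequences.
Context {R : realType} {V : Type}.
Implicit Types (A B : set V) (PP : set (set V)) (d : V -> V -> \bar R).

Lemma pblock_mem PP A a : partition PP id A -> A a ->
  PP (pblock PP id a) /\ pblock PP id a a.
Proof.
move=> [cA _ _] Aa; rewrite /pblock /pblock_index.
have [B PB Ba] : cover PP id a by rewrite cA.
by case: xgetP => [C _ []//|/(_ B) []].
Qed.

Lemma pblock_unique PP A a B : partition PP id A -> PP B -> B a -> pblock PP id a = B.
Proof.
move=> part PB Ba; have [cA tI _] := part.
have Aa : A a by rewrite -cA; exists B.
have [PC Ca] := pblock_mem part Aa.
by apply: tI => //; exists a.
Qed.

Lemma pblock_sub PP A a : partition PP id A -> A a -> pblock PP id a `<=` A.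
Proof.
move=> part Aa b; have [cA _ _] := part; have [PC _] := pblock_mem part Aa.
by rewrite -[in X in _ -> X]cA; exists (pblock PP id a).
Qed.

Lemma le_diameter d B a a' : B a -> B a' -> (d a a' <= diameter d B)%E.
Proof. by move=> Ba Ba'; apply: ereal_sup_ubound; exists (a, a'). Qed.

Lemma card_le_II_inj U (D : set U) n : (D #<= `I_n)%card ->
  exists f : U -> nat, (forall u, D u -> (f u < n)%N) /\
    forall u v, D u -> D v -> f u = f v -> u = v.
Proof.
move=> /pcard_leP/injfunPex[f fn fi]; exists f; split=> [u Du|u v Du Dv].
  exact: fn.
by apply: fi; exact/mem_set.
Qed.

Context {A : set V} {AA : nat -> set (set V)} (adm : admissible A AA).

Lemma pblock_refine j a : A a -> pblock (AA j.+1) id a `<=` pblock (AA j) id a.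
Proof.
move=> Aa; have [Pa aa] := pblock_mem (admissible_partition adm j.+1) Aa.
have [C PC BC] := admissible_refine adm Pa.
by rewrite (pblock_unique (admissible_partition adm j) PC (BC _ aa)).
Qed.

Lemma eq_pblock_refine j a a' : A a -> A a' ->
  pblock (AA j.+1) id a = pblock (AA j.+1) id a' -> pblock (AA j) id a = pblock (AA j) id a'.
Proof.
move=> Aa Aa' E; have [_ aa] := pblock_mem (admissible_partition adm j.+1) Aa.
apply: (pblock_unique (admissible_partition adm j)).
  by have [] := pblock_mem (admissible_partition adm j) Aa'.
by apply: pblock_refine => //; rewrite -E.
Qed.

Lemma pblock0 a a' : A a -> A a' -> pblock (AA 0) id a a'.
Proof.
move=> Aa Aa'.
have [P1 _] := pblock_mem (admissible_partition adm 0) Aa.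
have [P2 aa'] := pblock_mem (admissible_partition adm 0) Aa'.
have /card_le_II_inj[f [f1 fi]] : (AA 0%N #<= `I_1)%card.
  by have := admissible_card0 adm; rewrite card_eq_le => /andP[].
have := f1 _ P1; have := f1 _ P2; rewrite !ltnS !leqn0 => /eqP f2 /eqP f3.
by rewrite (fi _ _ P1 P2) // f2 f3.
Qed.

Context {d : V -> V -> \bar R} (d0 : forall a a', (0 <= d a a')%E)
  {w : nat -> R} (w1 : forall j, 1 <= w j) (w2 : forall j, w j <= 2 ^+ j) {g : R}
  (hg : forall a, A a ->
    (\sum_(0 <= j <oo) (w j)%:E * diameter d (pblock (AA j) id a) <= g%:E)%E).

Local Notation diam j a := (diameter d (pblock (AA j) id a)).

Lemma diameter_ge0 j a : A a -> (0 <= diam j a)%E.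
Proof.
move=> Aa; have [_ aa] := pblock_mem (admissible_partition adm j) Aa.
exact: le_trans (d0 a a) (le_diameter d aa aa).
Qed.

Let sum_le J a : A a -> (\sum_(0 <= j < J) (w j)%:E * diam j a <= g%:E)%E.
Proof.
move=> Aa; apply: le_trans (hg Aa); apply: nneseries_lim_ge => j _ _.
by rewrite mule_ge0 ?diameter_ge0// lee_fin (le_trans _ (w1 j)).
Qed.

Lemma diameter_fin j a : A a -> (fine (diam j a))%:E = diam j a.
Proof.
move=> Aa; apply: fineK; rewrite ge0_fin_numE ?diameter_ge0//.
apply: (@le_lt_trans _ _ g%:E); last exact: ltry.
apply: le_trans (sum_le j.+1 Aa); rewrite big_nat_recr//=.
apply: (@le_trans _ _ ((w j)%:E * diam j a)%E).
  by rewrite -[leLHS]mul1e lee_wpmul2r ?diameter_ge0// lee_fin.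
rewrite leeDr// sume_ge0// => i _.
by rewrite mule_ge0 ?diameter_ge0// lee_fin (le_trans _ (w1 i)).
Qed.

(** The tail bound needs positive radii. The added geometric terms provide them and, against weights
    of at most 2^j, cost no more than [e] in total. *)
Definition scale (e : R) j a := fine (diam j a) + e / 2 * 4^-1 ^+ j.

Lemma scale_gt0 e j a : 0 < e -> A a -> 0 < scale e j a.
Proof.
move=> e0 Aa; rewrite ltr_wpDl ?fine_ge0 ?diameter_ge0//.
by rewrite mulr_gt0 ?exprn_gt0 ?divr_gt0 ?invr_gt0.
Qed.

Lemma dist_le_scale e j a b b' : 0 < e -> A a ->
  pblock (AA j) id a b -> pblock (AA j) id a b' -> (d b b' <= (scale e j a)%:E)%E.
Proof.
move=> e0 Aa ab ab'; apply: (le_trans (le_diameter d ab ab')).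
rewrite -diameter_fin// lee_fin lerDl.
by rewrite mulr_ge0 ?exprn_ge0 ?invr_ge0// divr_ge0// ltW.
Qed.

Lemma sum_scale_le e J a : 0 < e -> A a -> \sum_(0 <= j < J) w j * scale e j a <= g + e.
Proof.
move=> e0 Aa.
rewrite (eq_bigr (fun j => w j * fine (diam j a) + w j * (e / 2 * 4^-1 ^+ j))); last first.
  by move=> j _; rewrite mulrDr.
rewrite big_split lerD//=.
  rewrite -lee_fin -sumEFin; apply: le_trans (sum_le J Aa).
  rewrite le_eqVlt; apply/orP; left; apply/eqP.
  by apply: eq_bigr => j _; rewrite EFinM diameter_fin.
have geo : \sum_(0 <= j < J) e / 2 * 2^-1 ^+ j = e * (1 - 2^-1 ^+ J).
  elim: J => [|J IH]; first by rewrite big_nil expr0 subrr mulr0.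
  by rewrite big_nat_recr//= IH exprS; field.
apply: (@le_trans _ _ (e * (1 - 2^-1 ^+ J))).
  rewrite -geo; apply: ler_sum => j _.
  rewrite mulrCA ler_wpM2l//; first by rewrite divr_ge0// ltW.
  have -> : 2^-1 ^+ j = 2 ^+ j * 4^-1 ^+ j :> R.
    by rewrite -exprMn; congr (_ ^+ _); field.
  by rewrite ler_wpM2r// exprn_ge0// invr_ge0.
by rewrite ler_piMr ?(ltW e0)// gerBl exprn_ge0// invr_ge0.
Qed.

End admissible_sequences.

Section unions.
Context {R : realType} {d} {S : measurableType d} (Q : probability S R).

Lemma finite_union_bound (I : eqType) (r : seq I) (B : I -> set S) (c : R) :
  (forall i, measurable (B i)) -> (forall i, (Q (B i) <= c%:E)%E) ->
  exists U : set S, [/\ measurable U, (Q U <= ((size r)%:R * c)%:E)%E &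
    forall i, i \in r -> B i `<=` U].
Proof.
move=> mB QB; elim: r => [|i r [U [mU QU BU]]].
  by exists set0; split => //; rewrite measure0 mul0r.
exists (B i `|` U); split; first exact: measurableU.
- apply: le_trans (measureU2 _ _ _) _ => //=.
  by rewrite -natr1 mulrDl mul1r addrC EFinD leeD.
- move=> i'; rewrite inE => /orP[/eqP->|/BU]; first by left.
  by move=> /subset_trans; apply; right.
Qed.

End unions.

(** * Numerical constants of the chain *)

Section chaining_numerics.
Context {R : realType}.

(* Level j has at most 16^(2^j) links, so the rate has to beat log 16 with a margin. *)
Definition chaining_rate : R := 157 / 50.

Lemma expR_chaining_rate : 16 * expR (- chaining_rate) <= 7 / 10.
Proof.
(* The rate is 4 y. At [y] the Taylor polynomial of degree 4 gives exp y >= 2.189, and 16 / 2.189^4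
   is below 7/10. *)
pose y : R := 157 / 200.
have y0 : 0 <= y by rewrite /y; lra.
have := series_le_psi2 3 y0; rewrite 3!big_ord_recr big_ord0/= /psi2 => h.
have e : 2189 / 1000 <= expR y.
  apply: le_trans (_ : 1 + y + (y ^+ 2 / 2 + y ^+ 3 / 6 + y ^+ 4 / 24) <= _).
    by rewrite /y; lra.
  move: h; rewrite !factS fact0 !natrM; lra.
have : (2189 / 1000) ^+ 4 <= expR chaining_rate.
  have -> : chaining_rate = 4%:R * y by rewrite /chaining_rate /y; lra.
  by rewrite expRM_natl lerXn2r// nnegrE; lra.
rewrite expRN; have := expR_gt0 chaining_rate.
set E := expR _ => E0 hE.
rewrite ler_pdivrMr//; lra.
Qed.

Lemma expR_43_lt : expR (43 / 100) < 1 + 545 / 10 ^+ 3 + 433 / 10 ^+ 6 :> R.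
Proof.
have := @psi2_le_bernstein R (43 / 100); rewrite /psi2 => h.
have {}h := h ltac:(lra); rewrite ler_pdivlMr in h; last by lra.
set E := expR _ in h *; lra.
Qed.

Lemma sum_doubly_exp J :
  \sum_(0 <= j < J) (7 / 10 : R) ^+ (2 ^ j) <= 3 / 2.
Proof.
pose r j : R := (7 / 10) ^+ (2 ^ j).
have r0 j : 0 <= r j by rewrite exprn_ge0//; lra.
have rS j : r j.+1 = r j ^+ 2 by rewrite /r expnSr exprM.
(* The term 11/10 r stands for the rest of the series: r + 11/10 r^2 <= 11/10 r as soon as r <=
   1/11, which holds from index 3 on. *)
have H j : \sum_(0 <= i < j.+3) r i + 11 / 10 * r j.+3 <= 3 / 2 /\ r j.+3 <= 1 / 11.
  elim: j => [|j [IH1 IH2]].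
    rewrite !big_nat_recr//= big_nil !rS /r expn0 expr1; split; lra.
  have := r0 j.+3; rewrite big_nat_recr//= [r j.+4]rS; split; nra.
have [J3|J3] := leqP 3 J.
  have [h _] := H (J - 3)%N; have := r0 J.
  by move: h; rewrite -addn3 subnK//; lra.
have [h _] := H 0%N; have r3 := r0 3.
apply: (@le_trans _ _ (\sum_(0 <= i < 3) r i)); last by lra.
rewrite [leRHS](big_cat_nat (n := J))//= ?(ltnW J3)//.
by rewrite lerDl sumr_ge0.
Qed.

Context {x : R} (x43 : 43 / 100 <= x).

(** At [t = 1] this reads 16/25 <= 3/2 x, which is the origin of the threshold 43/100. *)
Lemma level_le (t : R) : 1 <= t -> x + chaining_rate * t <= 5 / 2 * t * (1 + x).
Proof.
move=> t1; have : 0 <= (t - 1) * (x - 43 / 100) by rewrite mulr_ge0 ?subr_ge0.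
rewrite /chaining_rate; have := x43; nra.
Qed.

Lemma sqrt_level_le (t : R) : 1 <= t ->
  Num.sqrt (2 * (x + chaining_rate * t)) <= 5 / 3 * Num.sqrt t * (1 + Num.sqrt x).
Proof.
move=> t1; have x0 : 0 <= x by have := x43; lra.
have t0 : 0 <= t by lra.
pose r := Num.sqrt x; have r0 : 0 <= r by exact: sqrtr_ge0.
have r2 : r ^+ 2 = x by exact: sqr_sqrtr.
have st : Num.sqrt t ^+ 2 = t by exact: sqr_sqrtr.
rewrite -/r -[leRHS]ger0_norm; last by rewrite !mulr_ge0 ?sqrtr_ge0//; lra.
rewrite -sqrtr_sqr ler_wsqrtr// !exprMn st -r2 /chaining_rate.
have rl : 13 / 20 <= r.
  rewrite -[leLHS]ger0_norm; last by lra.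
  by rewrite -sqrtr_sqr ler_wsqrtr//; have := x43; lra.
(* After squaring, the difference of the two sides is affine in [t]: [h] is its sign at t = 1 and
   [h2] that of its slope. *)
have h : 0 <= 25 / 9 * (1 + r) ^+ 2 - 157 / 25 - 2 * r ^+ 2 by nra.
have h2 : 0 <= 25 / 9 * (1 + r) ^+ 2 - 157 / 25 by nra.
nra.
Qed.

End chaining_numerics.

(** * Chaining along two admissible sequences *)

Section chaining_bound.
Context {R : realType} {V : Type} {dS} {S : measurableType dS} {Q : probability S R}
  {A : set V} {astar : V} (hstar : A astar) {d2 d1 : V -> V -> \bar R}
  (d20 : forall a a', (0 <= d2 a a')%E) (d10 : forall a a', (0 <= d1 a a')%E)
  {AA BB : nat -> set (set V)} (hAA : admissible A AA) (hBB : admissible A BB)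
  {g2 g1 : R}
  (hg2 : forall a, A a -> (\sum_(0 <= j <oo)
     (2 `^ (j%:R / 2))%:E * diameter d2 (pblock (AA j) id a) <= g2%:E)%E)
  (hg1 : forall a, A a -> (\sum_(0 <= j <oo)
     (2 `^ (j%:R / 1))%:E * diameter d1 (pblock (BB j) id a) <= g1%:E)%E)
  {Z : V -> S -> R} {G : set S} {c2 c1 : R} (c20 : 0 <= c2) (c10 : 0 <= c1)
  (tail : forall a a' sg D u, A a -> A a' -> 0 < sg -> 0 < D -> 0 < u ->
     (d2 a a' <= sg%:E)%E -> (d1 a a' <= D%:E)%E ->
     exists Bad, [/\ measurable Bad, (Q Bad <= (expR (- u))%:E)%E &
       forall s, G s -> ~ Bad s -> Z a s - Z a' s <= c2 * sg * Num.sqrt (2 * u) + c1 * D * u])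
  (lip : forall s, G s -> exists2 M, 0 <= M &
     forall a a' D, A a -> A a' -> 0 < D -> (d1 a a' <= D%:E)%E -> Z a s - Z a' s <= M * D)
  (Z0 : forall s, G s -> Z astar s = 0)
  {x e : R} (x43 : 43 / 100 <= x) (e0 : 0 < e).

Let w2 (j : nat) : R := 2 `^ (j%:R / 2).
Let w1 (j : nat) : R := 2 `^ (j%:R / 1).

Let w1E j : w1 j = 2 ^+ j. Proof. by rewrite /w1 divr1 powR_mulrn. Qed.

Let w2E j : w2 j = Num.sqrt (2 ^+ j).
Proof. by rewrite /w2 powRrM powR_mulrn// powR12_sqrt// exprn_ge0. Qed.

Let pow2_ge1 j : 1 <= 2 ^+ j :> R. Proof. by rewrite exprn_ege1// ler1n. Qed.

Let w1_ge1 j : 1 <= w1 j. Proof. by rewrite w1E. Qed.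
Let w1_le j : w1 j <= 2 ^+ j. Proof. by rewrite w1E. Qed.
Let w2_ge1 j : 1 <= w2 j.
Proof. by rewrite w2E -[leLHS]sqrtr1 ler_wsqrtr. Qed.
Let w2_le j : w2 j <= 2 ^+ j.
Proof.
have := pow2_ge1 j; rewrite w2E; set t := 2 ^+ j => t1.
have t0 : 0 <= t by lra.
have := sqr_sqrtr t0; have : 1 <= Num.sqrt t by rewrite -[leLHS]sqrtr1 ler_wsqrtr.
nra.
Qed.

Let cell2 j a := pblock (AA j) id a.
Let cell1 j a := pblock (BB j) id a.
Let sg j a := @scale R V AA d2 e j a.
Let D j a := @scale R V BB d1 e j a.

Let pick_in (B : set V) : V :=
  if pselect (exists b, B b) is left h then sval (cid h) else astar.

(** A point common to the two cells of [a], as a function of the cells alone. At level 0 the only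
    cell is [A], so the chain may start at [astar], where [Z] vanishes. *)
Let rep j a : V := if j is 0 then astar else pick_in (cell2 j a `&` cell1 j a).

Let rep_in j a : A a -> cell2 j a (rep j a) /\ cell1 j a (rep j a).
Proof.
move=> Aa; case: j => [|j]; first by split; exact: (pblock0 _ Aa).
rewrite /rep /pick_in; case: pselect => [h|[]]; first by case: cid.
exists a; split.
  by have [] := pblock_mem (admissible_partition hAA j.+1) Aa.
by have [] := pblock_mem (admissible_partition hBB j.+1) Aa.
Qed.

Let A_rep j a : A a -> A (rep j a).
Proof.
move=> Aa; have [h _] := rep_in j Aa.
exact: (pblock_sub (admissible_partition hAA j) Aa h).
Qed.

Let u j : R := x + chaining_rate * 2 ^+ j.

Let u_gt0 j : 0 < u j.
Proof. by have := pow2_ge1 j; have := x43; rewrite /u /chaining_rate; lra. Qed.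

Let Nn j := (2 ^ (2 ^ j))%N.

Let link j a s := Z (rep j.+1 a) s - Z (rep j a) s.
Let bound j a := c2 * sg j a * Num.sqrt (2 * u j) + c1 * D j a * u j.

(** The cells of level j + 1 determine those of level j, so [link] and [bound] depend on [a] only
    through the numbers of its two cells at level j + 1. There is one exceptional event per pair of
    numbers, obtained from any [a0] that realizes the pair and empty if none does. *)
Let link_tail j : exists Bad : set S, [/\ measurable Bad,
    (Q Bad <= (expR (- x) * (7 / 10) ^+ (2 ^ j))%:E)%E &
    forall s, G s -> ~ Bad s -> forall a, A a -> link j a s <= bound j a].
Proof.
have [f [fN fi]] := card_le_II_inj (admissible_card hAA j.+1).
have [h [hN hi]] := card_le_II_inj (admissible_card hBB j.+1).
have mem2 a : A a -> AA j.+1 (cell2 j.+1 a).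
  by move=> Aa; have [] := pblock_mem (admissible_partition hAA j.+1) Aa.
have mem1 a : A a -> BB j.+1 (cell1 j.+1 a).
  by move=> Aa; have [] := pblock_mem (admissible_partition hBB j.+1) Aa.
have /choice[B hB] : forall pq : nat * nat, exists Bad : set S, [/\ measurable Bad,
    (Q Bad <= (expR (- u j))%:E)%E &
    forall s, G s -> ~ Bad s -> forall a, A a -> f (cell2 j.+1 a) = pq.1 ->
      h (cell1 j.+1 a) = pq.2 -> link j a s <= bound j a].
  move=> [p q].
  have [[a0 [Aa0 fa0 ha0]]|no] := pselect (exists a0,
      [/\ A a0, f (cell2 j.+1 a0) = p & h (cell1 j.+1 a0) = q]); last first.
    exists set0; split => //; first by rewrite measure0 lee_fin expR_ge0.
    by move=> s _ _ a Aa fa ha; exfalso; apply: no; exists a.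
  have [r2 r1] := rep_in j Aa0; have [r2' r1'] := rep_in j.+1 Aa0.
  have le2 := dist_le_scale hAA d20 w2_ge1 hg2 e0 Aa0
    (pblock_refine hAA Aa0 r2') r2.
  have le1 := dist_le_scale hBB d10 w1_ge1 hg1 e0 Aa0
    (pblock_refine hBB Aa0 r1') r1.
  have [Bad [mBad QBad hBad]] := tail (A_rep j.+1 Aa0) (A_rep j Aa0)
    (scale_gt0 hAA d20 j e0 Aa0) (scale_gt0 hBB d10 j e0 Aa0) (u_gt0 j) le2 le1.
  exists Bad; split => // s Gs nBad a Aa /= fa ha.
  have E2 : cell2 j.+1 a = cell2 j.+1 a0 by apply: fi; [exact: mem2|exact: mem2|rewrite fa].
  have E1 : cell1 j.+1 a = cell1 j.+1 a0 by apply: hi; [exact: mem1|exact: mem1|rewrite ha].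
  have F2 : cell2 j a = cell2 j a0 by exact: (eq_pblock_refine hAA Aa Aa0 E2).
  have F1 : cell1 j a = cell1 j a0 by exact: (eq_pblock_refine hBB Aa Aa0 E1).
  have -> : link j a s = link j a0 s.
    rewrite /link; have -> : rep j.+1 a = rep j.+1 a0 by rewrite /rep E2 E1.
    by rewrite /rep; case: (j) F2 F1 => // j' -> ->.
  have -> : bound j a = bound j a0.
    by rewrite /bound /sg /D /scale -/(cell2 j a) -/(cell1 j a) F2 F1.
  exact: hBad.
pose r := [seq (p, q) | p <- iota 0 (Nn j.+1), q <- iota 0 (Nn j.+1)].
have mB i : measurable (B i) by have [] := hB i.
have QB i : (Q (B i) <= (expR (- u j))%:E)%E by have [] := hB i.
have [U [mU QU BU]] := finite_union_bound r mB QB.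
exists U; split => //.
  apply: (le_trans QU); rewrite lee_fin size_allpairs !size_iota.
  have -> : (Nn j.+1 * Nn j.+1)%:R = 16 ^+ (2 ^ j) :> R.
    rewrite /Nn -expnD addnn -mul2n -expnS !expnS !mulnA expnM -natrX.
    by rewrite natrX.
  have -> : expR (- u j) = expR (- x) * expR (- chaining_rate) ^+ (2 ^ j).
    by rewrite -expRM_natl -expRD natrX /u; congr expR; ring.
  rewrite mulrCA -exprMn ler_wpM2l ?expR_ge0//.
  apply: lerXn2r; last exact: expR_chaining_rate.
    by rewrite nnegrE mulr_ge0 ?expR_ge0.
  by rewrite nnegrE; lra.
move=> s Gs nU a Aa.
have [_ _ hBs] := hB (f (cell2 j.+1 a), h (cell1 j.+1 a)).
apply: hBs => // Bs; apply: nU; apply: BU Bs.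
apply: allpairs_f; rewrite mem_iota add0n/=.
  by apply: fN; exact: mem2.
by apply: hN; exact: mem1.
Qed.

Let bound_le j a : A a ->
  bound j a <= 5 / 3 * c2 * (1 + Num.sqrt x) * (w2 j * sg j a)
    + 5 / 2 * c1 * (1 + x) * (w1 j * D j a).
Proof.
move=> Aa; have s0 := ltW (scale_gt0 hAA d20 j e0 Aa).
have D0 := ltW (scale_gt0 hBB d10 j e0 Aa).
apply: lerD.
  have -> : 5 / 3 * c2 * (1 + Num.sqrt x) * (w2 j * sg j a)
      = c2 * sg j a * (5 / 3 * w2 j * (1 + Num.sqrt x)) by ring.
  by rewrite ler_wpM2l ?mulr_ge0// w2E sqrt_level_le.
have -> : 5 / 2 * c1 * (1 + x) * (w1 j * D j a)
    = c1 * D j a * (5 / 2 * w1 j * (1 + x)) by ring.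
by rewrite ler_wpM2l ?mulr_ge0// w1E level_le.
Qed.

Lemma chaining_bound : exists Bad : set S, [/\ measurable Bad,
  (Q Bad <= (3 / 2 * expR (- x))%:E)%E &
  forall s, G s -> ~ Bad s -> forall a, A a ->
    Z a s <= 5 / 3 * c2 * (1 + Num.sqrt x) * (g2 + e) + 5 / 2 * c1 * (1 + x) * (g1 + e)].
Proof.
have [B hB] := choice link_tail.
have mB i : measurable (B i) by have [] := hB i.
exists (\bigcup_j B j); split; first exact: bigcup_measurable.
  apply: (@le_trans _ _ (\sum_(0 <= j <oo) Q (B j))%E).
    by apply: measure_sigma_subadditive => //; exact: bigcup_measurable.
  apply: lime_le; first by apply: is_cvg_nneseries => n _ _; exact: measure_ge0.
  apply: nearW => J.
  apply: (@le_trans _ _ (\sum_(0 <= j < J) (expR (- x) * (7 / 10) ^+ (2 ^ j))%:E)%E).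
    by apply: lee_sum => j _; have [] := hB j.
  rewrite sumEFin lee_fin -mulr_sumr mulrC ler_wpM2r ?expR_ge0//.
  exact: sum_doubly_exp.
move=> s Gs nB a Aa.
set K := 5 / 3 * c2 * _ * _ + _.
have x0 : 0 <= x by have := x43; lra.
have k2 : 0 <= 5 / 3 * c2 * (1 + Num.sqrt x) by rewrite !mulr_ge0 ?addr_ge0 ?sqrtr_ge0//; lra.
have k1 : 0 <= 5 / 2 * c1 * (1 + x) by rewrite !mulr_ge0 ?addr_ge0//; lra.
have repK J : Z (rep J a) s <= K.
  have -> : Z (rep J a) s = \sum_(0 <= j < J) link j a s.
    by rewrite telescope_sumr// /rep/= Z0// subr0.
  apply: (@le_trans _ _ (\sum_(0 <= j < J) bound j a)).
    apply: ler_sum => j _; have [_ _ h] := hB j.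
    by apply: h => // Bs; apply: nB; exists j.
  apply: (le_trans (ler_sum _ (fun j _ => bound_le j Aa))).
  rewrite big_split -!mulr_sumr lerD//= ler_wpM2l//.
    exact: (sum_scale_le hAA d20 w2_ge1 w2_le hg2 J e0 Aa).
  exact: (sum_scale_le hBB d10 w1_ge1 w1_le hg1 J e0 Aa).
have [M M0 hM] := lip Gs.
apply/ler_addgt0Pr => eps eps0.
have g1e : 0 <= g1 + e.
  have := sum_scale_le hBB d10 w1_ge1 w1_le hg1 0 e0 Aa.
  by rewrite big_nil.
(* [M] may depend on [s], and so may [J]. The weighted sum of the radii is at most g1 + e, hence so
   is its last term 2^J D_J, and 2^J exceeds M (g1 + e) / eps. *)
pose J := Num.bound (M * (g1 + e) / eps).
have DJ : 2 ^+ J * D J a <= g1 + e.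
  have := sum_scale_le hBB d10 w1_ge1 w1_le hg1 J.+1 e0 Aa.
  rewrite big_nat_recr//= w1E; apply: le_trans; rewrite lerDr.
  apply: sumr_ge0 => j _; rewrite mulr_ge0//; first by rewrite w1E exprn_ge0.
  exact/ltW/(scale_gt0 hBB d10 j e0 Aa).
have D0 := scale_gt0 hBB d10 J e0 Aa.
have [_ r1] := rep_in J Aa.
have [_ aa] := pblock_mem (admissible_partition hBB J) Aa.
have le1 := dist_le_scale hBB d10 w1_ge1 hg1 e0 Aa aa r1.
have := hM _ _ _ Aa (A_rep J Aa) D0 le1.
have := repK J.
suff : M * D J a <= eps by rewrite /D; lra.
have J2 : J%:R <= 2 ^+ J :> R by rewrite -natrX ler_nat ltnW// ltn_expl.
have : M * (g1 + e) / eps < 2 ^+ J.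
  apply: lt_le_trans J2; apply: unstable.ltr_bound.
rewrite ltr_pdivrMr// => h.
have p0 : 0 < 2 ^+ J :> R by rewrite exprn_gt0.
rewrite -(ler_pM2l p0) (le_trans _ (ltW h))// mulrCA ler_wpM2l//.
Qed.

End chaining_bound.

(** * The empirical process *)

Section lipschitz.
Context {R : realType} {k : nat} {dT : measure_display} {T : measurableType dT}
  {P : probability T R} {F : R -> set (set T)}
  {alpha0 : R * borel R k -> R} {X : {RV P >-> borel R k}}
  {N : T -> cumulative R R} {Y : R -> T -> R}
  (hmodel : counting_model F alpha0 X N Y)
  {a0 : R} (alpha0_le : forall z, time_cube z -> alpha0 z <= a0)
  {b D : R} {al be : R * borel R k -> R}
  (mal : bounded_measurable al) (mbe : bounded_measurable be)
  (alb : forall z, `|al z| <= b) (beb : forall z, `|be z| <= b)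
  (hD : forall z, `|al z - be z| <= D).

Let sq_lip z : `|al z ^+ 2 - be z ^+ 2| <= 2 * b * D.
Proof.
rewrite subr_sqr normrM mulrC ler_pM//.
by apply: (le_trans (ler_normD _ _)); have := alb z; have := beb z; lra.
Qed.

(** The constant grows with the number of jumps: it is finite along each path, which is all that the
    end of the chain requires. *)
Lemma loss_lipschitz w :
  loss al (X w) (Y ^~ w) (N w) - loss be (X w) (Y ^~ w) (N w)
  <= (2 * b + 2 * (jump_count (N w) 1)%:R) * D.
Proof.
have b1 : bounded_measurable (fun z => al z ^+ 2) by exact: bounded_measurableM.
have b2 : bounded_measurable (fun z => be z ^+ 2) by exact: bounded_measurableM.
rewrite !(loss_model hmodel)//.
have h1 : time_int X Y (fun z => al z ^+ 2) 0 1 w - time_int X Y (fun z => be z ^+ 2) 0 1 w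
    <= 2 * b * D.
  rewrite -(time_intB hmodel _ _ _ b1 b2).
  have := time_int_norm hmodel w (bounded_measurableB b1 b2) ler01 sq_lip.
  by rewrite subr0 mulr1; apply: le_trans; exact: ler_norm.
have h2 : `|@jump_integral _ _ _ _ P X N al w - @jump_integral _ _ _ _ P X N be w|
    <= (jump_count (N w) 1)%:R * D.
  rewrite /jump_integral /jump_sum -sumrB.
  apply: (le_trans (ler_norm_sum _ _ _)).
  apply: (@le_trans _ _ (\sum_(jump_count (N w) 0 <= l < jump_count (N w) 1) D)).
    by apply: ler_sum => l _; exact: hD.
  rewrite sumr_const_nat -[leLHS]mulr_natl ler_wpM2r ?ler_nat ?leq_subr//.
  exact: le_trans (hD point).
move: h1 h2; rewrite ler_norml => h1 /andP[h2 _]; lra.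
Qed.

Lemma risk_lipschitz :
  (forall z, ~ time_cube z -> al z = 0) -> (forall z, ~ time_cube z -> be z = 0) ->
  risk P X N Y al - risk P X N Y be <= (2 * b + 2 * a0) * D.
Proof.
move=> alout beout; rewrite !(risk_model hmodel alpha0_le)//.
pose f phi := fun z : R * borel R k => phi z ^+ 2 - 2 * (phi z * @cube_intensity R k alpha0 z).
have blam := bounded_measurable_cube_intensity hmodel alpha0_le.
have bf phi : bounded_measurable phi -> bounded_measurable (f phi).
  move=> bphi; apply: bounded_measurableB; first exact: bounded_measurableM.
  by apply: bounded_measurableZ; exact: bounded_measurableM.
have bt phi : bounded_measurable phi -> bounded_measurable (time_int X Y (f phi) 0 1).
  by move=> /bf bphi; exact: (bounded_measurable_time_int hmodel).
have int g : bounded_measurable g -> P.-integrable setT (EFin \o g).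
  exact: bounded_measurable_P_integrable.
have fl z : `|f al z - f be z| <= (2 * b + 2 * a0) * D.
  have -> : f al z - f be z = (al z ^+ 2 - be z ^+ 2)
      - 2 * ((al z - be z) * @cube_intensity R k alpha0 z) by rewrite /f; ring.
  apply: (le_trans (ler_normB _ _)); rewrite [leRHS]mulrDl lerD//.
  rewrite normrM [`|2|]ger0_norm// -mulrA ler_wpM2l// normrM mulrC ler_pM//.
  by rewrite ger0_norm ?(cube_intensity_ge0 hmodel)// (cube_intensity_le hmodel).
rewrite lerBlDl -(P_integral_cst (P := P) ((2 * b + 2 * a0) * D)).
rewrite -(RintegralD measurableT (int _ (bt _ mbe)) (int _ (bounded_measurable_cst _))).
apply: le_Rintegral => //; first exact: (int _ (bt _ mal)).
  apply: int; apply: bounded_measurableD; [exact: bt|exact: bounded_measurable_cst].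
move=> w _; rewrite -lerBlDl -(time_intB hmodel _ _ _ (bf _ mal) (bf _ mbe)).
have := time_int_norm hmodel w (bounded_measurableB (bf _ mal) (bf _ mbe)) ler01 fl.
by rewrite subr0 mulr1; apply: le_trans; exact: ler_norm.
Qed.

End lipschitz.

Section sup_norm.
Context {R : realType} {k : nat}.
Implicit Types a : R * borel R k -> R.

Lemma sup_norm_le a (c : R) : 0 <= c -> (forall z, ~ time_cube z -> a z = 0) ->
  (sup_norm a <= c%:E)%E -> forall z, `|a z| <= c.
Proof.
move=> c0 aout ac z; have [z01|/aout ->] := pselect (time_cube z); last by rewrite normr0.
rewrite -lee_fin; apply: le_trans ac.
by apply: ereal_sup_ubound; exists z.
Qed.

Lemma sup_norm_ge0 a : (0 <= sup_norm a)%E.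
Proof.
(* The origin belongs to the cube in every dimension, so the supremum is over a nonempty set. *)
pose z : R * borel R k := (0, const_mx 0 : 'rV[R]_k).
apply: (@le_trans _ _ (`|a z|%:E)); first by rewrite lee_fin.
apply: ereal_sup_ubound; exists z => //; split => [|i] /=.
  by rewrite in_itv/= lexx ler01.
by rewrite mxE lexx ler01.
Qed.

End sup_norm.

Section empirical_process.
Context {R : realType} {k n : nat} {dT : measure_display} {T : measurableType dT}
  {P : probability T R} {F : R -> set (set T)}
  {alpha0 : R * borel R k -> R} {X : {RV P >-> borel R k}}
  {N : T -> cumulative R R} {Y : R -> T -> R}
  (hmodel : counting_model F alpha0 X N Y)
  {m : R * borel R k -> R} (hm : is_cond_mean X Y m)
  {a0 : R} (alpha0_le : forall z, time_cube z -> alpha0 z <= a0) (a00 : 0 <= a0)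
  {dS : measure_display} {S : measurableType dS} {Q : probability S R}
  {Xs : 'I_n -> S -> borel R k} {Ns : 'I_n -> S -> cumulative R R}
  {Ys : 'I_n -> R -> S -> R}
  (hiid : iid_copies P Q (fun w => observation (X w) (N w) (Y ^~ w))
     (fun i s => observation (Xs i s) (Ns i s) (Ys i ^~ s)))
  (n0 : (0 < n)%N) {A : set (R * borel R k -> R)}
  (hA : forall a, A a -> cube_function a)
  {b : R} (b0 : 0 < b) (hAb : forall a, A a -> (sup_norm a <= b%:E)%E)
  {astar : R * borel R k -> R} (hstar : A astar).

Local Notation K := (@deviation_const R a0 b).
Local Notation risk' := (risk P X N Y).
Local Notation emp := (empirical_risk Xs Ns Ys).

Definition deviation a s : R :=
  Num.sqrt n%:R * ((risk' a - risk' astar) - (emp a s - emp astar s)).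

Let Ab a : A a -> forall z, `|a z| <= b.
Proof. by move=> Aa; apply: sup_norm_le; [exact: ltW|case: (hA Aa)|exact: hAb]. Qed.

Let Aout a : A a -> forall z, ~ time_cube z -> a z = 0.
Proof. by move=> /hA[]. Qed.

Let Abm a : A a -> bounded_measurable a.
Proof. by move=> Aa; split; [have [] := hA Aa|exists b; exact: Ab]. Qed.

Let d_infty_le a a' D : A a -> A a' -> 0 < D -> (d_infty a a' <= D%:E)%E ->
  forall z, `|a z - a' z| <= D.
Proof.
move=> Aa Aa' D0; apply: sup_norm_le; first exact: ltW.
by move=> z hz; rewrite /= !Aout// subrr.
Qed.

Let d_2_le a a' sg : A a -> A a' -> 0 < sg -> (d_2 X m a a' <= sg%:E)%E ->
  \int[P]_w time_int X Y (fun z => (a z - a' z) ^+ 2) 0 1 w <= sg ^+ 2.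
Proof.
move=> Aa Aa' sg0; rewrite /d_2 lee_fin => h.
have bB : bounded_measurable (a \- a') by apply: bounded_measurableB; exact: Abm.
apply: (@le_trans _ _ (inner X m (a \- a') (a \- a'))).
  by rewrite -(mean_time_int_inner hmodel hm bB).
(* [Num.sqrt] sends negative numbers to 0, so the bound on [d_2] controls the inner product directly
   only when it is nonnegative. *)
have [i0|/ltW i0] := leP 0 (inner X m (a \- a') (a \- a')).
  by rewrite -[leLHS]sqr_sqrtr// lerXn2r// ?nnegrE ?sqrtr_ge0// ltW.
by rewrite (le_trans i0)// sqr_ge0.
Qed.

Let nR : 0 < n%:R :> R. Proof. by rewrite ltr0n. Qed.
Let sn0 : 0 < Num.sqrt n%:R :> R. Proof. by rewrite sqrtr_gt0. Qed.

Let devB a a' s : deviation a s - deviation a' s =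
  Num.sqrt n%:R * ((risk' a - risk' a') - (emp a s - emp a' s)).
Proof. by rewrite /deviation; ring. Qed.

(** On [observable] each copy is the observation of some [w] of the model; the number of jumps of
    that path gives the Lipschitz constant of its loss. *)
Let lip s : @observable R k n _ T P X N Y _ S Xs Ns Ys s -> exists2 M, 0 <= M &
  forall a a' D, A a -> A a' -> 0 < D -> (d_infty a a' <= D%:E)%E ->
    deviation a s - deviation a' s <= M * D.
Proof.
move=> os.
have /choice[c hc] : forall i, exists c : R, 0 <= c /\ forall a a' D, A a -> A a' -> 0 < D ->
    (forall z, `|a z - a' z| <= D) ->
    loss a (Xs i s) (Ys i ^~ s) (Ns i s) - loss a' (Xs i s) (Ys i ^~ s) (Ns i s) <= c * D.
  move=> i; have [w _ wE] := os i.
  exists (2 * b + 2 * (jump_count (N w) 1)%:R); split.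
    by rewrite addr_ge0 ?mulr_ge0// ltW.
  move=> a a' D Aa Aa' D0 hD; rewrite -!(loss_observation _ wE).
  by apply: (loss_lipschitz hmodel) => //; [exact: Abm|exact: Abm|exact: Ab|exact: Ab].
exists (Num.sqrt n%:R * ((2 * b + 2 * a0) + n%:R^-1 * \sum_(i < n) c i)).
  rewrite mulr_ge0 ?sqrtr_ge0// addr_ge0 ?mulr_ge0 ?addr_ge0 ?mulr_ge0 ?(ltW b0) ?invr_ge0//.
  by apply: sumr_ge0 => i _; case: (hc i).
move=> a a' D Aa Aa' D0 /(d_infty_le Aa Aa' D0) hD.
have hD' z : `|a' z - a z| <= D by rewrite distrC.
rewrite devB -mulrA ler_wpM2l ?sqrtr_ge0// mulrDl lerD//.
  by apply: (risk_lipschitz hmodel alpha0_le) => //;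
    [exact: Abm|exact: Abm|exact: Ab|exact: Ab|exact: Aout|exact: Aout].
rewrite opprB /empirical_risk -mulrBr -mulrA ler_wpM2l ?invr_ge0//.
rewrite mulr_suml -sumrB; apply: ler_sum => i _.
have [_ h] := hc i; exact: h.
Qed.

Lemma empirical_process_bound (AA BB : nat -> set (set (R * borel R k -> R)))
    (g2 g1 x e : R) :
  admissible A AA -> admissible A BB ->
  (forall a, A a -> (\sum_(0 <= j <oo)
     (2 `^ (j%:R / 2))%:E * diameter (d_2 X m) (pblock (AA j) id a) <= g2%:E)%E) ->
  (forall a, A a -> (\sum_(0 <= j <oo)
     (2 `^ (j%:R / 1))%:E * diameter (@d_infty R k) (pblock (BB j) id a) <= g1%:E)%E) ->
  43 / 100 <= x -> 0 < e ->
  exists E : set S, [/\ measurable E, ((1 - 3 / 2 * expR (- x))%:E <= Q E)%E &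
    forall s, E s -> forall a, A a ->
      deviation a s <= 10 / 3 * K * ((1 + Num.sqrt x) * (g2 + e)
                                     + (1 + x) / Num.sqrt n%:R * (g1 + e))].
Proof.
move=> hAA hBB hg2 hg1 x43 e0.
have K0 : 0 < K by exact: deviation_const_gt0.
pose G := @observable R k n _ T P X N Y _ S Xs Ns Ys.
have tail a a' sg D u : A a -> A a' -> 0 < sg -> 0 < D -> 0 < u ->
     (d_2 X m a a' <= sg%:E)%E -> (d_infty a a' <= D%:E)%E ->
     exists Bad, [/\ measurable Bad, (Q Bad <= (expR (- u))%:E)%E &
       forall s, G s -> ~ Bad s -> deviation a s - deviation a' s
         <= 2 * K * sg * Num.sqrt (2 * u) + 4 / 3 * K / Num.sqrt n%:R * D * u].
  move=> Aa Aa' sg0 D0 u0 /(d_2_le Aa Aa' sg0) h2 /(d_infty_le Aa Aa' D0) h1.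
  have [Bad [mBad QBad hBad]] := empirical_tail hmodel alpha0_le hiid n0 b0 a00
    (Abm Aa) (Abm Aa') (Ab Aa) (Ab Aa') (Aout Aa) (Aout Aa') D0 h1 sg0 h2 u0.
  exists Bad; split => // s Gs nBs; rewrite devB.
  have := hBad s Gs nBs.
  by rewrite (_ : 4 / 3 * K * D * u / _ = 4 / 3 * K / Num.sqrt n%:R * D * u)//; ring.
have d20 (a a' : R * borel R k -> R) : (0 <= d_2 X m a a')%E by rewrite lee_fin sqrtr_ge0.
have d10 (a a' : R * borel R k -> R) : (0 <= d_infty a a')%E by exact: sup_norm_ge0.
have Z0 s : G s -> deviation astar s = 0 by rewrite /deviation !subrr mulr0.
have c20 : 0 <= 2 * K by rewrite mulr_ge0// ltW.
have c10 : 0 <= 4 / 3 * K / Num.sqrt n%:R.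
  by rewrite divr_ge0 ?mulr_ge0 ?(ltW K0)// ltW.
have [Bad [mBad QBad hBad]] := chaining_bound hstar d20 d10 hAA hBB hg2 hg1
  c20 c10 tail lip Z0 x43 e0.
have mG : measurable G by exact: (measurable_observed hiid).
exists (G `\` Bad); split; first exact: measurableD.
  have QG : Q (~` G) = 0%E by exact: (observed_null hiid).
  have : (Q (~` (G `\` Bad)) <= (3 / 2 * expR (- x))%:E)%E.
    rewrite setCD; apply: (le_trans (measureU2 _ _ _)) => //; first exact: measurableC.
    by rewrite -[leRHS]add0e; apply: leeD => //; move: QG => /eqP; rewrite eq_le => /andP[].
  rewrite probability_setC; last exact: measurableD.
  have : Q (G `\` Bad) \is a fin_num by apply: fin_num_measure; exact: measurableD.
  move=> /fineK <-; rewrite -EFinB !lee_fin; lra.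
move=> s [Gs nBs] a Aa; apply: (le_trans (hBad s Gs nBs a Aa)).
by rewrite le_eqVlt; apply/orP; left; apply/eqP; field; rewrite lt0r_neq0.
Qed.

End empirical_process.

(** The multiples of [b + a0] match, 10/3 * 6/5 = 4, and so do the constants, 10/3 (1/4 + 1/3) +
    1/18 = 2. For sqrt a0 there remains 5/3 <= sqrt (sqrt 2 (sqrt 2 + 1)). *)
Lemma chaining_constant_ge {R : realType} (a0 b : R) : 0 <= a0 ->
  10 / 3 * @deviation_const R a0 b + 18^-1 <= chaining_constant b a0.
Proof.
move=> a00.
rewrite /chaining_constant /deviation_const /deviation_const_A /deviation_const_B.
have s2 : 1 <= Num.sqrt 2 :> R by rewrite -[leLHS]sqrtr1 ler_wsqrtr// ler1n.
have s22 : Num.sqrt 2 ^+ 2 = 2 :> R by rewrite sqr_sqrtr.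
have c0 : 0 <= Num.sqrt 2 * (Num.sqrt 2 + 1) :> R by rewrite mulr_ge0// addr_ge0// sqrtr_ge0.
rewrite [Num.sqrt (_ * a0)]sqrtrM//; set c := Num.sqrt (Num.sqrt 2 * _).
have c53 : 5 / 3 <= c.
  rewrite -[leLHS]ger0_norm; last by lra.
  by rewrite -sqrtr_sqr ler_wsqrtr//; nra.
have := sqrtr_ge0 a0; nra.
Qed.

Section chaining_gamma.
Context {R : realType} {V : Type} {A : set V} {d : V -> V -> \bar R} {nu : R}
  (d0 : forall a a', (0 <= d a a')%E).

Lemma chaining_gamma_ge0 a : A a -> (0 <= chaining_gamma nu A d)%E.
Proof.
move=> Aa; apply: le_ereal_inf_tmp => _ [AA adm <-].
apply: le_trans (ereal_sup_ubound _); last by exists a; first exact: Aa.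
apply: nneseries_ge0 => j _ _; rewrite mule_ge0 ?lee_fin ?powR_ge0//.
exact: (diameter_ge0 adm d0).
Qed.

Lemma chaining_gamma_lt (c : R) : (chaining_gamma nu A d < c%:E)%E ->
  exists2 AA, admissible A AA & forall a, A a -> (\sum_(0 <= j <oo)
    (2 `^ (j%:R / nu))%:E * diameter d (pblock (AA j) id a) <= c%:E)%E.
Proof.
move=> /ereal_inf_lt[_ [AA adm <-] /ltW h]; exists AA => // a Aa.
by apply: le_trans h; apply: ereal_sup_ubound; exists a.
Qed.

(** Level 0 of an admissible sequence is the single cell [A], with weight 1, so the functional
    dominates every distance in [A]. *)
Lemma chaining_gamma_eq0 a a' : A a -> A a' -> chaining_gamma nu A d = 0%E -> d a a' = 0%E.
Proof.
move=> Aa Aa' g0; apply/eqP; rewrite eq_le d0 andbT.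
apply/lee_addgt0Pr => e e0; rewrite add0e.
have [|AA adm h] := @chaining_gamma_lt e; first by rewrite g0 lte_fin.
apply: le_trans (h a Aa).
have [_ aa] := pblock_mem (admissible_partition adm 0) Aa.
apply: (le_trans (le_diameter d aa (pblock0 adm Aa Aa'))).
apply: (@le_trans _ _ (\sum_(0 <= j < 1)
    (2 `^ (j%:R / nu))%:E * diameter d (pblock (AA j) id a))%E).
  by rewrite big_nat1 mul0r powRr0 mul1e.
apply: nneseries_lim_ge => j _ _.
by rewrite mule_ge0 ?lee_fin ?powR_ge0 ?(diameter_ge0 adm d0).
Qed.

End chaining_gamma.

Theorem theorem1 (R : realType) :
  exists L : R,
    `|L - (1 + 545 / 10 ^+ 3 + 433 / 10 ^+ 6)| < (10 ^+ 6)^-1 /\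
    forall (k n : nat) (hn : (0 < n)%N)
      (dT : measure_display) (T : measurableType dT) (P : probability T R)
      (F : R -> set (set T)) (alpha0 : R * borel R k -> R)
      (X : {RV P >-> borel R k}) (N : T -> cumulative R R) (Y : R -> T -> R)
      (hmodel : counting_model F alpha0 X N Y)
      (m : R * borel R k -> R) (hm : is_cond_mean X Y m)
      (dS : measure_display) (S : measurableType dS) (Q : probability S R)
      (Xs : 'I_n -> S -> borel R k) (Ns : 'I_n -> S -> cumulative R R)
      (Ys : 'I_n -> R -> S -> R)
      (hiid : iid_copies P Q
         (fun w => observation (X w) (N w) (Y ^~ w))
         (fun i s => observation (Xs i s) (Ns i s) (Ys i ^~ s)))
      (A : set (R * borel R k -> R))
      (hA : forall a, A a -> cube_function a)
      (hA' : exists A' : set (R * borel R k -> R),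
         [/\ countable A', A' `<=` A &
             {ae Q, forall s,
                ereal_sup [set (empirical_risk Xs Ns Ys a s)%:E | a in A'] =
                ereal_sup [set (empirical_risk Xs Ns Ys a s)%:E | a in A]}])
      (b : R) (hb : 0 < b)
      (hAb : forall a, A a -> (sup_norm a <= b%:E)%E)
      (hsupp : measure_support (distribution P X) = @unit_cube R k)
      (halpha0 : (sup_norm alpha0 < +oo)%E)
      (rho : R) (hrho : 0 < rho) (astar : R * borel R k -> R)
      (hastar : is_target (risk P X N Y) A rho astar)
      (x : R) (hx : 0 < x),
    exists E : set S,
      [/\ measurable E,
          ((1 - L * expR (- x))%:E < Q E)%E &
          forall s, E s ->
            (ereal_sup
               [set (Num.sqrt n%:R *
                     ((risk P X N Y a - risk P X N Y astar)
                      - (empirical_risk Xs Ns Ys a s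
                         - empirical_risk Xs Ns Ys astar s)))%:E | a in A]
             <= (chaining_constant b (fine (sup_norm alpha0)))%:E
                * (chaining_gamma 2 A (d_2 X m) * (1 + Num.sqrt x)%:E
                   + chaining_gamma 1 A (@d_infty R k)
                     * ((1 + x) / Num.sqrt n%:R)%:E))%E].
Proof.
pose L : R := 1 + 545 / 10 ^+ 3 + 433 / 10 ^+ 6.
exists L; split=> [|k n hn dT T P F alpha0 X N Y hmodel m hm dS S Q Xs Ns Ys hiid A hA _ b hb
    hAb _ halpha0 rho _ astar hastar x hx].
  by rewrite subrr normr0 invr_gt0 exprn_gt0.
have hstar : A astar by case: hastar.
have L0 : 3 / 2 < L by rewrite /L; lra.
pose a0 := fine (sup_norm alpha0).
have a0E : sup_norm alpha0 = a0%:E by rewrite fineK// ge0_fin_numE// sup_norm_ge0.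
have a00 : 0 <= a0 by rewrite fine_ge0// sup_norm_ge0.
have alpha0_le z : time_cube z -> alpha0 z <= a0.
  move=> z01; apply: (le_trans (ler_norm _)); rewrite -lee_fin -a0E.
  by apply: ereal_sup_ubound; exists z.
have d20 (a a' : R * borel R k -> R) : (0 <= d_2 X m a a')%E by rewrite lee_fin sqrtr_ge0.
have d10 (a a' : R * borel R k -> R) : (0 <= d_infty a a')%E by exact: sup_norm_ge0.
have G20 : (0 <= chaining_gamma 2 A (d_2 X m))%E := chaining_gamma_ge0 d20 hstar.
have G10 : (0 <= chaining_gamma 1 A (@d_infty R k))%E := chaining_gamma_ge0 d10 hstar.
set Gam2 := chaining_gamma 2 A _ in G20 *.
set Gam1 := chaining_gamma 1 A _ in G10 *.
set C := chaining_constant _ _.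
pose K := 10 / 3 * @deviation_const R a0 b.
have K0 : 0 < K by rewrite mulr_gt0// deviation_const_gt0.
have KC : K + 18^-1 <= C by exact: chaining_constant_ge.
have C0 : 0 < C by lra.
pose p := 1 + Num.sqrt x; pose q := (1 + x) / Num.sqrt n%:R.
have p0 : 0 < p by rewrite ltr_wpDr ?sqrtr_ge0.
have q0 : 0 < q by rewrite divr_gt0 ?addr_gt0 ?sqrtr_gt0 ?ltr0n.
rewrite -/p -/q.
have ex0 := expR_gt0 (- x).
have [x43|x43] := ltP x (43 / 100).
  exists set0; split; [exact: measurable0| |by []].
  rewrite measure0 lte_fin subr_lt0 expRN -ltr_pdivrMr ?invr_gt0 ?expR_gt0// invrK mul1r.
  by apply: lt_trans expR_43_lt; rewrite ltr_expR.
have QT : ((1 - L * expR (- x))%:E < Q setT)%E.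
  by rewrite probability_setT lte_fin gtrBl mulr_gt0//; lra.
(* With an infinite functional the right-hand side is +oo: the factors are positive and the other
   summand is nonnegative. *)
have [G2|G2] := eqVneq Gam2 +oo%E.
  exists setT; split => // s _; rewrite G2 gt0_mulye ?lte_fin//.
  rewrite addye ?gt0_muley ?lte_fin ?leey//.
  by rewrite gt_eqF// (lt_le_trans _ (mule_ge0 G10 _))// lee_fin ltW.
have [G1|G1] := eqVneq Gam1 +oo%E.
  exists setT; split => // s _; rewrite G1 [(+oo * _)%E]gt0_mulye ?lte_fin//.
  rewrite addey ?gt0_muley ?lte_fin ?leey//.
  by rewrite gt_eqF// (lt_le_trans _ (mule_ge0 G20 _))// lee_fin ltW.
pose g2 := fine Gam2.
pose g1 := fine Gam1.
have G2f : Gam2 \is a fin_num by rewrite (ge0_fin_numE G20) lt_neqAle G2 leey.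
have G2E : Gam2 = g2%:E := esym (fineK G2f).
have G1f : Gam1 \is a fin_num by rewrite (ge0_fin_numE G10) lt_neqAle G1 leey.
have G1E : Gam1 = g1%:E := esym (fineK G1f).
have g20 : 0 <= g2 := fine_ge0 G20.
have g10 : 0 <= g1 := fine_ge0 G10.
rewrite G2E G1E -!EFinM.
have S0 : 0 <= g2 * p + g1 * q.
  exact: addr_ge0 (mulr_ge0 g20 (ltW p0)) (mulr_ge0 g10 (ltW q0)).
(* If [g1] vanishes, [A] consists of [astar] alone and the deviation is 0; otherwise [g1 * q > 0]
   leaves room for a positive [e]. *)
have [g1z|g1z] := eqVneq g1 0.
  exists setT; split => // s _; apply: ge_ereal_sup => _ [a Aa <-].
  have -> : a = astar.
    apply/funext => z; apply/eqP; rewrite -subr_eq0 -normr_le0.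
    apply: (@sup_norm_le _ _ (a \- astar)) => //.
      by move=> z' hz'; rewrite /= (proj2 (hA _ Aa))// (proj2 (hA _ hstar))// subrr.
    have := @chaining_gamma_eq0 _ _ A (@d_infty R k) 1 d10 a astar Aa hstar (etrans G1E (congr1 EFin g1z)).
    by rewrite /d_infty => ->.
  rewrite !subrr mulr0 lee_fin; exact: mulr_ge0 (ltW C0) S0.
have g1p : 0 < g1 by rewrite lt0r g1z.
(* [e] enters twice, through the nearly optimal sequences and through [scale]. The resulting excess
   2 K e (p + q) equals g1 q / 18, which the margin 1/18 of [chaining_constant_ge] covers. *)
pose e := g1 * q / (36 * K * (p + q)).
have pq0 : 0 < p + q by rewrite addr_gt0.
have e0 : 0 < e.
  exact: divr_gt0 (mulr_gt0 g1p q0) (mulr_gt0 (mulr_gt0 (ltr0Sn _ 35) K0) pq0).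
have eE : K * (e * (p + q)) = g1 * q / 36 by rewrite /e; field; rewrite !lt0r_neq0.
have [|AA hAA sAA] := @chaining_gamma_lt _ _ A (d_2 X m) 2 (g2 + e).
  by rewrite -/Gam2 G2E lte_fin ltrDl.
have [|BB hBB sBB] := @chaining_gamma_lt _ _ A (@d_infty R k) 1 (g1 + e).
  by rewrite -/Gam1 G1E lte_fin ltrDl.
have [E [mE QE hE]] := empirical_process_bound hmodel hm alpha0_le a00 hiid hn hA hb hAb hstar
  hAA hBB sAA sBB x43 e0.
exists E; split => //.
  (* The failure bound has the factor 3/2, strictly below L; this gives the strict inequality. *)
  apply: lt_le_trans QE; rewrite lte_fin ltrD2l ltrN2 ltr_pM2r//.
move=> s Es; apply: ge_ereal_sup => _ [a Aa <-]; rewrite lee_fin.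
apply: (le_trans (hE s Es a Aa)); rewrite -/K -/p -/q.
have -> : K * (p * (g2 + e + e) + q * (g1 + e + e))
    = K * (g2 * p + g1 * q) + 2 * (K * (e * (p + q))) by ring.
rewrite eE; apply: (@le_trans _ _ ((K + 18^-1) * (g2 * p + g1 * q))).
  rewrite [leRHS]mulrDl lerD2l; have := mulr_ge0 g20 (ltW p0); lra.
exact: ler_wpM2r.
Qed.
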